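(* Let $i\in I$, $l>0$ and $\nu\in\mathbb N^I$ with $\nu_i\ge l$. There exist a variety $\check\Lambda(\nu)_{i,l}$ and a diagram $$\Lambda(\nu)_{i,l}\xleftarrow{\;q_{i,l}\;}\check\Lambda(\nu)_{i,l}\xrightarrow{\;p_{i,l}\;}\Lambda(\nu-le_i)_{i,0}\times\Lambda(le_i)$$ such that $p_{i,l}$ and $q_{i,l}$ are smooth with connected fibers, inducing a bijection $$\operatorname{Irr}\Lambda(\nu)_{i,l}\ \xrightarrow{\ \sim\ }\ \operatorname{Irr}\Lambda(\nu-le_i)_{i,0}\times\operatorname{Irr}\Lambda(le_i).$$
   Context: $Q=(I,\Omega)$ is an arbitrary finite quiver, possibly with loops and multiple arrows; $h\in\Omega$ goes from $s(h)$ to $t(h)$. For $h\in\Omega$ let $\bar h:t(h)\to s(h)$ be the opposite arrow, $\bar\Omega=\{\bar h\}$, $H=\Omega\sqcup\bar\Omega$, $\bar{\bar h}=h$; $\epsilon(h)=1$ on $\Omega$ and $-1$ on $\bar\Omega$. $e_i=(\delta_{i,j})_{j\in I}$. For $\nu\in\mathbb N^I$ fix an $I$-graded $\mathbb C$-vector space $V_\nu$ of dimension $\nu$; $\bar E_\nu=\bigoplus_{h\in H}\operatorname{Hom}((V_\nu)_{s(h)},(V_\nu)_{t(h)})$ and $\mu_\nu(x)=\sum_{h\in H}\epsilon(h)x_{\bar h}x_h$. $x\in\bar E_\nu$ is seminilpotent if there is a flag $V_\nu=\mathsf W_0\supset\dots\supset\mathsf W_r=\{0\}$ of $I$-graded subspaces,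 each quotient $\mathsf W_k/\mathsf W_{k+1}$ being concentrated at a single vertex, with $x_h(\mathsf W_k)\subseteq\mathsf W_{k+1}$ for $h\in\Omega$ and $x_h(\mathsf W_k)\subseteq\mathsf W_k$ for $h\in\bar\Omega$. $\Lambda(\nu)=\{x\in\mu_\nu^{-1}(0)\mid x\text{ seminilpotent}\}$. For $x\in\Lambda(\nu)$, $\mathfrak I_i(x)\subseteq V_\nu$ is the smallest $x$-stable $I$-graded subspace containing $\bigoplus_{j\ne i}(V_\nu)_j$, and for $l\ge0$, $\Lambda(\nu)_{i,l}=\{x\in\Lambda(\nu)\mid\operatorname{codim}\mathfrak I_i(x)=le_i\}$ (graded codimension). $\operatorname{Irr}$ denotes the set of irreducible components. The bijection induced by the diagram matches $Z$ with $(Z_1,Z_2)$ when $q_{i,l}^{-1}(Z)=p_{i,l}^{-1}(Z_1\times Z_2)$. *)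

(* Defs.v *)
From HB Require Import structures.
From mathcomp Require Import all_boot all_order all_algebra.
From mathcomp Require Import boolp classical_sets functions reals topology.
From mathcomp Require Import complex.
From mathcomp Require mpoly.
(* The notations of mpoly clash with those of mathcomp-analysis. *)
Import -(notations) mpoly.

Set Implicit Arguments.
Unset Strict Implicit.
Unset Printing Implicit Defensive.

Import GRing.Theory.

Local Open Scope classical_set_scope.
Local Open Scope ring_scope.

(** * Spaces with functions

   Reduced algebraic geometry over a field K, in the language of Kempf,
   "Algebraic Varieties", chapter 1: a space with functions is a topological
   space with a sheaf of K-algebras of K-valued functions such that, for f
   regular on U, the locus where f does not vanish is open and 1/f is regular
   on it. *)

(* [regular U f] means that the restriction of f to U is regular: the values
   of f outside U are irrelevant, by [regular_local]. It is only meaningful for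
   U open. *)
Record kspace (K : fieldType) := KSpace {
  ksort :> topologicalType ;
  regular : set ksort -> (ksort -> K) -> Prop ;
  regular_restr : forall U V f,
    open U -> open V -> V `<=` U -> regular U f -> regular V f ;
  regular_local : forall U f, open U ->
    (forall x, U x -> exists V g,
       [/\ open V, V x, regular V g & forall y, U y -> V y -> f y = g y]) ->
    regular U f ;
  regular_cst : forall U a, open U -> regular U (fun=> a) ;
  regularD : forall U f g, open U ->
    regular U f -> regular U g -> regular U (fun x => f x + g x) ;
  regularM : forall U f g, open U ->
    regular U f -> regular U g -> regular U (fun x => f x * g x) ;
  regularV : forall U f, open U -> regular U f ->
    open (U `&` [set x | f x != 0]) /\
    regular (U `&` [set x | f x != 0]) (fun x => (f x)^-1)
}.

Definition is_morphism (K : fieldType) (X Y : kspace K) (f : X -> Y) : Prop :=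
  continuous f /\
  forall V g, open V -> regular V g -> regular (f @^-1` V) (g \o f).

Definition is_iso (K : fieldType) (X Y : kspace K) (f : X -> Y) : Prop :=
  is_morphism f /\
  exists g : Y -> X, [/\ is_morphism g, cancel f g & cancel g f].

Lemma open_local (T : topologicalType) (A : set T) :
  (forall x, A x -> exists B, [/\ open B, B x & B `<=` A]) -> open A.
Proof.
move=> h; rewrite openE => x /h [B [oB Bx BA]].
by apply: filterS BA _; exact: open_nbhs_nbhs.
Qed.

Section Zariski.
Variables (K : fieldType) (n : nat) (E : Type) (c : E -> 'I_n -> K).

(* E with the Zariski structure defined by the coordinates c; this is affine
   n-space when c is a bijection between E and K^n. *)
Definition zariski of (E -> 'I_n -> K) : Type := E.

HB.instance Definition _ := gen_eqMixin (zariski c).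
HB.instance Definition _ := gen_choiceMixin (zariski c).

Definition zariski_open (A : set (zariski c)) : Prop :=
  forall x, A x -> exists p : mpoly n K,
    meval (c x) p != 0 /\ forall y, meval (c y) p != 0 -> A y.

Lemma zariski_openT : zariski_open setT.
Proof. by move=> x _; exists 1; rewrite meval1 oner_neq0. Qed.

Lemma zariski_openI : setI_closed zariski_open.
Proof.
move=> A B oA oB x [/oA[p [px pA]] /oB[q [qx qB]]].
exists (p * q); split; first by rewrite mevalM mulf_neq0.
by move=> y; rewrite mevalM mulf_eq0 negb_or => /andP[/pA Ay /qB By].
Qed.

Lemma zariski_open_bigU (J : Type) (f : J -> set (zariski c)) :
  (forall j, zariski_open (f j)) -> zariski_open (\bigcup_j f j).
Proof.
move=> of_ x [j _ /of_[p [px pf]]]; exists p; split=> // y /pf fy.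
by exists j.
Qed.

HB.instance Definition _ := isOpenTopological.Build (zariski c)
  zariski_openT zariski_openI zariski_open_bigU.

Definition zariski_regular (U : set (zariski c)) (f : zariski c -> K) : Prop :=
  forall x, U x -> exists p q : mpoly n K,
    meval (c x) q != 0 /\
    forall y, U y -> meval (c y) q != 0 -> f y = meval (c y) p / meval (c y) q.

Lemma zariski_openP (U : set (zariski c)) : open U <-> zariski_open U.
Proof. by []. Qed.

Lemma zariski_restr U V f : open U -> open V -> V `<=` U ->
  zariski_regular U f -> zariski_regular V f.
Proof.
move=> _ _ VU rf x /VU /rf [p [q [qx h]]]; exists p, q; split=> // y /VU.
exact: h.
Qed.

Lemma zariski_local U f : open U ->
  (forall x, U x -> exists V g,
     [/\ open V, V x, zariski_regular V g &
         forall y, U y -> V y -> f y = g y]) ->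
  zariski_regular U f.
Proof.
move=> _ h x Ux; have [V [g [/zariski_openP oV Vx rg fg]]] := h _ Ux.
have [r [rx rV]] := oV _ Vx; have [p [q [qx pq]]] := rg _ Vx.
exists (p * r), (q * r); split; first by rewrite mevalM mulf_neq0.
move=> y Uy; rewrite !mevalM mulf_eq0 negb_or => /andP[qy ry].
by rewrite fg ?pq ?rV//; [rewrite -mulf_div divff ?mulr1|exact: rV..].
Qed.

Lemma zariski_cst U a : open U -> zariski_regular U (fun=> a).
Proof.
move=> _ x _; exists (mpolyC n a), 1; rewrite meval1 oner_neq0; split=> // y _ _.
by rewrite mevalC meval1 divr1.
Qed.

Lemma zariskiD U f g : open U -> zariski_regular U f -> zariski_regular U g ->
  zariski_regular U (fun x => f x + g x).
Proof.
move=> _ rf rg x Ux; have [p [q [qx h]]] := rf _ Ux.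
have [p' [q' [q'x h']]] := rg _ Ux; exists (p * q' + p' * q), (q * q').
split; first by rewrite mevalM mulf_neq0.
move=> y Uy; rewrite mevalD !mevalM mulf_eq0 negb_or => /andP[qy q'y].
by rewrite h// h'// addf_div.
Qed.

Lemma zariskiM U f g : open U -> zariski_regular U f -> zariski_regular U g ->
  zariski_regular U (fun x => f x * g x).
Proof.
move=> _ rf rg x Ux; have [p [q [qx h]]] := rf _ Ux.
have [p' [q' [q'x h']]] := rg _ Ux; exists (p * p'), (q * q').
split; first by rewrite mevalM mulf_neq0.
move=> y Uy; rewrite !mevalM mulf_eq0 negb_or => /andP[qy q'y].
by rewrite h// h'// mulf_div.
Qed.

Lemma zariskiV U f : open U -> zariski_regular U f ->
  open (U `&` [set x | f x != 0]) /\
  zariski_regular (U `&` [set x | f x != 0]) (fun x => (f x)^-1).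
Proof.
move=> /zariski_openP oU rf; split.
  apply/zariski_openP => x [Ux fx].
  have [r [rx rU]] := oU _ Ux; have [p [q [qx h]]] := rf _ Ux.
  have px : meval (c x) p != 0.
    by apply: contraNneq fx => px; rewrite h// px mul0r.
  exists (p * q * r); split; first by rewrite !mevalM !mulf_neq0.
  move=> y; rewrite !mevalM !mulf_eq0 !negb_or => /andP[/andP[py qy] /rU Uy].
  by split=> //=; rewrite h// mulf_neq0 ?invr_eq0.
move=> x [Ux fx]; have [p [q [qx h]]] := rf _ Ux.
have px : meval (c x) p != 0 by apply: contraNneq fx => px; rewrite h// px mul0r.
exists (q * q), (p * q); split; first by rewrite mevalM mulf_neq0.
move=> y [Uy fy]; rewrite !mevalM mulf_eq0 negb_or => /andP[py qy].
by rewrite h// invf_div -mulf_div divff// mulr1.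
Qed.

Definition zariski_space : kspace K := KSpace zariski_restr zariski_local
  zariski_cst zariskiD zariskiM zariskiV.

End Zariski.

Definition affine_space (K : fieldType) (n : nat) : kspace K :=
  zariski_space (fun v : 'rV[K]_n => v 0).

Section Subspace.
Variables (K : fieldType) (X : kspace K) (A : set X).

Definition sub_regular (U : set A) (f : A -> K) : Prop :=
  forall a, U a -> exists W g, [/\ open W, W (val a), regular W g &
    forall b : A, U b -> W (val b) -> f b = g (val b)].

Lemma sub_openP (U : set A) :
  open U <-> exists2 W : set X, open W & [set a | W (val a)] = U.
Proof. by []. Qed.

Lemma sub_restr U V f : open U -> open V -> V `<=` U ->
  sub_regular U f -> sub_regular V f.
Proof.
move=> _ _ VU rf a /VU /rf [W [g [oW Wa rg fg]]].
by exists W, g; split=> // b /VU; exact: fg.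
Qed.

Lemma sub_local U f : open U ->
  (forall x, U x -> exists V g,
     [/\ open V, V x, sub_regular V g & forall y, U y -> V y -> f y = g y]) ->
  sub_regular U f.
Proof.
move=> _ h a Ua; have [V [g [/sub_openP[W oW WV] Va rg fg]]] := h _ Ua.
have [W' [g' [oW' W'a rg' gg']]] := rg _ Va; exists (W `&` W'), g'.
have Wa : W (val a) by move: Va; rewrite -WV.
have oWW' : open (W `&` W') by exact: openI.
split=> //; first by apply: regular_restr rg' => // x [].
move=> b Ub [Wb W'b]; have Vb : V b by rewrite -WV.
by rewrite fg// gg'.
Qed.

Lemma sub_cst U a : open U -> sub_regular U (fun=> a).
Proof.
move=> _ x _; exists setT, (fun=> a).
by split=> //; [exact: openT|apply: regular_cst; exact: openT].
Qed.

Lemma subD U f g : open U -> sub_regular U f -> sub_regular U g ->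
  sub_regular U (fun x => f x + g x).
Proof.
move=> _ rf rg a Ua; have [W [f' [oW Wa rf' ff']]] := rf _ Ua.
have [W' [g' [oW' W'a rg' gg']]] := rg _ Ua.
have oWW' : open (W `&` W') by exact: openI.
exists (W `&` W'), (fun x => f' x + g' x); split=> //.
  by apply: regularD => //;
    [apply: regular_restr rf'|apply: regular_restr rg'] => // x [].
by move=> b Ub [Wb W'b]; rewrite ff'// gg'.
Qed.

Lemma subM U f g : open U -> sub_regular U f -> sub_regular U g ->
  sub_regular U (fun x => f x * g x).
Proof.
move=> _ rf rg a Ua; have [W [f' [oW Wa rf' ff']]] := rf _ Ua.
have [W' [g' [oW' W'a rg' gg']]] := rg _ Ua.
have oWW' : open (W `&` W') by exact: openI.
exists (W `&` W'), (fun x => f' x * g' x); split=> //.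
  by apply: regularM => //;
    [apply: regular_restr rf'|apply: regular_restr rg'] => // x [].
by move=> b Ub [Wb W'b]; rewrite ff'// gg'.
Qed.

Lemma subV U f : open U -> sub_regular U f ->
  open (U `&` [set x | f x != 0]) /\
  sub_regular (U `&` [set x | f x != 0]) (fun x => (f x)^-1).
Proof.
move=> oU rf; split.
  apply: open_local => a [Ua fa]; have [W [g [oW Wa rg fg]]] := rf _ Ua.
  have [oWg _] := regularV oW rg.
  exists (U `&` [set b : A | (W `&` [set x | g x != 0]) (val b)]).
  split; last by move=> b [Ub [/= Wb gb]]; split=> //=; rewrite fg.
    by apply: openI => //; apply/sub_openP; exists (W `&` [set x | g x != 0]).
  by split=> //=; split=> //=; rewrite -fg.
move=> a [Ua fa]; have [W [g [oW Wa rg fg]]] := rf _ Ua.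
have [oWg rgV] := regularV oW rg.
exists (W `&` [set x | g x != 0]), (fun x => (g x)^-1); split=> //.
  by split=> //=; rewrite -fg.
by move=> b [Ub fb] [Wb gb]; rewrite fg.
Qed.

(* The structure induced by X on A, i.e. the reduced one when X is a variety
   and A is locally closed. *)
Definition sub_space : kspace K :=
  @KSpace K A sub_regular sub_restr sub_local sub_cst subD subM subV.

End Subspace.

Section Product.
Variables (K : fieldType) (X Y : kspace K).

Definition prod_type : Type := (X * Y)%type.

HB.instance Definition _ := Choice.on prod_type.

(* The algebra of functions on U x V generated by (the pullbacks of) the
   regular functions on U and on V. *)
Inductive tensor (U : set X) (V : set Y) : (prod_type -> K) -> Prop :=
| tensorl f : regular U f -> tensor U V (fun z => f z.1)
| tensorr g : regular V g -> tensor U V (fun z => g z.2)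
| tensorD f g : tensor U V f -> tensor U V g -> tensor U V (fun z => f z + g z)
| tensorM f g : tensor U V f -> tensor U V g -> tensor U V (fun z => f z * g z).

Lemma tensor_cst U V a : open U -> tensor U V (fun=> a).
Proof. by move=> oU; apply: (tensorl V (regular_cst a oU)). Qed.

Lemma tensor_restr U V U' V' f : open U -> open V -> open U' -> open V' ->
  U' `<=` U -> V' `<=` V -> tensor U V f -> tensor U' V' f.
Proof.
move=> oU oV oU' oV' sU sV; elim=> [g rg|g rg|g h _ ? _ ?|g h _ ? _ ?].
- by apply: (tensorl V'); exact: regular_restr rg.
- by apply: (tensorr U'); exact: regular_restr rg.
- exact: tensorD.
- exact: tensorM.
Qed.

(* The sets {(x, y) in U x V | c(x, y) != 0}, for c in [tensor U V], are a
   basis of the topology. *)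
Definition prod_open (W : set prod_type) : Prop :=
  forall z, W z -> exists U V c, [/\ open U, open V & tensor U V c] /\
    [/\ U z.1, V z.2, c z != 0 &
        forall w : prod_type, U w.1 -> V w.2 -> c w != 0 -> W w].

Lemma prod_openT : prod_open setT.
Proof.
move=> z _; exists setT, setT, (fun=> 1); split; split=> //.
- exact: openT.
- exact: openT.
- by apply: tensor_cst; exact: openT.
- exact: oner_neq0.
Qed.

Lemma prod_openI : setI_closed prod_open.
Proof.
move=> A B oA oB z [/oA[U [V [c [[oU oV tc] [Uz Vz cz cA]]]]]].
move=> /oB[U' [V' [c' [[oU' oV' tc'] [U'z V'z c'z c'B]]]]].
have oUU' : open (U `&` U') by exact: openI.
have oVV' : open (V `&` V') by exact: openI.
exists (U `&` U'), (V `&` V'), (fun z => c z * c' z); split; split=> //.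
- by apply: tensorM; [apply: tensor_restr tc|apply: tensor_restr tc'] => // x [].
- by rewrite mulf_neq0.
- move=> w [Uw U'w] [Vw V'w]; rewrite mulf_eq0 negb_or => /andP[cw c'w].
  by split; [exact: cA|exact: c'B].
Qed.

Lemma prod_open_bigU (J : Type) (f : J -> set prod_type) :
  (forall j, prod_open (f j)) -> prod_open (\bigcup_j f j).
Proof.
move=> of_ z [j _ /of_[U [V [c [h [Uz Vz cz cf]]]]]].
exists U, V, c; split=> //; split=> // w Uw Vw cw; exists j => //; exact: cf.
Qed.

HB.instance Definition _ := isOpenTopological.Build prod_type
  prod_openT prod_openI prod_open_bigU.

Lemma prod_openP (W : set prod_type) : open W <-> prod_open W.
Proof. by []. Qed.

Definition prod_regular (W : set prod_type) (f : prod_type -> K) : Prop :=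
  forall z, W z -> exists U V c d,
    [/\ open U, open V, tensor U V c & tensor U V d] /\
    [/\ U z.1, V z.2, d z != 0 &
        forall w, W w -> U w.1 -> V w.2 -> d w != 0 -> f w = c w / d w].

Lemma prod_restr W W' f : open W -> open W' -> W' `<=` W ->
  prod_regular W f -> prod_regular W' f.
Proof.
move=> _ _ sW rf z /sW /rf [U [V [c [d [h [Uz Vz dz fcd]]]]]].
by exists U, V, c, d; split=> //; split=> // w /sW; exact: fcd.
Qed.

Lemma prod_local W f : open W ->
  (forall x, W x -> exists V g,
     [/\ open V, V x, prod_regular V g & forall y, W y -> V y -> f y = g y]) ->
  prod_regular W f.
Proof.
move=> _ h z Wz; have [W' [g [/prod_openP oW' W'z rg fg]]] := h _ Wz.
have [U [V [e [[oU oV te] [Uz Vz ez eW']]]]] := oW' _ W'z.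
have [U' [V' [c [d [[oU' oV' tc td] [U'z V'z dz gcd]]]]]] := rg _ W'z.
have oUU' : open (U `&` U') by exact: openI.
have oVV' : open (V `&` V') by exact: openI.
have te' : tensor (U `&` U') (V `&` V') e by apply: tensor_restr te => // x [].
exists (U `&` U'), (V `&` V'), (fun z => c z * e z), (fun z => d z * e z).
split; split=> //.
- by apply: tensorM => //; apply: tensor_restr tc => // x [].
- by apply: tensorM => //; apply: tensor_restr td => // x [].
- by rewrite mulf_neq0.
- move=> w Ww [Uw U'w] [Vw V'w]; rewrite mulf_eq0 negb_or => /andP[dw ew].
  have W'w : W' w by exact: eW'.
  by rewrite fg// gcd// -mulf_div divff// mulr1.
Qed.

Lemma prod_cst W a : open W -> prod_regular W (fun=> a).
Proof.
move=> _ z _; exists setT, setT, (fun=> a), (fun=> 1).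
split; split=> //; rewrite ?oner_neq0//; do ?exact: openT.
- by apply: tensor_cst; exact: openT.
- by apply: tensor_cst; exact: openT.
- by move=> *; rewrite divr1.
Qed.

Lemma prodD W f g : open W -> prod_regular W f -> prod_regular W g ->
  prod_regular W (fun z => f z + g z).
Proof.
move=> _ rf rg z Wz.
have [U [V [c [d [[oU oV tc td] [Uz Vz dz fcd]]]]]] := rf _ Wz.
have [U' [V' [c' [d' [[oU' oV' tc' td'] [U'z V'z d'z gcd]]]]]] := rg _ Wz.
have oUU' : open (U `&` U') by exact: openI.
have oVV' : open (V `&` V') by exact: openI.
have {tc} tc : tensor (U `&` U') (V `&` V') c by apply: tensor_restr tc => // x [].
have {td} td : tensor (U `&` U') (V `&` V') d by apply: tensor_restr td => // x [].
have {tc'} tc' : tensor (U `&` U') (V `&` V') c' by apply: tensor_restr tc' => // x [].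
have {td'} td' : tensor (U `&` U') (V `&` V') d' by apply: tensor_restr td' => // x [].
exists (U `&` U'), (V `&` V'), (fun z => c z * d' z + c' z * d z).
exists (fun z => d z * d' z); split; split=> //.
- by apply: tensorD; exact: tensorM.
- exact: tensorM.
- by rewrite mulf_neq0.
- move=> w Ww [Uw U'w] [Vw V'w]; rewrite mulf_eq0 negb_or => /andP[dw d'w].
  by rewrite fcd// gcd// addf_div.
Qed.

Lemma prodM W f g : open W -> prod_regular W f -> prod_regular W g ->
  prod_regular W (fun z => f z * g z).
Proof.
move=> _ rf rg z Wz.
have [U [V [c [d [[oU oV tc td] [Uz Vz dz fcd]]]]]] := rf _ Wz.
have [U' [V' [c' [d' [[oU' oV' tc' td'] [U'z V'z d'z gcd]]]]]] := rg _ Wz.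
have oUU' : open (U `&` U') by exact: openI.
have oVV' : open (V `&` V') by exact: openI.
exists (U `&` U'), (V `&` V'), (fun z => c z * c' z), (fun z => d z * d' z).
split; split=> //.
- by apply: tensorM; [apply: tensor_restr tc|apply: tensor_restr tc'] => // x [].
- by apply: tensorM; [apply: tensor_restr td|apply: tensor_restr td'] => // x [].
- by rewrite mulf_neq0.
- move=> w Ww [Uw U'w] [Vw V'w]; rewrite mulf_eq0 negb_or => /andP[dw d'w].
  by rewrite fcd// gcd// mulf_div.
Qed.

Lemma prodV W f : open W -> prod_regular W f ->
  open (W `&` [set x | f x != 0]) /\
  prod_regular (W `&` [set x | f x != 0]) (fun x => (f x)^-1).
Proof.
move=> /prod_openP oW rf; split.
  apply/prod_openP => z [Wz fz].
  have [U [V [e [[oU oV te] [Uz Vz ez eW]]]]] := oW _ Wz.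
  have [U' [V' [c [d [[oU' oV' tc td] [U'z V'z dz fcd]]]]]] := rf _ Wz.
  have oUU' : open (U `&` U') by exact: openI.
  have oVV' : open (V `&` V') by exact: openI.
  have cz : c z != 0 by apply: contraNneq fz => cz; rewrite fcd// cz mul0r.
  exists (U `&` U'), (V `&` V'), (fun z => e z * (c z * d z)).
  split; split=> //.
  - apply: tensorM; first by apply: tensor_restr te => // x [].
    by apply: tensorM; [apply: tensor_restr tc|apply: tensor_restr td] => // x [].
  - by rewrite !mulf_neq0.
  - move=> w [Uw U'w] [Vw V'w]; rewrite !mulf_eq0 !negb_or.
    move=> /and3P[ew cw dw]; have Ww : W w by exact: eW.
    by split=> //=; rewrite fcd// mulf_neq0 ?invr_eq0.
move=> z [Wz fz]; have [U [V [c [d [[oU oV tc td] [Uz Vz dz fcd]]]]]] := rf _ Wz.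
have cz : c z != 0 by apply: contraNneq fz => cz; rewrite fcd// cz mul0r.
exists U, V, (fun z => d z * d z), (fun z => c z * d z); split; split=> //.
- exact: tensorM.
- exact: tensorM.
- by rewrite mulf_neq0.
- move=> w [Ww fw] Uw Vw; rewrite mulf_eq0 negb_or => /andP[cw dw].
  by rewrite fcd// invf_div -mulf_div divff// mulr1.
Qed.

(* The product in the category of spaces with functions. *)
Definition prod_space : kspace K := KSpace prod_restr prod_local
  prod_cst prodD prodM prodV.

End Product.

(** * Varieties and smooth morphisms *)

Definition affine_variety (K : fieldType) (X : kspace K) : Prop :=
  exists n (A : set (affine_space K n)) (phi : X -> sub_space A),
    closed A /\ is_iso phi.

Definition prevariety (K : fieldType) (X : kspace K) : Prop :=
  exists n (U : 'I_n -> set X),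
    (forall k, open (U k) /\ affine_variety (sub_space (U k))) /\
    forall x, exists k, U k x.

Definition separated (K : fieldType) (X : kspace K) : Prop :=
  forall (Y : kspace K) (f g : Y -> X), prevariety Y ->
    is_morphism f -> is_morphism g -> closed [set y | f y = g y].

(* Not necessarily irreducible. *)
Definition variety (K : fieldType) (X : kspace K) : Prop :=
  prevariety X /\ separated X.

(* g is an element of O(V)[T_1, ..., T_m]. *)
Definition poly_over (K : fieldType) (Y : kspace K) (V : set Y) (m : nat)
    (g : Y -> mpoly m K) : Prop :=
  (forall e, regular V (fun v => mcoeff e (g v))) /\
  exists d, forall v, V v -> (msize (g v) <= d)%N.

Definition zero_locus (K : fieldType) (Y : kspace K) (V : set Y) (n m : nat)
    (g : 'I_n -> Y -> mpoly m K) : set (prod_space Y (affine_space K m)) :=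
  [set z | V z.1 /\ forall a, meval ((z.2 : 'rV[K]_m) 0) (g a z.1) = 0].

Definition jacobian (K : fieldType) (n m : nat) (g : 'I_n -> mpoly m K)
    (t : 'rV[K]_m) : 'M[K]_(n, m) :=
  \matrix_(a, j) meval (t 0) (mderiv j (g a)).

(* Smoothness at x of relative dimension k, as in Mumford's Red Book, III.10:
   over a neighbourhood V of f x, a neighbourhood U of x is isomorphic to an
   open part of the zero locus in V x A^(n+k) of n equations whose Jacobian
   matrix in the affine coordinates has rank n at x. At such a point the scheme
   defined by the equations is smooth over a reduced base, hence reduced, so
   that nothing is lost by considering the zero locus. *)
Definition smooth_at (K : fieldType) (X Y : kspace K) (f : X -> Y) (x : X) :
    Prop :=
  exists n k (V : set Y) (g : 'I_n -> Y -> mpoly (n + k) K),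
    open V /\ (forall a, poly_over V (g a)) /\
  exists (U : set X) (O : set (prod_space Y (affine_space K (n + k))))
         (phi : sub_space U -> sub_space (O `&` zero_locus V g))
         (u : sub_space U),
    [/\ open U, open O & is_iso phi] /\
    [/\ forall u', (val (phi u')).1 = f (val u'), val u = x &
        \rank (jacobian (fun a => g a (f x)) (val (phi u)).2) = n].

Definition smooth (K : fieldType) (X Y : kspace K) (f : X -> Y) : Prop :=
  is_morphism f /\ forall x, smooth_at f x.

(* The library's [connected] holds of the empty set, which is excluded here. *)
Definition connected_fibers (K : fieldType) (X Y : kspace K) (f : X -> Y) :
    Prop :=
  forall y, f @^-1` [set y] !=set0 /\ connected (f @^-1` [set y]).

Definition irreducible (T : topologicalType) (A : set T) : Prop :=
  A !=set0 /\ forall B C, closed B -> closed C ->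
    A `<=` B `|` C -> A `<=` B \/ A `<=` C.

Definition irr (T : topologicalType) : set (set T) :=
  [set Z | irreducible Z /\
           forall Z', irreducible Z' -> Z `<=` Z' -> Z' = Z].
Arguments irr : clear implicits.

(** * Quivers and seminilpotent representations *)

Record quiver := Quiver {
  vertex : finType ;
  arrow : finType ;
  source : arrow -> vertex ;
  target : arrow -> vertex
}.

Section Quiver.
Variables (K : fieldType) (Q : quiver).
Implicit Types (nu : vertex Q -> nat) (i : vertex Q).

(* The double quiver: [inl h] is the arrow h of Q and [inr h] is its opposite. *)
Definition dbl : finType := (arrow Q + arrow Q)%type.

Definition src (h : dbl) : vertex Q :=
  match h with inl a => source a | inr a => target a end.

Definition tgt (h : dbl) : vertex Q :=
  match h with inl a => target a | inr a => source a end.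

Definition eps (h : dbl) : K := match h with inl _ => 1 | inr _ => -1 end.

(* (V_nu)_i is the space 'rV[K]_(nu i). *)
Definition rep nu : Type :=
  forall h : dbl, 'Hom('rV[K]_(nu (src h)), 'rV[K]_(nu (tgt h))).

Definition rep_index nu : finType :=
  {h : dbl & ('I_(nu (src h)) * 'I_(nu (tgt h)))%type}.

(* The matrix entries of x. *)
Definition rep_coord nu (x : rep nu) (k : 'I_#|rep_index nu|) : K :=
  let ab := tagged (enum_val k) in
  x (tag (enum_val k)) (delta_mx 0 ab.1) 0 ab.2.

Definition rep_space nu : kspace K := zariski_space (@rep_coord nu).

(* x_(h bar), typed with the endpoints of h. *)
Definition opp_map nu (x : rep nu) (h : dbl) :
    'Hom('rV[K]_(nu (tgt h)), 'rV[K]_(nu (src h))) :=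
  match h with inl a => x (inr a) | inr a => x (inl a) end.

(* The component at i of mu x; [untag] selects the terms with [src h = i]. *)
Definition mu nu (x : rep nu) (i : vertex Q) : 'End('rV[K]_(nu i)) :=
  \sum_(h : dbl) eps h *:
    @untag (vertex Q) (fun j => 'End('rV[K]_(nu j))) _ 0 i id
      (Tagged _ (opp_map x h \o x h)%VF).

Definition graded nu : Type := forall i, {vspace 'rV[K]_(nu i)}.

Definition seminilpotent nu (x : rep nu) : Prop :=
  exists (r : nat) (W : nat -> graded nu),
    [/\ forall i, W 0%N i = fullv,
        forall i, W r i = 0%VS,
        forall k, (k < r)%N ->
          (forall i, (W k.+1 i <= W k i)%VS) /\
          exists i, forall j, j != i -> W k.+1 j = W k j,
        forall k (a : arrow Q), (k < r)%N ->
          (x (inl a) @: W k (source a) <= W k.+1 (target a))%VS &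
        forall k (a : arrow Q), (k < r)%N ->
          (x (inr a) @: W k (target a) <= W k (source a))%VS].

Definition Lambda nu : set (rep_space nu) :=
  [set x | (forall i, mu x i = 0) /\ seminilpotent x].

Definition stable nu (x : rep nu) (W : graded nu) : Prop :=
  forall h, (x h @: W (src h) <= W (tgt h))%VS.

(* W is the smallest x-stable graded subspace containing (V_nu)_j for all
   j != i. *)
Definition is_frakI nu (x : rep nu) i (W : graded nu) : Prop :=
  [/\ stable x W, forall j, j != i -> W j = fullv &
      forall W' : graded nu, stable x W' ->
        (forall j, j != i -> W' j = fullv) -> forall j, (W j <= W' j)%VS].

(* The dimension vector l e_i. *)
Definition mult_e (l : nat) i : vertex Q -> nat := fun j => (l * (j == i))%N.

Definition Lambda_il nu i (l : nat) : set (rep_space nu) :=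
  [set x | @Lambda nu x /\ exists W, is_frakI x i W /\
           forall j, (nu j - \dim (W j))%N = mult_e l i j].

End Quiver.

Arguments Lambda K {Q} nu.
Arguments Lambda_il K {Q} nu i l.

(* Main.v *)
Require Import Defs.
From HB Require Import structures.
From mathcomp Require Import all_boot all_order all_algebra.
From mathcomp Require Import boolp classical_sets functions reals topology.
From mathcomp Require Import complex.
From mathcomp Require mpoly.
Import -(notations) mpoly.

(** Row vectors are used throughout, so that a representation of the double
   quiver is a family of matrices X_h acting on the right. Write nu' for
   nu - l e_i and nu'' for l e_i.

   For x in Lambda(nu)_{i,l} the subspace I_i(x) has dimension nu', and
   restricting x to it and inducing x on the quotient gives points x0 of
   Lambda(nu')_{i,0} and x1 of Lambda(nu''). Conversely, a point (x0, x1) and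
   an off-diagonal block E define a block triangular representation [extm]; it
   satisfies the moment map equation if and only if E solves a homogeneous
   linear system [bmum] whose coefficients are regular in (x0, x1). The total
   space [ext_space] consists of the (x0, x1, E, g) with E a solution and g an
   invertible graded matrix. The map p forgets E and g, and the map q sends the
   point to the conjugate by g of the block triangular representation
   ([glue_span], [cut_sub_full]).

   The system has full rank ([bmum_surj]): for the trace pairing, a family A
   orthogonal to its image is a morphism from x0 to x1; it vanishes at every
   vertex other than i, where V_nu'' is zero, hence its kernel is a stable
   subspace containing those vertices, hence it is everything because I_i(x0)
   is. Over a small open part of Lambda(nu)_{i,l}, the subspace I_i(x) is
   spanned by the images of finitely many fixed paths, so it is the kernel of a
   matrix which is regular in x ([coframeP]); a fiber of q is then the set of
   the invertible g which satisfy the linear system saying that g maps V_nu' to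
   I_i(x) ([chart_glue_map]).

   Both maps are therefore, locally on the base, the projection of
   {(y, t) | D(t) <> 0, t c(y) = 0} with D a polynomial and c a regular matrix
   of full rank ([linear_chart]). Such a projection is smooth by the Jacobian
   criterion; it has local sections through every point, so it is open; and its
   fibers are irreducible, because the line through two points of a fiber meets
   the fiber in the complement of a finite set. An open continuous map with
   irreducible fibers induces a bijection between irreducible components, and
   the components of a product are the products of components
   ([irr_correspondence]).

   It remains to see that the total space is a variety. Seminilpotency is a
   closed condition: it says that every path with enough letters other than
   opposite loops acts by zero ([seminilpotent_nilrep],
   [nilrep_seminilpotent]). The condition I_i(x0) = V_nu' is the nonvanishing
   of one of finitely many minors of the matrix of all short paths ending at i
   ([minor_full]), so the total space is covered by finitely many principal
   open subsets of a closed subset of an affine space. *)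

Set Implicit Arguments.
Unset Strict Implicit.
Unset Printing Implicit Defensive.

Import GRing.Theory Num.Theory.

Local Open Scope classical_set_scope.
Local Open Scope ring_scope.

(** * Regular functions and morphisms *)

Section RegularFunctions.
Variables (K : fieldType) (X : kspace K).
Implicit Types (U : set X) (f g : X -> K).

(** The values outside U are irrelevant, by locality. *)
Lemma regular_ext U f g : open U -> (forall x, U x -> g x = f x) ->
  regular U f -> regular U g.
Proof.
by move=> oU fg rf; apply: regular_local => // x Ux; exists U, f;
  split=> // y Uy _;
  exact: fg.
Qed.

Lemma regularN U f : open U -> regular U f -> regular U (fun x => - f x).
Proof.
move=> oU rf; apply: (@regular_ext _ (fun x => -1 * f x)) => // [x _|].
  by rewrite mulN1r.
by apply: regularM => //; exact: regular_cst.
Qed.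

Lemma regularB U f g : open U -> regular U f -> regular U g ->
  regular U (fun x => f x - g x).
Proof. by move=> oU rf rg; apply: regularD => //; exact: regularN. Qed.

Lemma regular_sum U (J : Type) (r : seq J) (P : pred J) (F : J -> X -> K) :
  open U -> (forall j, P j -> regular U (F j)) ->
  regular U (fun x => \sum_(j <- r | P j) F j x).
Proof.
move=> oU rF; elim: r => [|j r IH].
  by apply: (@regular_ext _ (fun=> 0)) => // [x _|]; rewrite ?big_nil//;
    exact: regular_cst.
apply: (@regular_ext _ (fun x => (if P j then F j x else 0) +
  \sum_(j <- r | P j) F j x)) => // [x _|].
  by rewrite big_cons; case: (P j); rewrite ?add0r.
apply: regularD => //; have := rF j; case: (P j) => [rj|_]; first exact: rj.
exact: regular_cst.
Qed.

Lemma regular_prod U (J : Type) (r : seq J) (P : pred J) (F : J -> X -> K) :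
  open U -> (forall j, P j -> regular U (F j)) ->
  regular U (fun x => \prod_(j <- r | P j) F j x).
Proof.
move=> oU rF; elim: r => [|j r IH].
  by apply: (@regular_ext _ (fun=> 1)) => // [x _|]; rewrite ?big_nil//;
    exact: regular_cst.
apply: (@regular_ext _ (fun x => (if P j then F j x else 1) *
  \prod_(j <- r | P j) F j x)) => // [x _|].
  by rewrite big_cons; case: (P j); rewrite ?mul1r.
apply: regularM => //; have := rF j; case: (P j) => [rj|_]; first exact: rj.
exact: regular_cst.
Qed.

Lemma regularX U f n : open U -> regular U f -> regular U (fun x => f x ^+ n).
Proof.
move=> oU rf; elim: n => [|n IH].
  exact: regular_cst.
apply: (@regular_ext _ (fun x => f x * f x ^+ n)) => // [x _|].
  by rewrite exprS.
exact: regularM.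
Qed.

Lemma regular_meval U n (p : mpoly n K) (c : X -> 'I_n -> K) : open U ->
  (forall k, regular U (c ^~ k)) -> regular U (fun x => meval (c x) p).
Proof.
move=> oU rc; apply: (@regular_ext _ (fun x => \sum_(m <- msupp p)
   mcoeff m p * \prod_i c x i ^+ m i)) => //.
apply: regular_sum => // m _; apply: regularM => //; first exact: regular_cst.
by apply: regular_prod => // k _; exact: regularX.
Qed.

Lemma open_neq0 U f : open U -> regular U f -> open (U `&` [set x | f x != 0]).
Proof. by move=> oU rf; case: (regularV oU rf). Qed.

Lemma open_neq0T f : regular setT f -> open [set x | f x != 0].
Proof.
move=> rf; have := open_neq0 openT rf; by rewrite setTI.
Qed.

Lemma closed_eq0 f : regular setT f -> closed [set x | f x = 0].
Proof.
move=> rf; rewrite -[X in closed X]setCK; apply: open_closedC.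
suff -> : ~` [set x | f x = 0] = [set x | f x != 0] by exact: open_neq0T.
by apply/seteqP; split=> x /= /eqP.
Qed.

Lemma regular_inv U f : open U -> (forall x, U x -> f x != 0) ->
  regular U f -> regular U (fun x => (f x)^-1).
Proof.
move=> oU f0 rf; have [_] := regularV oU rf.
suff -> : U `&` [set x | f x != 0] = U by [].
by apply/seteqP; split=> x /=; [case|move=> Ux; split=> //; exact: f0].
Qed.

Definition regular_mx U m n (M : X -> 'M[K]_(m, n)) : Prop :=
  forall a b, regular U (fun x => M x a b).

Lemma regular_mx_ext U m n (M N : X -> 'M[K]_(m, n)) : open U ->
  (forall x, U x -> N x = M x) -> regular_mx U M -> regular_mx U N.
Proof.
move=> oU MN rM a b; apply: (@regular_ext _ (fun x => M x a b)) => // x Ux.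
by rewrite MN.
Qed.

Lemma regular_mx_restr U V m n (M : X -> 'M[K]_(m, n)) : open U -> open V ->
  V `<=` U -> regular_mx U M -> regular_mx V M.
Proof. by move=> oU oV VU rM a b; exact: regular_restr (rM a b). Qed.

Lemma regular_mx_cst U m n (A : 'M[K]_(m, n)) : open U ->
  regular_mx U (fun=> A).
Proof. by move=> oU a b; exact: regular_cst. Qed.

Lemma regular_mxD U m n (M N : X -> 'M[K]_(m, n)) : open U ->
  regular_mx U M -> regular_mx U N -> regular_mx U (fun x => M x + N x).
Proof.
move=> oU rM rN a b.
apply: (@regular_ext _ (fun x => M x a b + N x a b)) => // [x _|].
  by rewrite mxE.
exact: regularD.
Qed.

Lemma regular_mxZ U m n f (M : X -> 'M[K]_(m, n)) : open U ->
  regular U f -> regular_mx U M -> regular_mx U (fun x => f x *: M x).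
Proof.
move=> oU rf rM a b.
apply: (@regular_ext _ (fun x => f x * M x a b)) => // [x _|].
  by rewrite mxE.
exact: regularM.
Qed.

Lemma regular_mxB U m n (M N : X -> 'M[K]_(m, n)) : open U ->
  regular_mx U M -> regular_mx U N -> regular_mx U (fun x => M x - N x).
Proof.
move=> oU rM rN a b.
apply: (@regular_ext _ (fun x => M x a b - N x a b)) => // [x _|].
  by rewrite !mxE.
exact: regularB.
Qed.

Lemma regular_mxM U m n p (M : X -> 'M[K]_(m, n)) (N : X -> 'M_(n, p)) :
  open U -> regular_mx U M -> regular_mx U N ->
  regular_mx U (fun x => M x *m N x).
Proof.
move=> oU rM rN a b.
apply: (@regular_ext _ (fun x => \sum_j M x a j * N x j b)) => // [x _|].
  by rewrite mxE.
by apply: regular_sum => // j _; exact: regularM.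
Qed.

Lemma regular_mx_sum U m n (J : Type) (r : seq J) (P : pred J)
    (F : J -> X -> 'M[K]_(m, n)) : open U ->
  (forall j, P j -> regular_mx U (F j)) ->
  regular_mx U (fun x => \sum_(j <- r | P j) F j x).
Proof.
move=> oU rF a b.
apply: (@regular_ext _ (fun x => \sum_(j <- r | P j) F j x a b)) => // [x _|].
  by rewrite summxE.
by apply: regular_sum => // j Pj; exact: rF.
Qed.

Lemma regular_det U n (M : X -> 'M[K]_n) : open U -> regular_mx U M ->
  regular U (fun x => \det (M x)).
Proof.
move=> oU rM; apply: regular_sum => // s _; apply: regularM => //.
  exact: regular_cst.
by apply: regular_prod.
Qed.

Lemma regular_mx_inv U n (M : X -> 'M[K]_n) : open U ->
  (forall x, U x -> \det (M x) != 0) -> regular_mx U M ->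
  regular_mx U (fun x => invmx (M x)).
Proof.
move=> oU M0 rM.
apply: (@regular_mx_ext _ _ _ (fun x => (\det (M x))^-1 *: \adj (M x))) => //.
  by move=> x Ux; rewrite /invmx unitmxE unitfE M0.
apply: regular_mxZ => //; first by apply: regular_inv => //; exact: regular_det.
move=> a b; apply: (@regular_ext _ (fun x => cofactor (M x) b a)) => //.
  by move=> x _; rewrite mxE.
apply: regularM => //; first exact: regular_cst.
apply: regular_det => // c d.
by apply: (@regular_ext _ (fun x => M x (lift b c) (lift a d))) => // x _;
  rewrite !mxE.
Qed.

End RegularFunctions.

Section Morphisms.
Variable K : fieldType.
Implicit Types X Y Z : kspace K.

Lemma is_morphism_comp X Y Z (f : X -> Y) (g : Y -> Z) :
  is_morphism f -> is_morphism g -> is_morphism (g \o f).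
Proof.
move=> [/continuousP cf rf] [/continuousP cg rg]; split.
  by apply/continuousP => A oA; exact: (cf _ (cg _ oA)).
by move=> V h oV rh; apply: (rf (g @^-1` V) (h \o g)); [exact: cg|exact: rg].
Qed.

Lemma is_morphism_id X : is_morphism (@id X).
Proof. by split=> //; apply/continuousP. Qed.

Lemma open_preimage X Y (f : X -> Y) (V : set Y) :
  is_morphism f -> open V -> open (f @^-1` V).
Proof. by move=> [/continuousP cf _] /cf. Qed.

Lemma closed_preimage X Y (f : X -> Y) (V : set Y) :
  is_morphism f -> closed V -> closed (f @^-1` V).
Proof. by move=> [/continuous_closedP cf _] /cf. Qed.

Lemma regular_comp X Y (f : X -> Y) (h : Y -> K) :
  is_morphism f -> regular setT h -> regular setT (h \o f).
Proof. by move=> [_ rf] /(rf _ _ openT). Qed.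

Lemma regular_mx_comp X Y (f : X -> Y) m n (M : Y -> 'M[K]_(m, n)) :
  is_morphism f -> regular_mx setT M -> regular_mx setT (M \o f).
Proof. by move=> mf rM a b; apply: (regular_comp mf (rM a b)). Qed.

Lemma is_morphism_val X (A : set X) : is_morphism (val : sub_space A -> X).
Proof.
split; first by apply/continuousP => W oW; exists W.
by move=> V g oV rg a Va; exists V, g; split.
Qed.

Lemma regular_val X (V : set X) h : open V -> regular V h ->
  regular setT (h \o (val : sub_space V -> X)).
Proof.
move=> oV rh; have [_ /(_ _ _ oV rh)] := @is_morphism_val X V.
suff -> : (val : sub_space V -> X) @^-1` V = setT by [].
by apply/seteqP; split=> // x _; exact: set_valP.
Qed.

Lemma regular_mx_val X (V : set X) m n (M : X -> 'M[K]_(m, n)) : open V ->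
  regular_mx V M -> regular_mx setT (M \o (val : sub_space V -> X)).
Proof. by move=> oV rM a b; apply: (regular_val oV (rM a b)). Qed.

(** With [is_morphism_val], the universal property of the induced structure. *)
Lemma is_morphism_sub X Y (A : set X) (f : Y -> sub_space A) :
  is_morphism (val \o f) -> is_morphism f.
Proof.
move=> [/continuousP cf rf].
have cf' : continuous f by apply/continuousP => _ [W oW <-]; exact: (cf W).
split=> // U g oU rg; have oV : open (f @^-1` U) by move/continuousP: cf';
  apply.
apply: regular_local => // y Uy.
have [W [h [oW Wy rh gh]]] := rg _ Uy.
have oW' : open ((val \o f) @^-1` W) by exact: cf.
exists ((val \o f) @^-1` W), (h \o (val \o f)).
by split=> //; [exact: rf|move=> z Uz Wz; exact: gh].
Qed.

Lemma is_morphism_fst X Y : is_morphism (fst : prod_space X Y -> X).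
Proof.
split.
  apply/continuousP => W oW; apply/prod_openP => z Wz.
  exists W, setT, (fun=> 1); split; split=> //; rewrite ?oner_neq0//.
    exact: openT.
  exact: tensor_cst.
move=> V g oV rg z Vz; exists V, setT, (fun z => g z.1), (fun=> 1).
split; split=> //; rewrite ?oner_neq0//.
- exact: openT.
- exact: tensorl.
- exact: tensor_cst.
- by move=> w *; rewrite divr1.
Qed.

Lemma is_morphism_snd X Y : is_morphism (snd : prod_space X Y -> Y).
Proof.
split.
  apply/continuousP => W oW; apply/prod_openP => z Wz.
  exists setT, W, (fun=> 1); split; split=> //; rewrite ?oner_neq0//.
    exact: openT.
  exact/tensor_cst/openT.
move=> V g oV rg z Vz; exists setT, V, (fun z => g z.2), (fun=> 1).
split; split=> //; rewrite ?oner_neq0//.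
- exact: openT.
- exact: tensorr.
- exact/tensor_cst/openT.
- by move=> w *; rewrite divr1.
Qed.

(** The universal property of the product: the pullback of a tensor is regular,
   so that both the basic open sets and the local fractions pull back. *)
Lemma is_morphism_pair X Y Z (f : Z -> X) (g : Z -> Y) :
  is_morphism f -> is_morphism g ->
  is_morphism (fun z => (f z, g z) : prod_space X Y).
Proof.
move=> mf mg.
have tr U V c : open U -> open V -> tensor U V c ->
    regular (f @^-1` U `&` g @^-1` V) (fun z => c (f z, g z)).
  move=> oU oV; have o1 := open_preimage mf oU; have o2 := open_preimage mg oV.
  have o12 : open (f @^-1` U `&` g @^-1` V) by exact: openI.
  elim=> [h rh|h rh|h h' _ ? _ ?|h h' _ ? _ ?].
  - by apply: regular_restr (mf.2 _ _ oU rh) => // x [].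
  - by apply: regular_restr (mg.2 _ _ oV rh) => // x [].
  - exact: regularD.
  - exact: regularM.
have cfg : continuous (fun z => (f z, g z) : prod_space X Y).
  apply/continuousP => W /prod_openP oW; apply: open_local => z Wz.
  have [U [V [c [[oU oV tc] [Uz Vz cz cW]]]]] := oW _ Wz.
  have o12 : open (f @^-1` U `&` g @^-1` V).
    by apply: openI; exact: open_preimage.
  exists ((f @^-1` U `&` g @^-1` V) `&` [set z | c (f z, g z) != 0]); split.
  - by apply: open_neq0 => //; exact: tr.
  - by [].
  - by move=> w [[Uw Vw] cw]; exact: cW.
split=> // W h oW rh; have oW' := (continuousP _).1 cfg _ oW.
apply: regular_local => // z Wz.
have [U [V [c [d [[oU oV tc td] [Uz Vz dz hcd]]]]]] := rh _ Wz.
have o12 : open (f @^-1` U `&` g @^-1` V).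
  by apply: openI; exact: open_preimage.
have rc := tr _ _ _ oU oV tc; have rd := tr _ _ _ oU oV td.
have [o3 rdV] := regularV o12 rd.
exists ((f @^-1` U `&` g @^-1` V) `&` [set z | d (f z, g z) != 0]).
exists (fun z => c (f z, g z) * (d (f z, g z))^-1); split=> //.
  by apply: regularM => //; apply: regular_restr rc => // x [].
by move=> w Ww [[Uw Vw] dw] /=; rewrite hcd.
Qed.

Lemma regular_zariski n (E : Type) (c : E -> 'I_n -> K) k :
  regular (setT : set (zariski_space c)) (c ^~ k).
Proof.
move=> x _; exists (mpolyX K (mnm1 k)), 1; rewrite meval1 oner_neq0;
  split=> // y _ _.
by rewrite mevalXU meval1 divr1.
Qed.

(** The pullback of every polynomial in the coordinates is regular. *)
Lemma is_morphism_zariski n (E : Type) (c : E -> 'I_n -> K) Y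
    (f : Y -> zariski_space c) :
  (forall k, regular setT (fun y => c (f y) k)) -> is_morphism f.
Proof.
move=> rc.
have rp p : regular setT (fun y => meval (c (f y)) p).
  by apply: regular_meval => //; exact: openT.
have cf : continuous f.
  apply/continuousP => W /zariski_openP oW; apply: open_local => z Wz.
  have [p [pz pW]] := oW _ Wz.
  exists [set y | meval (c (f y)) p != 0]; split=> //; last by move=> y /pW.
  exact: open_neq0T.
split=> // W h oW rh; have oW' := (continuousP _).1 cf _ oW.
apply: regular_local => // z Wz.
have [p [q [qz hpq]]] := rh _ Wz.
have [oq rq] := regularV openT (rp q).
exists ([set: Y] `&` [set y | meval (c (f y)) q != 0]).
exists (fun y => meval (c (f y)) p * (meval (c (f y)) q)^-1); split=> //.
  by apply: regularM => //; apply: regular_restr (rp p) => //; exact: openT.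
by move=> w Ww [_ qw] /=; rewrite hpq.
Qed.

Lemma is_morphism_affine n Y (f : Y -> affine_space K n) :
  regular_mx setT (f : Y -> 'rV[K]_n) -> is_morphism f.
Proof. by move=> rf; apply: is_morphism_zariski => k; exact: (rf 0). Qed.

Lemma regular_mx_affine n :
  regular_mx (setT : set (affine_space K n)) (fun v : 'rV[K]_n => v).
Proof. by move=> a b; rewrite ord1; apply: regular_zariski. Qed.

End Morphisms.

(** * Irreducible components along fibrations *)

Section Irreducible.

(** In this form, irreducibility can be transported along open maps. *)
Lemma irreducible_meet (T : topologicalType) (A : set T) :
  irreducible A <-> A !=set0 /\ forall U V, open U -> open V ->
    A `&` U !=set0 -> A `&` V !=set0 -> A `&` U `&` V !=set0.
Proof.
split=> -[A0 h]; split=> //.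
  move=> U V oU oV [a [Aa Ua]] [b [Ab Vb]].
  apply: contrapT => nAUV.
  have [] := h (~` U) (~` V) (open_closedC oU) (open_closedC oV).
  - move=> x Ax; have [Ux|] := pselect (U x); last by left.
    by right=> Vx; apply: nAUV; exists x.
  - by move=> /(_ _ Aa).
  - by move=> /(_ _ Ab).
move=> B C cB cC ABC; apply: contrapT =>
  /not_orP[/existsNP[a /not_implyP[Aa nBa]]].
move=> /existsNP[b /not_implyP[Ab nCb]].
have [||x [[Ax nBx] nCx]] := h (~` B) (~` C) (closed_openC cB) (closed_openC
  cC).
- by exists a.
- by exists b.
- by have [] := ABC _ Ax.
Qed.

Lemma irreducible_image (S T : topologicalType) (f : S -> T) (A : set S) :
  continuous f -> irreducible A -> irreducible (f @` A).
Proof.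
move=> /continuousP cf /irreducible_meet[[a Aa] h]; apply/irreducible_meet;
  split.
  by exists (f a); exists a.
move=> U V oU oV [_ [[x Ax <-] Ux]] [_ [[y Ay <-] Vy]].
have [||z [[Az Uz] Vz]] := h _ _ (cf _ oU) (cf _ oV).
- by exists x.
- by exists y.
- by exists (f z); split=> //; split=> //; exists z.
Qed.

Section Fibration.
Variables (S T : topologicalType) (f : S -> T).
Hypotheses (cf : continuous f) (f_open : forall A, open A -> open (f @` A)).
Hypothesis f_irr : forall y, irreducible (f @^-1` [set y]).

(** Open sets meeting the preimage of Z have open images meeting Z, hence
   meeting at a point of Z; both open sets then meet the irreducible fiber over
   it. *)
Lemma irreducible_preimage Z : irreducible Z -> irreducible (f @^-1` Z).
Proof.
move=> /irreducible_meet[[z Zz] h]; apply/irreducible_meet; split.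
  by have [[x fx] _] := f_irr z; exists x; rewrite /preimage/= fx.
move=> U V oU oV [a [Za Ua]] [b [Zb Vb]].
have [||y [[Zy [c Uc fc]] [d Vd fd]]] := h _ _ (f_open oU) (f_open oV).
- by exists (f a); split=> //; exists a.
- by exists (f b); split=> //; exists b.
have /irreducible_meet[_ hy] := f_irr y.
have [||x [[fx Ux] Vx]] := hy _ _ oU oV.
- by exists c.
- by exists d.
- by exists x; split=> //; split=> //; rewrite /preimage/= fx.
Qed.

Lemma fibration_surj y : exists x, f x = y.
Proof. by have [[x fx] _] := f_irr y; exists x. Qed.

Lemma preimage_inj A B : f @^-1` A = f @^-1` B -> A = B.
Proof.
move=> /seteqP[AB BA]; apply/seteqP; split=> y; have [x <-] := fibration_surj y.
- exact: AB.
- exact: BA.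
Qed.

(** An irreducible set containing the preimage of Z has an irreducible image
   containing Z, which is therefore Z. *)
Lemma irr_preimage Z : irr T Z -> irr S (f @^-1` Z).
Proof.
move=> [iZ mZ]; split; first exact: irreducible_preimage.
move=> Z' iZ' ZZ'; apply/seteqP; split=> // x Z'x.
have -> : Z = f @` Z'; last by exists x.
apply/esym/mZ; first exact: irreducible_image.
by move=> y Zy; have [u fu] := fibration_surj y; exists u => //; apply: ZZ';
  rewrite /preimage/= fu.
Qed.

(** The image of Z' is irreducible, so its preimage is an irreducible set
   containing Z', hence equal to it. *)
Lemma irr_image Z' : irr S Z' -> exists2 Z, irr T Z & f @^-1` Z = Z'.
Proof.
move=> [iZ' mZ']; have iZ := irreducible_image cf iZ'.
have E : f @^-1` (f @` Z') = Z'.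
  apply: mZ'; first exact: irreducible_preimage.
  by move=> x Z'x; exists x.
exists (f @` Z') => //; split=> // Z2 iZ2 ZZ2; apply: preimage_inj.
rewrite E; apply: mZ'; first exact: irreducible_preimage.
by move=> x Z'x; apply: ZZ2; exists x.
Qed.

End Fibration.

Lemma irreducible_connected (T : topologicalType) (A : set T) :
  irreducible A -> connected A.
Proof.
move=> [_ h] B [b Bb] [U oU BU] [V cV BV]; apply/seteqP; split.
  by rewrite BU; exact: subIsetl.
have [] := h V (~` U) cV (open_closedC oU).
- move=> x Ax; have [Ux|] := pselect (U x); last by right.
  by left; have [] : (A `&` V) x by rewrite -BV BU.
- by move=> AV x Ax; rewrite BV; split=> //; exact: AV.
- by move=> AU; move: (Bb); rewrite BU => -[/AU].
Qed.

End Irreducible.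

Section ProductIrr.
Variables (K : fieldType) (X Y : kspace K).

Lemma is_morphism_cst (Z W : kspace K) (w : W) : is_morphism (fun _ : Z => w).
Proof.
have oE (V : set W) : open ((fun _ : Z => w) @^-1` V).
  have [Vw|nVw] := pselect (V w).
    suff -> : (fun _ : Z => w) @^-1` V = setT by exact: openT.
    by apply/seteqP; split.
  suff -> : (fun _ : Z => w) @^-1` V = set0 by exact: open0.
  by apply/seteqP; split.
by split=> [|V h _ _]; [exact/continuousP|exact: (regular_cst (h w))].
Qed.

(** Let two open sets meet A x B at (a, b) and (a', b'). As slices are open and
   A is irreducible, some x in A has (x, b) in the first and (x, b') in the
   second; then the slice over x is handled in the same way, with B. *)
Lemma irreducible_prod (A : set X) (B : set Y) : irreducible A ->
  irreducible B -> irreducible (A `*` B : set (prod_space X Y)).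
Proof.
move=> /irreducible_meet[[a0 Aa0] hA] /irreducible_meet[[b0 Bb0] hB].
apply/irreducible_meet; split; first by exists (a0, b0).
move=> U V oU oV [[a b] [[/= Aa Bb] Uab]] [[a' b'] [[/= Aa' Bb'] Vab']].
have sl (y : Y) (W : set (prod_space X Y)) : open W -> open [set x : X |
  W (x, y)].
  apply: (@open_preimage _ _ _ (fun x => (x, y) : prod_space X Y)).
  exact: is_morphism_pair (is_morphism_id X) (is_morphism_cst _ y).
have sr (x : X) (W : set (prod_space X Y)) : open W -> open [set y : Y |
  W (x, y)].
  apply: (@open_preimage _ _ _ (fun y => (x, y) : prod_space X Y)).
  exact: is_morphism_pair (is_morphism_cst _ x) (is_morphism_id Y).
have [||x [[Ax Uxb] Vxb']] := hA _ _ (sl b _ oU) (sl b' _ oV).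
- by exists a.
- by exists a'.
have [||y [[By Uxy] Vxy]] := hB _ _ (sr x _ oU) (sr x _ oV).
- by exists b.
- by exists b'.
- by exists (x, y).
Qed.

Lemma irr_prod (A : set X) (B : set Y) : irr X A -> irr Y B ->
  irr (prod_space X Y) (A `*` B).
Proof.
move=> [iA mA] [iB mB]; split; first exact: irreducible_prod.
move=> Z iZ ABZ; apply/seteqP; split=> // -[x y] Zxy.
have [c1 _] := is_morphism_fst X Y; have [c2 _] := is_morphism_snd X Y.
have [[a Aa] _] := iA; have [[b Bb] _] := iB.
have EA := mA _ (irreducible_image c1 iZ).
have EB := mB _ (irreducible_image c2 iZ).
split=> /=.
  by rewrite -EA; [exists (x, y)|move=> u Au; exists (u, b) => //; exact: ABZ].
by rewrite -EB; [exists (x, y)|move=> u Bu; exists (a, u) => //; exact: ABZ].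
Qed.

(** Z is contained in the product of its projections, which is irreducible. *)
Lemma irr_prod_inv Z : irr (prod_space X Y) Z ->
  exists A B, [/\ irr X A, irr Y B & Z = A `*` B].
Proof.
move=> [iZ mZ].
have [c1 _] := is_morphism_fst X Y; have [c2 _] := is_morphism_snd X Y.
have iA := irreducible_image c1 iZ; have iB := irreducible_image c2 iZ.
have sub C D : irreducible C -> irreducible D -> fst @` Z `<=` C ->
    snd @` Z `<=` D -> (C `*` D : set (prod_space X Y)) = Z.
  move=> iC iD AC BD; apply: mZ; first exact: irreducible_prod.
  by move=> z Zz; split; [apply: AC; exists z|apply: BD; exists z].
have [[z0 Zz0] _] := iZ.
exists (fst @` Z), (snd @` Z); split; last by rewrite sub.
- split=> // C iC AC; apply/seteqP; split=> // x Cx.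
  exists (x, z0.2) => //; rewrite -(sub _ _ iC iB AC) //; split=> //=;
    exists z0 => //.
- split=> // C iC AC; apply/seteqP; split=> // x Cx.
  exists (z0.1, x) => //; rewrite -(sub _ _ iA iC _ AC) //; split=> //=;
    exists z0 => //.
Qed.

End ProductIrr.

Section IrrBijection.
Variables (K : fieldType) (S T X Y : kspace K) (q : S -> T).
Variable p : S -> prod_space X Y.
Hypotheses (cq : continuous q) (oq : forall A, open A -> open (q @` A)).
Hypothesis iq : forall y, irreducible (q @^-1` [set y]).
Hypotheses (cp : continuous p) (op : forall A, open A -> open (p @` A)).
Hypothesis ip : forall y, irreducible (p @^-1` [set y]).

(** Pull back along the two fibrations, and use that the components of a
   product are the products of components. *)
Lemma irr_correspondence : exists Phi : set T -> set X * set Y,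
  set_bij (irr T) (irr X `*` irr Y) Phi /\
  forall Z A B, irr T Z -> irr X A -> irr Y B ->
    (Phi Z = (A, B) <-> q @^-1` Z = p @^-1` (A `*` B)).
Proof.
pose rel Z (AB : set X * set Y) :=
  [/\ irr X AB.1, irr Y AB.2 & q @^-1` Z = p @^-1` (AB.1 `*` AB.2)].
have prod_inj (A A' : set X) (B B' : set Y) : irr X A -> irr Y B ->
    irr X A' -> irr Y B' -> A `*` B = A' `*` B' -> (A, B) = (A', B').
  move=> [[[a Aa] _] _] [[[b Bb] _] _] [[[a' Aa'] _] _] [[[b' Bb'] _] _]
    /seteqP[s1 s2].
  congr pair; apply/seteqP; split=> x hx.
  - by have [] := s1 (x, b).
  - by have [] := s2 (x, b').
  - by have [] := s1 (a, x).
  - by have [] := s2 (a', x).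
have rel_ex Z : irr T Z -> exists AB, rel Z AB.
  move=> /(irr_preimage cq oq iq) /(irr_image cp op ip)[W /irr_prod_inv[A [B
    [iA iB ->]]] EW].
  by exists (A, B).
pose Phi Z : set X * set Y := xget (set0, set0) (rel Z).
have PhiP Z : irr T Z -> rel Z (Phi Z).
  by move=> /rel_ex[AB hAB]; rewrite /Phi;
    exact: (xgetPex _ (ex_intro _ AB hAB)).
have PhiE Z A B : irr T Z -> irr X A -> irr Y B ->
    (Phi Z = (A, B) <-> q @^-1` Z = p @^-1` (A `*` B)).
  move=> iZ iA iB; have [iP1 iP2 EP] := PhiP _ iZ; split=> [E|E].
    by rewrite E in EP.
  have := preimage_inj ip (etrans (esym EP) E).
  by move/prod_inj => <- //; case: (Phi Z).
exists Phi; split=> //; split.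
- by move=> Z /PhiP[].
- move=> Z Z' /set_mem iZ /set_mem iZ' E.
  have [_ _ E1] := PhiP _ iZ; have [_ _ E2] := PhiP _ iZ'.
  by apply: (preimage_inj iq); rewrite E1 E2 E.
- move=> [A B] [/= iA iB].
  have /(irr_image cq oq iq)[Z iZ EZ] := irr_preimage cp op ip (irr_prod iA iB).
  by exists Z => //; apply/PhiE.
Qed.

End IrrBijection.

(** * Linear charts *)

Section Points.
Variables (K : fieldType) (X : kspace K) (A : set X).

Definition subpoint x (Ax : A x) : sub_space A := exist _ x (mem_set Ax).

Lemma open_val (U : set A) : open A -> open (U : set (sub_space A)) ->
  open (val @` U : set X).
Proof.
move=> oA [W oW <-].
suff -> : val @` [set a : A | W (val a)] = A `&` W by exact: openI.
apply/seteqP; split=> [_ [a Wa <-]|x [Ax Wx]].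
  by split=> //; exact: set_valP.
by exists (subpoint Ax).
Qed.

End Points.

Section Line.
Variable K : numFieldType.

Definition line : kspace K := zariski_space (fun (s : K) (_ : 'I_1) => s).

Lemma mpoly1_horner (p : mpoly 1 K) :
  exists u : {poly K}, forall s, meval (fun=> s) p = u.[s].
Proof.
exists (\sum_(m <- msupp p) (mcoeff m p *: \prod_i 'X ^+ (m i))) => s.
rewrite mevalE horner_sum; apply: eq_bigr => m _.
by rewrite hornerZ !big_ord1 hornerXn.
Qed.

(** A nonempty open subset of the line has a finite complement, and K is
   infinite as it has characteristic 0. *)
Lemma line_meet (U V : set line) : open U -> open V ->
  U !=set0 -> V !=set0 -> U `&` V !=set0.
Proof.
move=> /zariski_openP oU /zariski_openP oV [a /oU[p [pa pU]]] [b /oV[q [qb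
  qV]]].
have [u up] := mpoly1_horner p; have [v vq] := mpoly1_horner q.
rewrite up in pa; rewrite vq in qb.
have u0 : u != 0 by apply: contraNneq pa => ->; rewrite horner0.
have v0 : v != 0 by apply: contraNneq qb => ->; rewrite horner0.
have [s sr] : exists s, ~~ root (u * v) s.
  apply: contrapT => /forallNP r.
  pose rs : seq K := [seq k%:R | k <- iota 0 (size (u * v))].
  have ars : all (root (u * v)) rs by apply/allP => x _;
    apply: contrapT => /negP /r.
  have urs : uniq rs.
    by rewrite map_inj_uniq ?iota_uniq// => m n /eqP; rewrite eqr_nat => /eqP.
  have := max_poly_roots (mulf_neq0 u0 v0) ars urs.
  by rewrite size_map size_iota ltnn.
exists s; move: sr; rewrite rootM negb_or => /andP[su sv].
by split; [apply: pU; rewrite up|apply: qV; rewrite vq].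
Qed.

End Line.

Section LinearLocus.
Variables (K : fieldType) (Y : kspace K) (V : set Y) (m n : nat).
Variables (c : Y -> 'M[K]_(m, n)) (D : mpoly m K).

Definition lin_locus : set (prod_space Y (affine_space K m)) :=
  [set z | [/\ V z.1, meval ((z.2 : 'rV_m) 0) D != 0 &
               (z.2 : 'rV_m) *m c z.1 = 0]].

Definition lin_eqns (a : 'I_n) (y : Y) : mpoly m K :=
  \sum_k c y k a *: mpolyX K (mnm1 k).

Lemma meval_lin_eqns a y (t : 'rV_m) :
  meval (t 0) (lin_eqns a y) = (t *m c y) 0 a.
Proof.
rewrite /lin_eqns raddf_sum mxE /=; apply: eq_bigr => k _.
by rewrite mevalZ mevalXU mulrC.
Qed.

Lemma jacobian_lin_eqns y (t : 'rV_m) :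
  jacobian (fun a => lin_eqns a y) t = (c y)^T.
Proof.
apply/matrixP => a j; rewrite !mxE.
suff -> : mderiv j (lin_eqns a y) = c y j a *: 1 by rewrite mevalZ meval1 mulr1.
rewrite /lin_eqns (raddf_sum (mderiv j)) /= (bigD1 j)//= big1 ?addr0.
  rewrite mderivZ mderivX mnmE eqxx scale1r.
  suff -> : mnm_sub (mnm1 j) (mnm1 j) = mnm0 by rewrite mpolyX0.
  by apply/mnmP => k; rewrite mnmBE subnn mnm0E.
by move=> k kj; rewrite mderivZ mderivX mnmE (negPf kj) scale0r scaler0.
Qed.

Lemma poly_over_lin_eqns a : open V -> regular_mx V c ->
  poly_over V (lin_eqns a).
Proof.
move=> oV rc; split.
  move=> e; apply: (@regular_ext _ _ _
    (fun v => \sum_k c v k a * mcoeff e (mpolyX K (mnm1 k)))) => //.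
    by move=> v _; rewrite /lin_eqns raddf_sum /=; apply: eq_bigr => k _;
      rewrite mcoeffZ.
  by apply: regular_sum => // k _; apply: regularM => //; exact: regular_cst.
exists 2 => v _; rewrite /lin_eqns.
elim/big_rec: _ => [|k p _ IH]; first by rewrite msize0.
rewrite (leq_trans (msizeD_le _ _))// geq_max IH andbT.
by rewrite (leq_trans (msizeZ_le _ _))// msizeX mdeg1.
Qed.

Lemma lin_locusE :
  lin_locus = [set z | meval ((z.2 : 'rV_m) 0) D != 0] `&` zero_locus V
    lin_eqns.
Proof.
apply/seteqP; split=> [z [Vz Dz cz]|z [Dz [Vz gz]]].
  by split=> //; split=> // a; rewrite meval_lin_eqns cz mxE.
by split=> //; apply/rowP => a; rewrite -meval_lin_eqns gz mxE.
Qed.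

Lemma open_lin_locus_dom :
  open [set z : prod_space Y (affine_space K m) |
    meval ((z.2 : 'rV_m) 0) D != 0].
Proof.
apply: open_neq0T; apply: regular_meval => [|k]; first exact: openT.
have := regular_comp (is_morphism_snd Y (affine_space K m)) (@regular_mx_affine
  K m 0 k).
by [].
Qed.

End LinearLocus.

(** The common local form of both maps of the diagram. The full rank of c gives
   smoothness and openness, linearity in t gives irreducible fibers, and the
   last condition makes the fibers nonempty. *)
Definition linear_chart (K : fieldType) (X Y : kspace K) (f : X -> Y)
    (V : set Y) : Prop :=
  exists m n (c : Y -> 'M[K]_(m, n)) (D : mpoly m K)
      (phi : sub_space (f @^-1` V) -> sub_space (lin_locus V c D)),
    [/\ open V, regular_mx V c, forall v, V v -> row_full (c v), is_iso phi &
        forall u, (val (phi u)).1 = f (val u)] /\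
    forall v, V v -> exists t, lin_locus V c D (v, t).

Section Chart.
Variables (K : fieldType) (X Y : kspace K) (f : X -> Y) (V : set Y).
Hypotheses (mf : is_morphism f) (ch : linear_chart f V).

(** The Jacobian matrix of the linear equations in the variables t is the
   transpose of their coefficient matrix, which has full rank. *)
Lemma smooth_at_chart x : V (f x) -> smooth_at f x.
Proof.
move=> Vx; have [m [n [c [D [phi [[oV rc fc iphi phi1] _]]]]]] := ch.
have le_nm : (n <= m)%N by rewrite -(eqP (fc _ Vx)) rank_leq_row.
(* n independent equations in m variables; k is the relative dimension *)
have [k Em] : exists k, (n + k)%N = m by exists (m - n)%N; rewrite subnKC.
case: m / Em {le_nm} c D phi rc fc iphi phi1 => c D phi rc fc iphi phi1.
exists n, k, V, (lin_eqns c); split=> //; split.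
  by move=> a; exact: poly_over_lin_eqns.
exists (f @^-1` V), [set z | meval ((z.2 : 'rV_(n + k)) 0) D != 0].
rewrite -lin_locusE.
have Ux : (f @^-1` V) x by [].
exists phi, (subpoint Ux); split; split=> //.
- exact: open_preimage.
- exact: open_lin_locus_dom.
- by rewrite jacobian_lin_eqns mxrank_tr; exact/eqP/fc.
Qed.

(** A solution t over f x extends to nearby points y by a correction: with B a
   constant matrix such that B c(f x) = 1, the matrix B c(y) stays invertible
   and t - t c(y) (B c(y))^-1 B solves the system at y. *)
Lemma chart_section x (A : set X) : V (f x) -> open A -> A x ->
  exists W : set Y, [/\ open W, W (f x) & W `<=` f @` A].
Proof.
move=> Vx oA Ax.
have [m [n [c [D [phi [[oV rc fc [mphi [psi [mpsi phiK psiK]]] phi1] _]]]]]] :=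
  ch.
have Ux : (f @^-1` V) x by [].
have [] := set_valP (phi (subpoint Ux)); rewrite phi1/=.
set v := f x; set t : 'rV_m := (val (phi (subpoint Ux))).2 => _ Dt ct.
have /row_fullP[B Bc] := fc _ Vx.
pose M y := B *m c y.
have rM : regular_mx V M by apply: regular_mxM => //; exact: regular_mx_cst.
pose V1 := V `&` [set y | \det (M y) != 0].
have oV1 : open V1 by apply: open_neq0 => //; exact: regular_det.
have V1V : V1 `<=` V by move=> y [].
pose t' y : 'rV_m := t - t *m c y *m invmx (M y) *m B.
have rt' : regular_mx V1 t'.
  apply: regular_mxB => //; first exact: regular_mx_cst.
  apply: regular_mxM => //; last exact: regular_mx_cst.
  apply: regular_mxM => //.
    apply: regular_mxM => //; first exact: regular_mx_cst.
    exact: regular_mx_restr rc.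
  apply: regular_mx_inv => //; first by move=> y [].
  exact: regular_mx_restr rM.
pose V2 := V1 `&` [set y | meval (t' y 0) D != 0].
have oV2 : open V2 by apply: open_neq0 => //; apply: regular_meval => // k;
  exact: rt'.
have V2P y : V2 y -> lin_locus V c D (y, t' y).
  move=> [[Vy My] Dy]; split=> //=.
  rewrite /t' mulmxBl -!mulmxA -/(M y) mulVmx ?mulmx1 ?subrr//.
  by rewrite unitmxE unitfE.
have V2V1 : V2 `<=` V1 by move=> y [].
have t'v : t' v = t by rewrite /t' ct !mul0mx subr0.
have V2v : V2 v by split; [split=> //=;
  rewrite /M Bc det1 oner_neq0|rewrite /= t'v].
pose s (w : sub_space V2) : sub_space (lin_locus V c D) := subpoint (V2P _
  (set_valP w)).
have ms : is_morphism s.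
  apply: is_morphism_sub.
  apply: (@is_morphism_pair _ _ _ _ (val : sub_space V2 ->
    Y) (t' \o val : _ -> affine_space K m)).
    exact: is_morphism_val.
  by apply: is_morphism_affine; apply: regular_mx_val => //;
    exact: regular_mx_restr rt'.
pose h := val \o psi \o s.
have mh : is_morphism h.
  by apply: is_morphism_comp (@is_morphism_val _ _ _); exact: is_morphism_comp.
have fh w : f (h w) = val w by rewrite /h /= -phi1 psiK.
have oh := open_preimage mh oA.
exists (val @` (h @^-1` A)); split.
- exact: open_val.
- exists (subpoint V2v) => //;
    suff Eh : h (subpoint V2v) = x by rewrite /preimage/= Eh.
  rewrite /h/=; suff -> : s (subpoint V2v) = phi (subpoint Ux) by rewrite phiK.
  apply: val_inj; rewrite /= [RHS]surjective_pairing phi1 -/t /=.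
  by rewrite t'v.
- by move=> _ [w Aw <-]; exists (h w).
Qed.

End Chart.

Section LocallyLinear.
Variables (K : numFieldType) (X Y : kspace K) (f : X -> Y).
Hypothesis mf : is_morphism f.
Hypothesis ch : forall y, exists2 V, V y & linear_chart f V.

Lemma smooth_chart : smooth f.
Proof.
split=> // x; have [V Vx chV] := ch (f x).
exact: (smooth_at_chart mf chV).
Qed.

Lemma open_chart (A : set X) : open A -> open (f @` A).
Proof.
move=> oA; apply: open_local => _ [x Ax <-]; have [V Vx chV] := ch (f x).
have [W [oW Wx WA]] := chart_section chV Vx oA Ax.
by exists W.
Qed.

(** Two points of a fiber lie on a line. The part of that line with D <> 0 is
   an open part of the affine line and maps to the fiber, so that open sets
   around the two points meet. *)
Lemma irreducible_fiber_chart y : irreducible (f @^-1` [set y]).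
Proof.
have [V Vy [m [n [c [D [phi [[oV rc fc [mphi [psi [mpsi phiK psiK]]] phi1]
  ne]]]]]]] := ch y.
have fpsi z : f (val (psi z)) = (val z).1 by rewrite -phi1 psiK.
apply/irreducible_meet; split.
  have [t ht] := ne _ Vy; exists (val (psi (subpoint ht))).
  by rewrite /preimage/= fpsi.
move=> U1 U2 oU1 oU2 [x1 [/= fx1 Ux1]] [x2 [/= fx2 Ux2]].
have Vx1 : (f @^-1` V) x1 by rewrite /preimage/= fx1.
have Vx2 : (f @^-1` V) x2 by rewrite /preimage/= fx2.
have [] := set_valP (phi (subpoint Vx1)); rewrite phi1/= fx1.
set t1 : 'rV_m := (val (phi (subpoint Vx1))).2 => _ Dt1 ct1.
have [] := set_valP (phi (subpoint Vx2)); rewrite phi1/= fx2.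
set t2 : 'rV_m := (val (phi (subpoint Vx2))).2 => _ Dt2 ct2.
(* the line through the two points, which stays in the linear fiber *)
pose g (s : line K) : 'rV_m := t1 + (s : K) *: (t2 - t1).
have rg : regular_mx setT g.
  apply: regular_mxD; rewrite //; [exact: openT|by apply: regular_mx_cst;
    exact: openT|].
  apply: regular_mxZ; [exact: openT| |by apply: regular_mx_cst; exact: openT].
  exact: (@regular_zariski _ 1 K (fun s _ => s) 0).
pose T := [set s : line K | meval (g s 0) D != 0].
have oT : open T.
  by apply: open_neq0T; apply: regular_meval => [|k]; [exact: openT|exact: rg].
have TP s : T s -> lin_locus V c D (y, g s).
  by move=> Ts; split=> //=;
    rewrite /g mulmxDl -scalemxAl mulmxBl ct1 ct2 subrr scaler0 addr0.
pose ls (s : sub_space T) : sub_space (lin_locus V c D) := subpoint (TP _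
  (set_valP s)).
pose h s := val (psi (ls s)).
have mh : is_morphism h.
  have ms : is_morphism ls.
    apply: is_morphism_sub.
    apply: (@is_morphism_pair _ Y (affine_space K m) (sub_space T) (fun=> y)
      (fun s => g (val s))).
      exact: is_morphism_cst.
    apply: is_morphism_affine; apply: regular_mx_val => //.
    by apply: regular_mx_restr rg => //; exact: openT.
  exact: is_morphism_comp (is_morphism_comp ms mpsi) (@is_morphism_val _ _ _).
have T0 : T 0 by rewrite /T/= /g scale0r addr0.
have T1 : T 1 by rewrite /T/= /g scale1r addrC subrK.
have h0 : h (subpoint T0) = x1.
  rewrite /h; suff -> : ls (subpoint T0) = phi (subpoint Vx1) by rewrite phiK.
  apply: val_inj; rewrite /= [RHS]surjective_pairing phi1 /= fx1 -/t1.
  by rewrite /g scale0r addr0.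
have h1 : h (subpoint T1) = x2.
  rewrite /h; suff -> : ls (subpoint T1) = phi (subpoint Vx2) by rewrite phiK.
  apply: val_inj; rewrite /= [RHS]surjective_pairing phi1 /= fx2 -/t2.
  by rewrite /g scale1r addrC subrK.
have o1 := open_val oT (open_preimage mh oU1).
have o2 := open_val oT (open_preimage mh oU2).
have [||_ [[s1 hs1 <-] [s2 hs2 /val_inj E]]] := line_meet o1 o2.
- by exists 0, (subpoint T0) => //; rewrite /preimage/= h0.
- by exists 1, (subpoint T1) => //; rewrite /preimage/= h1.
rewrite E in hs2; exists (h s1); split=> //; split=> //.
by rewrite /preimage/= /h fpsi.
Qed.

Lemma connected_fibers_chart : connected_fibers f.
Proof.
move=> y; have ir := irreducible_fiber_chart y.
by split; [case: ir|exact: irreducible_connected].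
Qed.

End LocallyLinear.

(** * Representations of the double quiver as families of matrices *)

Arguments eps K {Q} h.

Section MatrixReps.
Variables (K : fieldType) (Q : quiver).
Implicit Types (nu : vertex Q -> nat) (h : dbl Q) (w : seq (dbl Q)).

(** Composing with these matrices places a matrix between given vertices
   without transporting it along an equality of vertices. *)
Definition vid nu j k : 'M[K]_(nu j, nu k) :=
  \matrix_(a, b) ((j == k) && (a == b :> nat))%:R.

Lemma vid_refl nu j : vid nu j j = 1%:M.
Proof. by apply/matrixP => a b; rewrite !mxE eqxx. Qed.

Lemma vid_neq nu j k : j != k -> vid nu j k = 0.
Proof. by move=> /negPf jk; apply/matrixP => a b; rewrite !mxE jk. Qed.

Lemma vid_comm nu nu' (phi : forall j, 'M[K]_(nu j, nu' j)) j k :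
  vid nu j k *m phi k = phi j *m vid nu' j k.
Proof.
have [->|jk] := eqVneq j k; first by rewrite !vid_refl mul1mx mulmx1.
by rewrite !vid_neq// mul0mx mulmx0.
Qed.

Definition mrep nu := forall h, 'M[K]_(nu (src h), nu (tgt h)).

Definition oppm nu (X : mrep nu) h : 'M[K]_(nu (tgt h), nu (src h)) :=
  match h with inl a => X (inr a) | inr a => X (inl a) end.

Definition mum nu (X : mrep nu) j : 'M[K]_(nu j) :=
  \sum_(h : dbl Q) eps K h *:
    (vid nu j (src h) *m X h *m oppm X h *m vid nu (src h) j).

(** The map V_j -> V_k given by the path w, read from left to right; it is zero
   if w is not a path from j to k. *)
Fixpoint pathmx nu (X : mrep nu) w j k : 'M[K]_(nu j, nu k) :=
  if w is h :: w' then vid nu j (src h) *m X h *m pathmx X w' (tgt h) k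
  else vid nu j k.

Lemma pathmx_cat nu (X : mrep nu) w1 w2 j k :
  pathmx X (w1 ++ w2) j k = \sum_m pathmx X w1 j m *m pathmx X w2 m k.
Proof.
elim: w1 j => [|h w1 IH] j /=.
  rewrite (bigD1 j)//= vid_refl mul1mx big1 ?addr0// => m mj.
  by rewrite vid_neq 1?eq_sym// mul0mx.
by rewrite IH mulmx_sumr; apply: eq_bigr => m _; rewrite !mulmxA.
Qed.

Lemma pathmx_rcons nu (X : mrep nu) w h j k :
  pathmx X (rcons w h) j k =
  pathmx X w j (src h) *m X h *m vid nu (tgt h) k.
Proof.
rewrite -cats1 pathmx_cat /= (bigD1 (src h))//= vid_refl mul1mx mulmxA.
rewrite big1 ?addr0// => m mh; by rewrite vid_neq// !mul0mx mulmx0.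
Qed.

(** Morphisms of representations. *)
Definition intertwines nu nu' (X : mrep nu) (Z : mrep nu')
    (phi : forall j, 'M[K]_(nu j, nu' j)) : Prop :=
  forall h, X h *m phi (tgt h) = phi (src h) *m Z h.

Section Intertwine.
Variables (nu nu' : vertex Q -> nat) (X : mrep nu) (Z : mrep nu').
Variable phi : forall j, 'M[K]_(nu j, nu' j).
Hypothesis XZ : intertwines X Z phi.

Lemma pathmx_intertwine w j k :
  pathmx X w j k *m phi k = phi j *m pathmx Z w j k.
Proof.
elim: w j => [|h w IH] j /=; first exact: vid_comm.
by rewrite -mulmxA IH -!mulmxA (mulmxA (X h)) XZ !mulmxA vid_comm.
Qed.

Lemma oppm_intertwine h :
  oppm X h *m phi (src h) = phi (tgt h) *m oppm Z h.
Proof. by case: h => a; [exact: (XZ (inr a))|exact: (XZ (inl a))]. Qed.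

Lemma mum_intertwine j : mum X j *m phi j = phi j *m mum Z j.
Proof.
rewrite mulmx_suml mulmx_sumr; apply: eq_bigr => h _.
rewrite -scalemxAl -scalemxAr; congr (_ *: _).
rewrite -mulmxA vid_comm mulmxA -[_ *m oppm X h *m _]mulmxA oppm_intertwine.
by rewrite -!mulmxA (mulmxA (X h)) XZ !mulmxA vid_comm.
Qed.

End Intertwine.

(** The arrows which move a seminilpotent flag down: all but the opposites of
   loops. For the opposite of an arrow between distinct vertices this holds
   because successive terms of the flag differ at a single vertex. *)
Definition letter h : bool :=
  match h with inl _ => true | inr a => source a != target a end.

Definition nilrep r nu (X : mrep nu) : Prop :=
  forall w j k, (r <= count letter w)%N -> pathmx X w j k = 0.

Lemma count_split w r s : (r + s <= count letter w)%N ->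
  exists w1 w2, [/\ w = w1 ++ w2, (r <= count letter w1)%N &
                    (s <= count letter w2)%N].
Proof.
elim: w r => [|h w IH] r /=.
  by rewrite leqn0 addn_eq0 => /andP[/eqP -> /eqP ->]; exists [::], [::].
case: r => [|r]; first by rewrite add0n => ?; exists [::], (h :: w).
case E: (letter h) => /=.
  rewrite addSn add1n ltnS => /IH[w1 [w2 [-> h1 h2]]].
  by exists (h :: w1), w2; rewrite /= E add1n ltnS.
rewrite add0n => /IH[w1 [w2 [-> h1 h2]]].
by exists (h :: w1), w2; rewrite /= E add0n.
Qed.

End MatrixReps.

Section SplitMatrices.
Variables (K : fieldType) (n a b : nat) (e : n = (a + b)%N).

Definition incm : 'M[K]_(a, n) := castmx (erefl, esym e) (row_mx 1%:M 0).
Definition retm : 'M[K]_(n, a) := castmx (esym e, erefl) (col_mx 1%:M 0).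
Definition prjm : 'M[K]_(n, b) := castmx (esym e, erefl) (col_mx 0 1%:M).
Definition secm : 'M[K]_(b, n) := castmx (erefl, esym e) (row_mx 0 1%:M).

(** The inclusion of the first summand of K^n = K^a + K^b with its retraction,
   and the projection to the second summand with its section. *)
Lemma splitmxE :
  [/\ incm *m retm = 1%:M, incm *m prjm = 0, secm *m retm = 0,
      secm *m prjm = 1%:M & retm *m incm + prjm *m secm = 1%:M].
Proof.
rewrite /incm /retm /prjm /secm; case: n / (esym e) => /=.
rewrite !castmx_id !mul_row_col !mul_col_row !mul0mx !mulmx0 !mulmx1 !addr0
  !add0r.
split=> //; rewrite add_block_mx !addr0 !add0r -scalar_mx_block//.
Qed.

Lemma inc_ret : incm *m retm = 1%:M. Proof. by case: splitmxE. Qed.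
Lemma inc_prj : incm *m prjm = 0. Proof. by case: splitmxE. Qed.
Lemma sec_ret : secm *m retm = 0. Proof. by case: splitmxE. Qed.
Lemma sec_prj : secm *m prjm = 1%:M. Proof. by case: splitmxE. Qed.
Lemma ret_inc : retm *m incm + prjm *m secm = 1%:M. Proof. by case: splitmxE.
  Qed.

End SplitMatrices.

(** * Extensions, and subspaces spanned by paths *)

Section Extensions.
Variables (K : fieldType) (Q : quiver).
Implicit Types (h : dbl Q) (w : seq (dbl Q)).

Section Transfer.
Variables (nu nu' : vertex Q -> nat) (X : mrep K nu) (Z : mrep K nu').
Variable phi : forall j, 'M[K]_(nu j, nu' j).
Variable psi : forall j, 'M[K]_(nu' j, nu j).
Hypothesis XZ : intertwines X Z phi.

Lemma nilrep_mono r : (forall j,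
  phi j *m psi j = 1%:M) -> nilrep r Z -> nilrep r X.
Proof.
move=> pK nZ w j k rw; rewrite -[pathmx X w j k]mulmx1 -pK mulmxA.
by rewrite (pathmx_intertwine XZ) nZ// mulmx0 mul0mx.
Qed.

Lemma nilrep_epi r : (forall j,
  psi j *m phi j = 1%:M) -> nilrep r X -> nilrep r Z.
Proof.
move=> pK nX w j k rw; rewrite -[pathmx Z w j k]mul1mx -pK -mulmxA.
by rewrite -(pathmx_intertwine XZ) nX// mul0mx mulmx0.
Qed.

Lemma mum_mono j : phi j *m psi j = 1%:M -> mum Z j = 0 -> mum X j = 0.
Proof.
move=> pK mZ; rewrite -[mum X j]mulmx1 -pK mulmxA.
by rewrite (mum_intertwine XZ) mZ mulmx0 mul0mx.
Qed.

Lemma mum_epi j : psi j *m phi j = 1%:M -> mum X j = 0 -> mum Z j = 0.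
Proof.
move=> pK mX; rewrite -[mum Z j]mul1mx -pK -mulmxA.
by rewrite -(mum_intertwine XZ) mX mul0mx mulmx0.
Qed.

End Transfer.

Definition conjm nu (g : forall j, 'M[K]_(nu j)) (Y : mrep K nu) : mrep K nu :=
  fun h => invmx (g (src h)) *m Y h *m g (tgt h).

Lemma conjm_intertwine nu (g : forall j, 'M[K]_(nu j)) (Y : mrep K nu) :
  (forall j, g j \in unitmx) -> intertwines Y (conjm g Y) g.
Proof. by move=> gu h; rewrite /conjm !mulmxA mulmxV// mul1mx. Qed.

Variables (nu nu' nu'' : vertex Q -> nat).
Hypothesis e : forall j, nu j = (nu' j + nu'' j)%N.

Local Notation I := (fun j => incm K (e j)).
Local Notation R := (fun j => retm K (e j)).
Local Notation P := (fun j => prjm K (e j)).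
Local Notation S := (fun j => secm K (e j)).

Definition off := forall h, 'M[K]_(nu'' (src h), nu' (tgt h)).

Definition extm (X0 : mrep K nu') (X1 : mrep K nu'') (E : off) : mrep K nu :=
  fun h => R (src h) *m X0 h *m I (tgt h) + P (src h) *m E h *m I (tgt h) +
           P (src h) *m X1 h *m S (tgt h).

Definition subm (Y : mrep K nu) : mrep K nu' :=
  fun h => I (src h) *m Y h *m R (tgt h).
Definition quom (Y : mrep K nu) : mrep K nu'' :=
  fun h => S (src h) *m Y h *m P (tgt h).
Definition offm (Y : mrep K nu) : off :=
  fun h => S (src h) *m Y h *m R (tgt h).

Section Ext.
Variables (X0 : mrep K nu') (X1 : mrep K nu'') (E : off).
Local Notation Y := (extm X0 X1 E).

Lemma inc_extm h : I (src h) *m Y h = X0 h *m I (tgt h).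
Proof.
by rewrite /extm !mulmxDr !mulmxA inc_ret inc_prj mul1mx !mul0mx !addr0.
Qed.

Lemma sec_extm h : S (src h) *m Y h = E h *m I (tgt h) + X1 h *m S (tgt h).
Proof.
by rewrite /extm !mulmxDr !mulmxA sec_ret sec_prj !mul1mx !mul0mx add0r.
Qed.

Lemma extm_prj h : Y h *m P (tgt h) = P (src h) *m X1 h.
Proof.
by rewrite /extm !mulmxDl -!mulmxA inc_prj sec_prj !mulmx0 mulmx1 !add0r.
Qed.

Lemma sub_intertwine : intertwines X0 Y I.
Proof. by move=> h; rewrite inc_extm. Qed.

Lemma quo_intertwine : intertwines Y X1 P.
Proof. by move=> h; rewrite extm_prj. Qed.

Lemma sub_extm h : subm Y h = X0 h.
Proof. by rewrite /subm inc_extm -mulmxA inc_ret mulmx1. Qed.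

Lemma quo_extm h : quom Y h = X1 h.
Proof. by rewrite /quom -mulmxA extm_prj mulmxA sec_prj mul1mx. Qed.

Lemma off_extm h : offm Y h = E h.
Proof.
by rewrite /offm sec_extm mulmxDl -!mulmxA inc_ret sec_ret mulmx1 mulmx0 addr0.
Qed.

(** A path with r1 + r0 letters is a path with r1 letters, which sends V_nu
   into the subrepresentation, followed by a path with r0 letters. *)
Lemma nilrep_extm r0 r1 : nilrep r0 X0 -> nilrep r1 X1 -> nilrep (r1 + r0) Y.
Proof.
move=> n0 n1 w j k /count_split[w1 [w2 [-> c1 c2]]].
rewrite pathmx_cat big1// => m _.
rewrite -[pathmx Y w1 j m]mulmx1 -(ret_inc K (e m)) mulmxDr !mulmxA.
rewrite (pathmx_intertwine quo_intertwine) n1// mulmx0 mul0mx addr0.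
by rewrite -[_ *m pathmx Y w2 m k]mulmxA -(pathmx_intertwine sub_intertwine)
  n0// mul0mx mulmx0.
Qed.

Definition oppe (F : off) h : 'M[K]_(nu'' (tgt h), nu' (src h)) :=
  match h with inl a => F (inr a) | inr a => F (inl a) end.

(** The off-diagonal block of the moment map ([sec_mum_ret]); it is linear in
   F. *)
Definition bmum (F : off) j : 'M[K]_(nu'' j, nu' j) :=
  \sum_(h : dbl Q) eps K h *: (vid K nu'' j (src h) *m
    (F h *m oppm X0 h + X1 h *m oppe F h) *m vid K nu' (src h) j).

Lemma opp_extm_ret h :
  oppm Y h *m R (src h) = R (tgt h) *m oppm X0 h + P (tgt h) *m oppe E h.
Proof.
have ret h' : Y h' *m R (tgt h') = R (src h') *m X0 h' + P (src h') *m E h'.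
  rewrite /extm !mulmxDl -!mulmxA inc_ret sec_ret !mulmx1 !mulmx0 addr0//.
by case: h => a; [exact: (ret (inr a))|exact: (ret (inl a))].
Qed.

Lemma sec_mum_ret j : S j *m mum Y j *m R j = bmum E j.
Proof.
rewrite mulmx_sumr mulmx_suml; apply: eq_bigr => h _.
rewrite -scalemxAr -scalemxAl; congr (_ *: _).
rewrite -!mulmxA (vid_comm R) /= !mulmxA -(vid_comm S) /=; congr (_ *m _).
rewrite -!mulmxA; congr (_ *m _).
rewrite opp_extm_ret !mulmxA sec_extm !(mulmxDl, mulmxDr) !mulmxA.
rewrite -!mulmxA !(mulmxA (incm _ _)) inc_ret inc_prj.
rewrite !(mulmxA (secm _ _)) sec_ret sec_prj.
by rewrite !(mulmx0, mul0mx, mul1mx) ?addr0 ?add0r.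
Qed.

(** The diagonal blocks of the moment map are those of X0 and X1. *)
Lemma mum_extm_eq0 : (forall j, mum X0 j = 0) -> (forall j, mum X1 j = 0) ->
  (forall j, bmum E j = 0) -> forall j, mum Y j = 0.
Proof.
move=> m0 m1 mE j.
have IY : incm K (e j) *m mum Y j = 0.
  by rewrite -(mum_intertwine sub_intertwine) m0 mul0mx.
have YP : mum Y j *m prjm K (e j) = 0.
  by rewrite (mum_intertwine quo_intertwine) m1 mulmx0.
rewrite -[mum Y j]mul1mx -(ret_inc K (e j)) mulmxDl -!mulmxA IY mulmx0 add0r.
rewrite -[mum Y j]mulmx1 -(ret_inc K (e j)) mulmxDr (mulmxA (mum Y j) (prjm _
  _)).
rewrite YP mul0mx addr0 !mulmxA -[prjm _ _ *m secm _ _ *m _]mulmxA.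
by rewrite -(mulmxA (prjm _ _)) sec_mum_ret mE mulmx0 mul0mx.
Qed.

Lemma bmum_eq0 j : mum Y j = 0 -> bmum E j = 0.
Proof. by move=> m0; rewrite -sec_mum_ret m0 mulmx0 mul0mx. Qed.

(** The transpose of F |-> bmum F for the trace pairing. The terms X1_h F_hbar
   are reindexed by h |-> hbar, which changes the sign. *)
Lemma trace_bmum (A : forall j, 'M[K]_(nu' j, nu'' j)) (F : off) :
  \sum_j \tr (bmum F j *m A j) =
  \sum_h \tr (F h *m (eps K h *: (oppm X0 h *m A (src h) - A (tgt h) *m oppm X1
    h))).
Proof.
transitivity (\sum_h eps K h * \tr ((F h *m oppm X0 h + X1 h *m oppe F h) *m A
  (src h))).
  under eq_bigr do rewrite /bmum mulmx_suml raddf_sum/=.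
  rewrite exchange_big/=; apply: eq_bigr => h _.
  rewrite (bigD1 (src h))//= !vid_refl mul1mx mulmx1 big1 ?addr0.
    by rewrite -scalemxAl mxtraceZ.
  by move=> j jh; rewrite vid_neq// !mul0mx scaler0 mul0mx mxtrace0.
rewrite !big_sumType/= -!big_split/=; apply: eq_bigr => a _.
rewrite !mulmxDl !mxtraceD -!scalemxAr !mxtraceZ !mulmxBr !raddfB /=.
rewrite !mul1r !mulN1r !mulmxA.
rewrite -[X1 (inl a) *m _ *m _]mulmxA -[X1 (inr a) *m _ *m _]mulmxA.
rewrite (mxtrace_mulC (X1 (inl a))) (mxtrace_mulC (X1 (inr a))).
by rewrite opprD opprB [- _ - _]addrC addrACA.
Qed.

Lemma bmum_linear (a : K) (F G : off) j :
  bmum (fun h => a *: F h + G h) j = a *: bmum F j + bmum G j.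
Proof.
rewrite /bmum scaler_sumr -big_split; apply: eq_bigr => h _ /=.
rewrite scalerA mulrC -scalerA -scalerDr; congr (_ *: _).
have -> : oppe (fun h => a *: F h + G h) h = a *: oppe F h + oppe G h by case:
  (h).
rewrite scalemxAl -mulmxDl; congr (_ *m _); rewrite scalemxAr -mulmxDr.
congr (_ *m _); rewrite mulmxDl mulmxDr -scalemxAl -scalemxAr.
by rewrite addrACA -scalerDr.
Qed.

Lemma trace_nondeg (M : forall h, 'M[K]_(nu' (tgt h), nu'' (src h))) :
  (forall F : off, \sum_h \tr (F h *m M h) = 0) -> forall h, M h = 0.
Proof.
move=> M0 h; apply/matrixP => b a; rewrite mxE.
(* test against the elementary matrix at h, written without a cast *)
have := M0 (fun h' => \matrix_(a', b')
  ((h' == h) && ((a' == a :> nat) && (b' == b :> nat)))%:R).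
rewrite (bigD1 h)//= big1 ?addr0 => [|h' /negPf h'h]; last first.
  by rewrite /mxtrace big1// => k _; rewrite mxE big1// => k' _;
    rewrite mxE h'h mul0r.
rewrite /mxtrace (bigD1 a)//= [X in _ + X]big1 ?addr0 => [|k ka]; last first.
  by rewrite mxE big1// => k' _;
    rewrite mxE eqxx (negPf (ka : val k != val a)) mul0r.
rewrite mxE (bigD1 b)//= big1 ?addr0 => [|k kb]; last first.
  by rewrite mxE eqxx (negPf (kb : val k != val b)) andbF mul0r.
by rewrite mxE !eqxx mul1r.
Qed.

End Ext.

Lemma extm_decomp (Y : mrep K nu) :
  (forall h, I (src h) *m Y h *m P (tgt h) = 0) ->
  forall h, extm (subm Y) (quom Y) (offm Y) h = Y h.
Proof.
move=> Y0 h; rewrite /extm /subm /quom /offm.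
rewrite -[RHS]mul1mx -(ret_inc K (e (src h))) mulmxDl -[RHS]mulmx1.
rewrite -[in RHS](ret_inc K (e (tgt h))) !mulmxDr !mulmxDl !mulmxA.
rewrite -[_ *m _ *m Y h *m _ *m secm _ _]mulmxA.
have -> : retm K (e (src h)) *m incm K (e (src h)) *m Y h *m prjm K (e (tgt h))
  = 0.
  by rewrite -!mulmxA (mulmxA (incm _ _)) Y0 mulmx0.
by rewrite mul0mx add0r.
Qed.

End Extensions.

Section Generated.
Variables (K : fieldType) (Q : quiver) (i : vertex Q).
Implicit Types (nu : vertex Q -> nat) (h : dbl Q) (w : seq (dbl Q)).

(** Paths of length at most n together with a basis vector of their source. *)
Definition gen_index n nu : finType :=
  ({k : vertex Q & 'I_(nu k)} * n.-bseq (dbl Q))%type.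

Definition gen_row n nu (X : mrep K nu) j (p : gen_index n nu) : 'rV[K]_(nu j)
  :=
  (tag p.1 != i)%:R *: row (tagged p.1) (pathmx X p.2 (tag p.1) j).

(** Its row space at j is spanned by the images of the V_k with k <> i under
   the paths of length at most n; for n large this is I_i(X). *)
Definition pathspan n nu (X : mrep K nu) j : 'M[K]_(#|gen_index n nu|, nu j) :=
  \matrix_r gen_row X j (enum_val r).

Lemma path_pathspan n nu (X : mrep K nu) w k j : k != i -> (size w <= n)%N ->
  (pathmx X w k j <= pathspan n X j)%MS.
Proof.
move=> ki wn; apply/row_subP => a.
have := row_sub (enum_rank (Tagged (fun k =>
  'I_(nu k)) a, Bseq wn)) (pathspan n X j).
by rewrite rowK enum_rankK /gen_row /= ki scale1r.
Qed.

Lemma pathspan_sub n nu (X : mrep K nu) j m (B : 'M[K]_(m, nu j)) :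
  (forall w k, k != i -> (size w <= n)%N -> (pathmx X w k j <= B)%MS) ->
  (pathspan n X j <= B)%MS.
Proof.
move=> XB; apply/row_subP => r; rewrite rowK /gen_row.
have [|ki] := eqVneq (tag (enum_val r).1) i; first by rewrite scale0r sub0mx.
rewrite scale1r (submx_trans (row_sub _ _))// XB//; exact: size_bseq.
Qed.

Definition totdim nu := (\sum_j nu j)%N.

(** The total dimension of the spans of the paths of length at most n is
   bounded, so it is the same for some n and n + 1; from then on the spans are
   stable under the arrows. *)
Lemma path_pathspan_stab n nu (X : mrep K nu) w k j : (totdim nu <= n)%N ->
  k != i -> (pathmx X w k j <= pathspan n X j)%MS.
Proof.
move=> nN ki.
have gS m j' : (pathspan m X j' <= pathspan m.+1 X j')%MS.
  by apply: pathspan_sub => w' k' k'i wm; apply: path_pathspan => //;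
    exact: leqW.
(* if the total rank d grew at each of the first totdim nu + 1 steps, it would
   exceed totdim nu *)
pose d m := (\sum_j' \rank (pathspan m X j'))%N.
have [m mN dm] : exists2 m, (m <= totdim nu)%N & d m.+1 = d m.
  apply: contrapT => h.
  have dlt m : (m <= totdim nu)%N -> (d m < d m.+1)%N.
    move=> mN; rewrite ltn_neqAle; apply/andP; split.
      by apply/eqP => E; apply: h; exists m.
    by apply: leq_sum => j' _; exact: mxrankS.
  have dge m : (m <= (totdim nu).+1)%N -> (m <= d m)%N.
    elim: m => // m IH mN; exact: leq_ltn_trans (IH (ltnW mN)) (dlt _ mN).
  have := dge _ (leqnn _); rewrite ltnNge => /negP; apply.
  by apply: leq_sum => j' _; exact: rank_leq_col.
have stab j' : (pathspan m.+1 X j' <= pathspan m X j')%MS.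
  have /leqif_sum := fun j' (_ : true) => mxrank_leqif_sup (gS m j').
  by move=> [_]; rewrite -/(d m) -/(d m.+1) dm eqxx => /esym/forallP/(_ j').
have all_w w' j' : (pathmx X w' k j' <= pathspan m X j')%MS.
  elim/last_ind: w' j' => [|w' h IH] j'; first exact: path_pathspan.
  rewrite pathmx_rcons -mulmxA (submx_trans (submxMr _ (IH _)))//.
  apply: submx_trans (stab j').
  apply/row_subP => r.
  rewrite row_mul rowK /gen_row.
  have [|k'i] := eqVneq (tag (enum_val r).1) i;
    first by rewrite scale0r mul0mx sub0mx.
  rewrite scale1r -row_mul (submx_trans (row_sub _ _))// mulmxA -pathmx_rcons.
  by apply: path_pathspan => //; rewrite size_rcons ltnS; exact: size_bseq.
apply: submx_trans (all_w w j) _; apply: pathspan_sub => w' k' k'i wm.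
by apply: path_pathspan => //; rewrite (leq_trans wm)// (leq_trans mN).
Qed.

Lemma pathspan_stab n m nu (X : mrep K nu) j : (totdim nu <= n)%N ->
  (pathspan m X j <= pathspan n X j)%MS.
Proof. by move=> nN; apply: pathspan_sub => w k ki _;
  exact: path_pathspan_stab. Qed.

Lemma pathspan_id n nu (X : mrep K nu) j : j != i -> row_full (pathspan n X j).
Proof.
move=> ji; rewrite -sub1mx (submx_trans _ (path_pathspan (w := [::]) X j ji
  _))//.
by rewrite /= vid_refl.
Qed.

Lemma pathspan_act n nu (X : mrep K nu) h : (totdim nu <= n)%N ->
  (pathspan n X (src h) *m X h <= pathspan n X (tgt h))%MS.
Proof.
move=> nN; apply/row_subP => r; rewrite row_mul rowK /gen_row.
have [|ki] := eqVneq (tag (enum_val r).1) i;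
  first by rewrite scale0r mul0mx sub0mx.
rewrite scale1r -row_mul (submx_trans (row_sub _ _))//.
have := path_pathspan_stab X (rcons (enum_val r).2 h) (tgt h) nN ki.
by rewrite pathmx_rcons vid_refl mulmx1.
Qed.

(** With [pathspan_act] and [pathspan_id], this identifies the row space with
   I_i(X). *)
Lemma pathspan_min n nu (X : mrep K nu) (m : vertex Q -> nat)
    (B : forall j, 'M[K]_(m j, nu j)) :
  (forall h, (B (src h) *m X h <= B (tgt h))%MS) ->
  (forall j, j != i -> row_full (B j)) ->
  forall j, (pathspan n X j <= B j)%MS.
Proof.
move=> sB fB j; apply: pathspan_sub => w k ki _.
elim/last_ind: w j => [|w h IH] j.
  have [<-|kj] := eqVneq k j; first exact: submx_full (fB _ ki).
  by rewrite /= vid_neq// sub0mx.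
rewrite pathmx_rcons (submx_trans (submxMr _ (submxMr _ (IH _))))//.
have [->|hj] := eqVneq j (tgt h); first by rewrite vid_refl mulmx1.
by rewrite vid_neq 1?eq_sym// mulmx0 sub0mx.
Qed.

Section GenIntertwine.
Variables (nu nu' : vertex Q -> nat) (X : mrep K nu) (Z : mrep K nu').
Variable phi : forall j, 'M[K]_(nu j, nu' j).
Hypothesis XZ : intertwines X Z phi.

Lemma pathspan_intertwine n j : (pathspan n X j *m phi j <= pathspan n Z j)%MS.
Proof.
apply/row_subP => r; rewrite row_mul rowK /gen_row.
have [|ki] := eqVneq (tag (enum_val r).1) i;
  first by rewrite scale0r mul0mx sub0mx.
rewrite scale1r -row_mul (submx_trans (row_sub _ _))//.
rewrite (pathmx_intertwine XZ) (submx_trans (submxMl _ _))//.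
by apply: path_pathspan => //; exact: size_bseq.
Qed.

Lemma pathspan_intertwine_epi n j (psi : forall k, 'M[K]_(nu' k, nu k)) :
  (forall k, k != i -> psi k *m phi k = 1%:M) ->
  (pathspan n Z j <= pathspan n X j *m phi j)%MS.
Proof.
move=> pK; apply: pathspan_sub => w k ki wn.
rewrite -[pathmx Z w k j]mul1mx -(pK _ ki) -mulmxA -(pathmx_intertwine XZ)
  mulmxA.
by apply: submxMr; rewrite (submx_trans (submxMl _ _))// path_pathspan.
Qed.

(** A morphism which vanishes at the vertices other than i vanishes on
   everything generated from them. *)
Lemma pathspan_kill n : (forall j, j != i -> phi j = 0) ->
  (forall j, row_full (pathspan n X j)) -> forall j, phi j = 0.
Proof.
move=> p0 fX j; apply/eqP; rewrite -submx0 -[phi j]mul1mx.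
rewrite (submx_trans (submxMr _ (submx_full _ (fX j))))//.
apply/row_subP => r; rewrite row_mul rowK /gen_row.
have [|ki] := eqVneq (tag (enum_val r).1) i;
  first by rewrite scale0r mul0mx sub0mx.
rewrite scale1r -row_mul (pathmx_intertwine XZ) p0// mul0mx.
by rewrite (submx_trans (row_sub _ _))// sub0mx.
Qed.

End GenIntertwine.

(** Full rank of the linear system for the off-diagonal block, in dual form: A
   orthogonal to its image is a morphism X0 -> X1. *)
Lemma bmum_surj nu' nu'' n (X0 : mrep K nu') (X1 : mrep K nu'') :
  (forall j, j != i -> nu'' j = 0)%N ->
  (forall j, row_full (pathspan n X0 j)) ->
  forall A : forall j, 'M[K]_(nu' j, nu'' j),
  (forall F : off K nu' nu'', \sum_j \tr (bmum X0 X1 F j *m A j) = 0) ->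
  forall j, A j = 0.
Proof.
move=> nu0 fX A A0.
have M0 h : eps K h *: (oppm X0 h *m A (src h) - A (tgt h) *m oppm X1 h) = 0.
  apply: (@trace_nondeg _ _ nu' nu'' (fun h =>
    eps K h *: (oppm X0 h *m A (src h) - A (tgt h) *m oppm X1 h))) => F.
  by rewrite -trace_bmum.
have XA : intertwines X0 X1 A.
  have M1 h : oppm X0 h *m A (src h) = A (tgt h) *m oppm X1 h.
    apply/eqP; rewrite -subr_eq0; have /eqP := M0 h; rewrite scaler_eq0.
    by case: (h) => a /=; rewrite ?oppr_eq0 oner_eq0.
  by case=> a; [exact: (M1 (inr a))|exact: (M1 (inl a))].
apply: (pathspan_kill XA _ fX) => j ji.
by apply/matrixP => a b; case: b => b hb; exfalso; rewrite nu0 in hb.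
Qed.

End Generated.

(** * Seminilpotency in terms of paths *)

Section RowSpaces.
Variable K : fieldType.

Definition rsv m n (A : 'M[K]_(m, n)) : {vspace 'rV[K]_n} :=
  limg (linfun (mulmxr A) : 'Hom('rV[K]_m, 'rV[K]_n)).

Lemma mem_rsv m n (A : 'M[K]_(m, n)) v : (v \in rsv A) = (v <= A)%MS.
Proof.
apply/memv_imgP/submxP => [[u _ ->]|[u ->]]; exists u; rewrite ?lfunE ?memvf//.
Qed.

Lemma dim_rV n : dim 'rV[K]_n = n.
Proof. by rewrite dim_matrix; exact: mul1n. Qed.

Lemma dim_rsv m n (A : 'M[K]_(m, n)) : \dim (rsv A) = \rank A.
Proof.
have -> : rsv A = rsv (row_base A).
  by apply/vspaceP => v; rewrite !mem_rsv eq_row_base.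
rewrite limg_dim_eq ?dimvf ?dim_rV//.
apply/eqP; rewrite -subv0; apply/subvP => u /memv_capP[_].
rewrite memv_ker lfunE /= mulmx_free_eq0 ?row_base_free// => /eqP ->.
exact: mem0v.
Qed.

Definition vsm n (U : {vspace 'rV[K]_n}) : 'M[K]_(\dim U, n) :=
  \matrix_k (vbasis U)`_k.

Lemma sub_vsm n (U : {vspace 'rV[K]_n}) v : (v <= vsm U)%MS = (v \in U).
Proof.
apply/idP/idP => [/submxP[D ->]|/coord_vbasis ->].
  rewrite mulmx_sum_row rpred_sum// => k _; rewrite rowK rpredZ//.
  by rewrite vbasis_mem// mem_nth// size_tuple.
apply: summx_sub => k _; apply: scalemx_sub;
  rewrite -[_`_k](rowK (fun k => (vbasis U)`_k)).
exact: row_sub.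
Qed.

(** Take a subspace of largest dimension among those contained in P. *)
Lemma vspace_of_pred n (P : 'rV[K]_n -> Prop) : P 0 ->
  (forall a u v, P u -> P v -> P (a *: u + v)) ->
  exists U : {vspace 'rV[K]_n}, forall v, v \in U <-> P v.
Proof.
move=> P0 PL.
pose good d := `[< exists2 U : {vspace 'rV[K]_n}, (forall v,
  v \in U -> P v) & \dim U = d >].
have gex : exists d, good d.
  exists 0%N; apply/asboolP; exists 0%VS; rewrite ?dimv0// => v.
  by rewrite memv0 => /eqP ->.
have gub d : good d -> (d <= n)%N.
  move=> /asboolP[U _ <-]; rewrite -[X in (_ <= X)%N]dim_rV -dimvf.
  exact/dimvS/subvf.
have [d /asboolP[U UP dU] dmax] := ex_maxnP gex gub.
exists U => v; split=> [/UP//|Pv].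
have UvP u : u \in (U + <[v]>)%VS -> P u.
  move=> /memv_addP[u1 /UP Pu1 [_ /vlineP[a ->] ->]].
  by rewrite addrC; exact: PL.
have dUv : (\dim (U + <[v]>) <= \dim U)%N.
  by rewrite dU; apply: dmax; apply/asboolP; exists (U + <[v]>)%VS.
have /eqP -> : U == (U + <[v]>)%VS by rewrite eqEdim addvSl.
by apply: (subvP (addvSr U _)); exact: memv_line.
Qed.

End RowSpaces.

Section RepMatrices.
Variables (K : fieldType) (Q : quiver) (nu : vertex Q -> nat).
Implicit Types (x : rep K nu) (h : dbl Q) (w : seq (dbl Q)).

Definition rmx x : mrep K nu := fun h => lin1_mx (x h).
Definition mxr (M : mrep K nu) : rep K nu := fun h => linfun (mulmxr (M h)).

Lemma rmxE x h v : x h v = v *m rmx x h.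
Proof. by rewrite mul_rV_lin1. Qed.

Lemma mxrK M h : rmx (mxr M) h = M h.
Proof.
by apply/row_matrixP => a; rewrite !rowE -rmxE /mxr lfunE.
Qed.

Lemma rep_ext x y : (forall h, rmx x h = rmx y h) -> x = y.
Proof.
by move=> xy; apply: functional_extensionality_dep => h; apply/lfunP => v;
  rewrite !rmxE xy.
Qed.

Lemma oppmE x h v : opp_map x h v = v *m oppm (rmx x) h.
Proof. by case: h v => a v; [exact: (@rmxE x (inr a))|exact: (@rmxE x (inl a))].
Qed.

(** The summand at j of the moment map, with the cast replaced by [vid]. *)
Lemma untag_lfun s j (f : 'End('rV[K]_(nu s))) (A : 'M[K]_(nu s)) v :
  (forall u, f u = u *m A) ->
  untag 0 (id : 'End('rV[K]_(nu j)) -> 'End('rV[K]_(nu j)))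
    (Tagged (fun j => 'End('rV[K]_(nu j))) f) v =
  v *m (vid K nu j s *m A *m vid K nu s j).
Proof.
move=> fA; have [jE|sj] := eqVneq s j; last first.
  by rewrite untag_dflt// zero_lfunE vid_neq 1?eq_sym// !mul0mx mulmx0.
by case: j / jE v => v; rewrite untagE vid_refl mul1mx mulmx1 -fA.
Qed.

Lemma oppm_comp x h u :
  (opp_map x h \o x h)%VF u = u *m (rmx x h *m oppm (rmx x) h).
Proof. by rewrite comp_lfunE oppmE rmxE mulmxA. Qed.

Lemma muE x j v : mu x j v = v *m mum (rmx x) j.
Proof.
rewrite /mu /mum sum_lfunE mulmx_sumr; apply: eq_bigr => h _.
rewrite scale_lfunE -scalemxAr; congr (_ *: _).
rewrite (untag_lfun _ (@oppm_comp x h)).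
by rewrite !mulmxA.
Qed.

Lemma mu_eq0 x j : mu x j = 0 <-> mum (rmx x) j = 0.
Proof.
split=> E; last by apply/lfunP => v; rewrite muE E mulmx0 zero_lfunE.
by apply/row_matrixP => a; rewrite rowE -muE E zero_lfunE row0.
Qed.

Lemma img_subP x h (U : {vspace 'rV[K]_(nu (src h))})
    (U' : {vspace 'rV[K]_(nu (tgt h))}) : reflect (forall v,
      v \in U -> v *m rmx x h \in U')
  (x h @: U <= U')%VS.
Proof.
apply: (iffP subvP) => [xU v Uv|xU _ /memv_imgP[v Uv ->]].
  by rewrite -rmxE; apply: xU; exact: memv_img.
by rewrite rmxE; exact: xU.
Qed.

Lemma img_mem x h (U : {vspace 'rV[K]_(nu (src h))})
    (U' : {vspace 'rV[K]_(nu (tgt h))}) v :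
  (x h @: U <= U')%VS -> v \in U -> v *m rmx x h \in U'.
Proof. by move=> /img_subP; exact. Qed.

End RepMatrices.

Section Seminilpotent.
Variables (K : fieldType) (Q : quiver) (nu : vertex Q -> nat) (x : rep K nu).
Implicit Types (h : dbl Q) (w : seq (dbl Q)).
Local Notation X := (rmx x).

(** Exposing the length and the flag makes it possible to shorten a flag. *)
Definition sflag r (W : nat -> graded K nu) : Prop :=
  [/\ forall i, W 0%N i = fullv,
      forall i, W r i = 0%VS,
      forall k, (k < r)%N ->
        (forall i, (W k.+1 i <= W k i)%VS) /\
        exists i, forall j, j != i -> W k.+1 j = W k j,
      forall k (a : arrow Q), (k < r)%N ->
        (x (inl a) @: W k (source a) <= W k.+1 (target a))%VS &
      forall k (a : arrow Q), (k < r)%N ->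
        (x (inr a) @: W k (target a) <= W k (source a))%VS].

(** A repeated term can be removed from a flag. The resulting index [bump k0.+1
   m] may be replaced by [bump k0 m], as the two differ only where the flag
   repeats. *)
Lemma sflag_del r W k0 : sflag r.+1 W -> (k0 <= r)%N ->
  (forall j, W k0.+1 j = W k0 j) -> sflag r (fun m => W (bump k0.+1 m)).
Proof.
move=> [W0 Wr Wd Wl Wo] k0r E.
have B1 m j : W (bump k0.+1 m) j = W (bump k0 m) j.
  rewrite /bump; case: (ltngtP k0 m) => // <-; first by rewrite add0n add1n E.
have B2 m : bump k0.+1 m.+1 = (bump k0 m).+1 by rewrite bumpS.
have B3 m : (m < r)%N -> (bump k0 m < r.+1)%N.
  by move=> mr; rewrite /bump; case: (k0 <= m)%N;
    rewrite ?add1n ?add0n ltnS// ltnW.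
split.
- by move=> i; rewrite /bump ltn0 add0n.
- move=> i; rewrite B1 /bump k0r add1n; exact: Wr.
- move=> k kr; have [s [i si]] := Wd _ (B3 _ kr); split.
    by move=> i'; rewrite B2 B1.
  by exists i => j ji; rewrite B2 B1 si.
- by move=> k a kr; rewrite B2 B1; exact/Wl/B3.
- by move=> k a kr; rewrite !B1; exact/Wo/B3.
Qed.

(** A shortest flag has no repetition, so its dimension drops at every step. *)
Lemma sflag_short r W : sflag r W ->
  exists r' W', sflag r' W' /\ (r' <= totdim nu)%N.
Proof.
elim: r W => [|r IH] W fW; first by exists 0%N, W.
have [[k0 k0r E]|nE] := pselect (exists2 k0, (k0 <= r)%N & forall j,
  W k0.+1 j = W k0 j).
  exact: IH (sflag_del fW k0r E).
exists r.+1, W; split=> //.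
have [W0 Wr Wd _ _] := fW.
have dW k : (k <= r.+1)%N -> (\sum_j \dim (W k j) + k <= totdim nu)%N.
  elim: k => [_|k IHk kr].
    rewrite addn0; apply: leq_sum => j _.
    by rewrite W0 dimvf dim_rV.
  apply: leq_trans (IHk (ltnW kr)); rewrite addnS -addSn leq_add2r.
  have [sW _] := Wd _ kr.
  have le_d j : (\dim (W k.+1 j) <= \dim (W k j))%N by exact: dimvS.
  rewrite ltn_neqAle leq_sum ?andbT//; apply/eqP => Ed; apply: nE;
    exists k => // j.
  have /leqif_sum := fun j' (_ : true) => dimv_leqif_eq (sW j').
  by move=> [_]; rewrite Ed eqxx => /esym/forallP/(_ j)/eqP.
have := dW _ (leqnn _); apply: leq_trans; exact: leq_addl.
Qed.

(** For the opposite of an arrow a between distinct vertices, the flag is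
   constant at the target of a, where v then lies one step further, or at the
   source of a. *)
Lemma sflag_letter r W h k v : sflag r W -> (k < r)%N -> letter h ->
  v \in W k (src h) -> v *m X h \in W k.+1 (tgt h).
Proof.
move=> fW; have [_ Wr Wd Wl Wo] := fW; move=> kr; case: h v => a v /= la Wv.
  exact: (@img_mem _ _ _ x (inl a) _ _ _ (Wl _ a kr) Wv).
have Wv' := @img_mem _ _ _ x (inr a) _ _ _ (Wo _ a kr) Wv.
have [_ [j Wj]] := Wd _ kr.
have [sj|sj] := eqVneq (source a) j; last by rewrite Wj.
rewrite -Wj in Wv; last by rewrite -sj eq_sym.
have [kr'|] := ltnP k.+1 r; last first.
  move=> rk; have Ek : k.+1 = r by apply/eqP; rewrite eqn_leq kr.
  rewrite Ek Wr memv0 in Wv; move/eqP: Wv => ->.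
  by rewrite mul0mx mem0v.
exact: (@img_mem _ _ _ x (inr a) _ _ _ (Wo _ a kr') Wv).
Qed.

Lemma sflag_path r W w j j' k v : sflag r W -> (k <= r)%N ->
  v \in W k j -> v *m pathmx X w j j' \in W (minn r (k + count (@letter Q)
    w)%N) j'.
Proof.
move=> fW; have [W0 Wr Wd Wl Wo] := fW.
elim: w j k v => [|h w IH] j k v kr Wv /=.
  rewrite addn0 (minn_idPr kr).
  have [<-|jj'] := eqVneq j j'; first by rewrite vid_refl mulmx1.
  by rewrite vid_neq// mulmx0 mem0v.
rewrite !mulmxA.
have [jh|jh] := eqVneq j (src h);
  last by rewrite vid_neq// mulmx0 !mul0mx mem0v.
move: v Wv; move/esym: jh => jh; case: j / jh => v Wv; rewrite vid_refl mulmx1.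
move: kr; rewrite leq_eqVlt => /orP[/eqP kr|kr].
  by move: Wv; rewrite kr Wr memv0 => /eqP ->; rewrite !mul0mx mem0v.
case lh: (letter h); rewrite ?add1n ?add0n -?addSnnS.
  by apply: IH => //; exact: sflag_letter lh Wv.
apply: IH => //; first exact: ltnW.
case: h lh v Wv => a //= /negbFE/eqP E v Wv.
exact: (@img_mem _ _ _ x (inr a) _ _ _ (Wo _ a kr) Wv).
Qed.

Lemma seminilpotent_nilrep : seminilpotent x -> nilrep (totdim nu) X.
Proof.
move=> [r0 [W0 fW0]]; have [r [W [fW rN]]] := sflag_short fW0.
move=> w j k Nw; apply/row_matrixP => a; rewrite rowE row0.
have W0f : delta_mx 0 a \in W 0%N j by have [-> _ _ _ _] := fW; exact: memvf.
have := sflag_path w k fW (leq0n r) W0f.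
rewrite add0n (minn_idPl (leq_trans rN Nw)).
by have [_ -> _ _ _] := fW; rewrite memv0 => /eqP.
Qed.

(** The vectors killed by all paths with at least c letters form a filtration
   which every letter moves down and every arrow preserves. Its steps are then
   refined one vertex at a time, in the order of an enumeration of the
   vertices: modulo the next step only the opposites of loops act, and they
   preserve each vertex. *)
Lemma nilrep_seminilpotent r : nilrep r X -> seminilpotent x.
Proof.
move=> nX.
have Kex c j : exists U : {vspace 'rV[K]_(nu j)}, forall v, v \in U <->
    forall w k, (c <= count (@letter Q) w)%N -> v *m pathmx X w j k = 0.
  apply: vspace_of_pred => [w k _|a u v Pu Pv w k cw]; first by rewrite mul0mx.
  by rewrite mulmxDl -scalemxAl Pu// Pv// scaler0 addr0.
have [Kr KrP] : exists Kr : nat -> graded K nu, forall c j v, v \in Kr c j <->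
    forall w k, (c <= count (@letter Q) w)%N -> v *m pathmx X w j k = 0.
  exists (fun c j => projT1 (cid (Kex c j))) => c j;
    exact: projT2 (cid (Kex c j)).
have Kle c c' j : (c <= c')%N -> (Kr c j <= Kr c' j)%VS.
  move=> cc'; apply/subvP => v /KrP h; apply/KrP => w k c'w; apply: h.
  exact: leq_trans c'w.
have K0 j : Kr 0%N j = 0%VS.
  apply/eqP; rewrite -subv0; apply/subvP => v /KrP/(_ [::] j isT).
  by rewrite /= vid_refl mulmx1 => ->; exact: mem0v.
have Kact h c c' v : (c <= c' + letter h)%N -> v \in Kr c (src h) ->
    v *m X h \in Kr c' (tgt h).
  move=> cc' /KrP Kv; apply/KrP => w k c'w.
  have := Kv (h :: w) k; rewrite /= vid_refl mul1mx mulmxA; apply.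
  by rewrite (leq_trans cc')// addnC leq_add2l.
pose n := #|vertex Q|.
(* the refined flag: after k = c n + a steps, the first a vertices have moved to
   step c + 1 of the filtration and the others are still at step c *)
pose rk (j : vertex Q) : nat := enum_rank j.
have rkn j : (rk j < n)%N by exact: ltn_ord.
have n0 (j : vertex Q) : (0 < n)%N by exact: leq_ltn_trans (rkn j).
pose E k j := (k %/ n + (rk j < k %% n))%N.
have ES k j : E k.+1 j = (k %/ n + (rk j <= k %% n))%N.
  have nP := n0 j; rewrite /E divnS// modnS; case: ifP => [dk|_]; last first.
    by rewrite add0n ltnS.
  rewrite ltn0 addn0 addnC; congr (_ + _)%N; suff -> : (rk j <= k %% n)%N by [].
  rewrite -ltnS (leq_trans (rkn j))//.
  have : (n %| (k %% n).+1)%N by rewrite -addn1 /dvdn modnDml addn1.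
  exact: dvdn_leq.
pose W c j := Kr (r - c)%N j.
have WS c c' j : (c <= c')%N -> (W c' j <= W c j)%VS.
  by move=> cc'; apply: Kle; exact: leq_sub2l.
have Wact h c c' v : (c' <= c + letter h)%N -> v \in W c (src h) ->
    v *m X h \in W c' (tgt h).
  move=> cc'; apply: Kact; rewrite leq_subLR [X in (_ + X)%N]addnC addnA
    -leq_subLR.
  exact: leq_sub2l.
exists (r * n)%N, (fun k j => W (E k j) j); split.
- move=> j; rewrite /W /E div0n mod0n addn0 subn0.
  apply/vspaceP => v; rewrite memvf; apply/KrP => w k rw.
  by rewrite nX// mulmx0.
- by move=> j; rewrite /W /E mulnK ?n0// modnMl addn0 subnn K0.
- move=> k kr; split.
    move=> j; apply: WS; rewrite ES leq_add2l.
    by case: ltnP => // /ltnW ->.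
  have nP : (0 < n)%N by case: (n) kr => //; rewrite muln0.
  exists (enum_val (Ordinal (ltn_pmod k nP))) => j jk.
  suff -> : E k.+1 j = E k j by []; rewrite ES /E leq_eqVlt;
    case: eqVneq => // rkj.
  case/eqP: jk; apply: enum_rank_inj; rewrite enum_valK.
  exact: val_inj.
- move=> k a kr; apply/(@img_subP _ _ _ x (inl a)) => v; apply: (Wact (inl a)).
  by rewrite ES -addnA leq_add2l addn1 (leq_trans (leq_b1 _)).
- move=> k a kr; apply/(@img_subP _ _ _ x (inr a)) => v; apply: (Wact (inr a)).
  rewrite /= -addnA leq_add2l.
  have [->|_] := eqVneq (source a) (target a); first by rewrite addn0.
  by rewrite addn1 (leq_trans (leq_b1 _)).
Qed.

End Seminilpotent.

Section LambdaMatrices.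
Variables (K : fieldType) (Q : quiver) (nu : vertex Q -> nat).
Implicit Types x : rep K nu.

Lemma LambdaP x : Lambda K nu x <->
  (forall j, mum (rmx x) j = 0) /\ nilrep (totdim nu) (rmx x).
Proof.
split=> -[m0 h]; split.
- by move=> j; apply/mu_eq0.
- exact: seminilpotent_nilrep.
- by move=> j; apply/mu_eq0.
- exact: nilrep_seminilpotent h.
Qed.

Lemma frakI_pathspan x i : is_frakI x i (fun j =>
  rsv (pathspan i (totdim nu) (rmx x) j)).
Proof.
split.
- move=> h; apply/img_subP => v; rewrite !mem_rsv => vg.
  by apply: submx_trans (submxMr _ vg) _; exact: pathspan_act.
- move=> j ji; apply/vspaceP => v; rewrite memvf mem_rsv.
  by apply: submx_full; exact: pathspan_id.
- move=> W' sW fW j; apply/subvP => v; rewrite mem_rsv => vg.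
  rewrite -sub_vsm (submx_trans vg)//.
  apply: (@pathspan_min _ _ _ _ _ _ (fun j => \dim (W' j)) (fun j =>
    vsm (W' j))).
    move=> h; apply/row_subP => r; rewrite row_mul sub_vsm.
    by apply: img_mem (sW h) _; rewrite -sub_vsm row_sub.
  move=> k ki; rewrite -sub1mx; apply/row_subP => r; rewrite sub_vsm fW//.
  exact: memvf.
Qed.

Lemma frakI_unique x i W W' : is_frakI x i W -> is_frakI x i W' ->
  forall j, W j = W' j.
Proof.
move=> [sW fW mW] [sW' fW' mW'] j; apply/eqP; rewrite eqEsubv.
by rewrite mW// mW'.
Qed.

Lemma Lambda_ilP x i l : Lambda_il K nu i l x <-> Lambda K nu x /\
  forall j, (nu j - \rank (pathspan i (totdim nu) (rmx x) j))%N = mult_e l i j.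
Proof.
split=> -[Lx h]; split=> //.
  have [W [/frakI_unique/(_ (frakI_pathspan x i)) EW dW]] := h.
  by move=> j; rewrite -dim_rsv -EW.
exists (fun j => rsv (pathspan i (totdim nu) (rmx x) j)); split.
  exact: frakI_pathspan.
by move=> j; rewrite dim_rsv.
Qed.

End LambdaMatrices.

(** * Linear systems and regular families of matrices *)

Section LinearFunctions.
Variable K : fieldType.

Definition fmx m n (F : 'rV[K]_m -> 'rV[K]_n) : 'M[K]_(m, n) :=
  \matrix_(k, a) F (delta_mx 0 k) 0 a.

Lemma fmxE m n (F : 'rV[K]_m -> 'rV[K]_n) :
  linear F -> forall t, t *m fmx F = F t.
Proof.
move=> lF t; pose F' : {linear 'rV[K]_m -> 'rV[K]_n} :=
  HB.pack F (GRing.isLinear.Build _ _ _ _ F lF).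
have -> : fmx F = lin1_mx F' by apply/matrixP => k a; rewrite !mxE.
by rewrite mul_rV_lin1.
Qed.

Lemma row_full_surj m n (A : 'M[K]_(m, n)) :
  (forall v : 'rV_n, exists u, u *m A = v) -> row_full A.
Proof.
move=> sA; rewrite -sub1mx; apply/row_subP => r.
by have [u <-] := sA (row r 1%:M); exact: submxMl.
Qed.

Lemma row_full_ker m n (A : 'M[K]_(m, n)) :
  (forall v : 'cV_n, A *m v = 0 -> v = 0) -> row_full A.
Proof.
move=> kA; rewrite /row_full -mxrank_tr -[_ == _]/(row_free A^T) -kermx_eq0.
apply/eqP/row_matrixP => r; rewrite row0; apply: (can_inj (@trmxK _ _ _)).
rewrite trmx0; apply: kA; apply: (can_inj (@trmxK _ _ _)).
by rewrite trmx_mul trmxK trmx0 -row_mul mulmx_ker row0.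
Qed.

Lemma free_rows m n (A : 'M[K]_(m, n)) r : \rank A = r ->
  exists kappa : 'I_r -> 'I_m, row_free (rowsub kappa A).
Proof. by move=> <-; exists (maxrankfun A); exact: maxrowsub_free. Qed.

(** The block identity matrix and A have the same rank, so some invertible
   matrix carries one to the other. *)
Lemma completion n a b (e : n = (a + b)%N) (A : 'M[K]_(a, n)) : row_free A ->
  exists T : 'M[K]_(b, n), retm K e *m A + prjm K e *m T \in unitmx.
Proof.
move=> fA; have IA : incm K e *m (retm K e *m A) = A by rewrite mulmxA inc_ret
  mul1mx.
have fI : row_free (incm K e) by apply/row_freeP; exists (retm K e);
  exact: inc_ret.
have [|g gu] := @complete_unitmx _ _ _ (incm K e) (retm K e *m A).
  by rewrite IA (eqP fA) (eqP fI).
rewrite IA => ->; exists (secm K e *m g).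
by rewrite !mulmxA -mulmxDl ret_inc mul1mx.
Qed.

End LinearFunctions.

Section Families.
Variables (K : fieldType) (J : finType) (a b : J -> nat).

Definition fam_index : finType := {j : J & ('I_(a j) * 'I_(b j))%type}.

Definition fam (t : 'rV[K]_#|fam_index|) j : 'M[K]_(a j, b j) :=
  \matrix_(r, s) t 0 (enum_rank (Tagged (fun j =>
    'I_(a j) * 'I_(b j))%type (r, s))).

Definition unfam (M : forall j, 'M[K]_(a j, b j)) : 'rV[K]_#|fam_index| :=
  \row_k M (tag (enum_val k)) (tagged (enum_val k)).1 (tagged (enum_val k)).2.

Lemma unfamK M j : fam (unfam M) j = M j.
Proof. by apply/matrixP => r s; rewrite !mxE enum_rankK. Qed.

Lemma famK t : unfam (fam t) = t.
Proof.
apply/rowP => k; rewrite !mxE; congr (t 0 _); apply: (canLR enum_valK).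
by case: (enum_val k) => j [r s].
Qed.

Lemma fam_linear j : linear (fam ^~ j).
Proof. by move=> c u v; apply/matrixP => r s; rewrite !mxE. Qed.

(** The standard pairing of vectors is the trace pairing of families of
   matrices. *)
Lemma unfam_mul M (v : 'cV[K]_#|fam_index|) :
  unfam M *m v = (\sum_j \tr (M j *m (fam v^T j)^T))%:M.
Proof.
apply/matrixP => r s; rewrite !ord1 !mxE eqxx mulr1n.
rewrite (reindex_onto (@enum_rank fam_index) enum_val) => [|k _];
  last exact: enum_valK.
under eq_bigl do rewrite enum_rankK eqxx.
transitivity (\sum_(p : fam_index) M (tag p) (tagged p).1 (tagged p).2 *
    fam v^T (tag p) (tagged p).1 (tagged p).2).
  apply: eq_bigr => -[j [r' s']] _; rewrite !mxE enum_rankK /=;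
    congr (_ * v _ _).
rewrite -(@sig_big_dep _ _ _ _ _ predT (fun _ => predT)
  (fun j rs => M j rs.1 rs.2 * fam v^T j rs.1 rs.2))/=.
apply: eq_bigr => j _; rewrite /mxtrace -(pair_bigA _ (fun r s =>
  M j r s * fam v^T j r s))/=.
by apply: eq_bigr => r' _; rewrite !mxE; apply: eq_bigr => s' _; rewrite !mxE.
Qed.

Lemma regular_fam (X : kspace K) (U : set X) (t : X -> 'rV[K]_#|fam_index|) j :
  open U -> regular_mx U t -> regular_mx U (fun x => fam (t x) j).
Proof.
move=> oU rt r s; set k := enum_rank (Tagged (fun j =>
  'I_(a j) * 'I_(b j))%type (r, s)).
by apply: (@regular_ext _ _ _ (fun x => t x 0 k)) => // x _; rewrite mxE.
Qed.

Lemma regular_unfam (X : kspace K) (U : set X)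
    (M : X -> forall j, 'M[K]_(a j, b j)) :
  open U -> (forall j, regular_mx U (M ^~ j)) ->
  regular_mx U (fun x => unfam (M x)).
Proof.
move=> oU rM r k; set p := enum_val k.
apply: (@regular_ext _ _ _ (fun x =>
  M x (tag p) (tagged p).1 (tagged p).2)) => //.
  by move=> x _; rewrite mxE.
exact: rM.
Qed.

End Families.

Section FamilyDet.
Variables (K : fieldType) (J : finType) (a : J -> nat) (m : nat).
Variable s : 'I_#|fam_index a a| -> 'I_m.

Definition fam_det : mpoly m K := \prod_j
  \det (\matrix_(r, c) mpolyX K (mnm1 (s (enum_rank
    (Tagged (fun j => 'I_(a j) * 'I_(a j))%type (r,
      c) : fam_index a a)))) : 'M_(a j)).

Lemma meval_fam_det (t : 'rV[K]_m) :
  meval (t 0) fam_det = \prod_j \det (fam (\row_k t 0 (s k)) j).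
Proof.
rewrite /fam_det rmorph_prod; apply: eq_bigr => j _ /=.
rewrite -det_map_mx; congr (\det _); apply/matrixP => r c.
by rewrite !mxE /= mevalXU.
Qed.

Lemma fam_det_neq0 (t : 'rV[K]_m) : reflect
  (forall j, fam (\row_k t 0 (s k)) j \in unitmx) (meval (t 0) fam_det != 0).
Proof.
rewrite meval_fam_det; apply: (iffP idP) => [/prodf_neq0 h j|h].
  by rewrite unitmxE unitfE; exact: h.
by apply/prodf_neq0 => j _; have := h j; rewrite unitmxE unitfE.
Qed.

End FamilyDet.

#[local] Hint Extern 0 (open setT) => exact: openT : core.

Section RegularReps.
Variables (K : fieldType) (Q : quiver).
Implicit Types (nu : vertex Q -> nat) (h : dbl Q).

Lemma regular_rmx nu h :
  regular_mx (setT : set (rep_space K nu)) (fun x => rmx x h).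
Proof.
move=> r s; set p : rep_index nu := Tagged (fun h =>
  'I_(nu (src h)) * 'I_(nu (tgt h)))%type (r, s).
apply: (@regular_ext _ (rep_space K nu) setT (fun x =>
  rep_coord (x : rep K nu) (enum_rank p))) => //.
  by move=> x _; rewrite mxE /rep_coord enum_rankK.
exact: regular_zariski.
Qed.

Lemma is_morphism_rep nu (Y : kspace K) (f : Y -> rep_space K nu) :
  (forall h, regular_mx setT (fun y => rmx (f y) h)) -> is_morphism f.
Proof.
move=> rf; apply: is_morphism_zariski => k; set p := enum_val k.
apply: (@regular_ext _ _ _ (fun y =>
  rmx (f y) (tag p) (tagged p).1 (tagged p).2)) => //.
  by move=> x _; rewrite mxE.
exact: rf.
Qed.

Variables (X : kspace K) (U : set X).
Hypothesis oU : open U.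

Definition regular_mrep nu (M : X -> mrep K nu) : Prop :=
  forall h, regular_mx U (M ^~ h).

Lemma regular_pathmx nu (M : X -> mrep K nu) w j k : regular_mrep M ->
  regular_mx U (fun x => pathmx (M x) w j k).
Proof.
move=> rM; elim: w j => [|h w IH] j /=; first exact: regular_mx_cst.
by apply: regular_mxM => //; apply: regular_mxM => //; exact: regular_mx_cst.
Qed.

Lemma regular_oppm nu (M : X -> mrep K nu) h : regular_mrep M ->
  regular_mx U (fun x => oppm (M x) h).
Proof. by move=> rM; case: h => a;
  [exact: (rM (inr a))|exact: (rM (inl a))]. Qed.

Lemma regular_mum nu (M : X -> mrep K nu) j : regular_mrep M ->
  regular_mx U (fun x => mum (M x) j).
Proof.
move=> rM; apply: regular_mx_sum => // h _.
apply: regular_mxZ => //; first exact: regular_cst.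
apply: regular_mxM => //; last exact: regular_mx_cst.
apply: regular_mxM => //; last exact: regular_oppm.
by apply: regular_mxM => //; exact: regular_mx_cst.
Qed.

Lemma regular_pathspan i n nu (M : X -> mrep K nu) j : regular_mrep M ->
  regular_mx U (fun x => pathspan i n (M x) j).
Proof.
move=> rM r s; set p := enum_val r.
apply: (@regular_ext _ _ _
  (fun x => (tag p.1 != i)%:R * pathmx (M x) p.2 (tag p.1) j (tagged p.1) s))
    => //.
  by move=> x _; rewrite !mxE.
apply: regularM => //; first exact: regular_cst.
exact: regular_pathmx.
Qed.

Section Ext.
Variables (nu nu' nu'' : vertex Q -> nat).
Variable e : forall j, nu j = (nu' j + nu'' j)%N.

Lemma regular_extm (X0 : X -> mrep K nu') (X1 : X -> mrep K nu'')
    (E : X -> off K nu' nu'') : regular_mrep X0 -> regular_mrep X1 ->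
  (forall h, regular_mx U (E ^~ h)) ->
  regular_mrep (fun x => extm e (X0 x) (X1 x) (E x)).
Proof.
move=> r0 r1 rE h; apply: regular_mxD => //; first apply: regular_mxD => //.
- by apply: regular_mxM => //; [apply: regular_mxM => //|];
    exact: regular_mx_cst.
- by apply: regular_mxM => //; [apply: regular_mxM => //|];
    exact: regular_mx_cst.
- by apply: regular_mxM => //; [apply: regular_mxM => //|];
    exact: regular_mx_cst.
Qed.

Lemma regular_bmum (X0 : X -> mrep K nu') (X1 : X -> mrep K nu'')
    (E : X -> off K nu' nu'') j : regular_mrep X0 -> regular_mrep X1 ->
  (forall h, regular_mx U (E ^~ h)) ->
  regular_mx U (fun x => bmum (X0 x) (X1 x) (E x) j).
Proof.
move=> r0 r1 rE; apply: regular_mx_sum => // h _.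
apply: regular_mxZ => //; first exact: regular_cst.
apply: regular_mxM => //; last exact: regular_mx_cst.
apply: regular_mxM => //; first exact: regular_mx_cst.
apply: regular_mxD => //; apply: regular_mxM => //; first exact: regular_oppm.
by case: h => a; [exact: (rE (inr a))|exact: (rE (inl a))].
Qed.

Lemma regular_subm (Y : X -> mrep K nu) : regular_mrep Y ->
  regular_mrep (fun x => subm e (Y x)).
Proof.
by move=> rY h; apply: regular_mxM => //; [apply: regular_mxM => //|];
  exact: regular_mx_cst.
Qed.

Lemma regular_quom (Y : X -> mrep K nu) : regular_mrep Y ->
  regular_mrep (fun x => quom e (Y x)).
Proof.
by move=> rY h; apply: regular_mxM => //; [apply: regular_mxM => //|];
  exact: regular_mx_cst.
Qed.

Lemma regular_offm (Y : X -> mrep K nu) : regular_mrep Y ->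
  forall h, regular_mx U (fun x => offm e (Y x) h).
Proof.
by move=> rY h; apply: regular_mxM => //; [apply: regular_mxM => //|];
  exact: regular_mx_cst.
Qed.

Lemma regular_conjm (g : X -> forall j, 'M[K]_(nu j)) (Y : X -> mrep K nu) :
  (forall x j, U x -> g x j \in unitmx) -> (forall j, regular_mx U (g ^~ j)) ->
  regular_mrep Y -> regular_mrep (fun x => conjm (g x) (Y x)).
Proof.
move=> gu rg rY h; apply: regular_mxM => //; apply: regular_mxM => //.
apply: regular_mx_inv => // x Ux.
by have := gu x (src h) Ux; rewrite unitmxE unitfE.
Qed.

End Ext.
End RegularReps.

(** * Gluing and cutting representations *)

Lemma intertwines_comp (K : fieldType) (Q : quiver)
    (nu nu' nu'' : vertex Q -> nat)
    (X : mrep K nu) (Y : mrep K nu') (Z : mrep K nu'')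
    (phi : forall j, 'M[K]_(nu j, nu' j)) (psi : forall j, 'M[K]_(nu' j,
      nu'' j)) :
  intertwines X Y phi -> intertwines Y Z psi ->
  intertwines X Z (fun j => phi j *m psi j).
Proof. by move=> XY YZ h; rewrite mulmxA XY -!mulmxA YZ. Qed.

Section Conjugation.
Variables (K : fieldType) (Q : quiver) (nu : vertex Q -> nat).
Variable g : forall j, 'M[K]_(nu j).
Hypothesis gu : forall j, g j \in unitmx.

Lemma conjmK (Y : mrep K nu) : conjm (fun j => invmx (g j)) (conjm g Y) = Y.
Proof.
apply: functional_extensionality_dep => h; rewrite /conjm invmxK !mulmxA.
by rewrite mulmxV// mul1mx -mulmxA mulmxV// mulmx1.
Qed.

Lemma conjmKV (Y : mrep K nu) : conjm g (conjm (fun j => invmx (g j)) Y) = Y.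
Proof.
apply: functional_extensionality_dep => h; rewrite /conjm invmxK !mulmxA.
by rewrite mulVmx// mul1mx -mulmxA mulVmx// mulmx1.
Qed.

Lemma conjm_intertwineV (Y : mrep K nu) :
  intertwines (conjm (fun j => invmx (g j)) Y) Y g.
Proof. by rewrite -{2}(conjmKV Y); exact: conjm_intertwine. Qed.

End Conjugation.

Section GlueCut.
Variables (K : fieldType) (Q : quiver) (i : vertex Q).
Variables (nu nu' nu'' : vertex Q -> nat) (N : nat).
Hypothesis e : forall j, nu j = (nu' j + nu'' j)%N.
Hypothesis nu''0 : forall j, j != i -> nu'' j = 0%N.
Hypothesis nuN : (totdim nu <= N)%N.

(** The bound r is left free: it is additive in extensions, whereas the
   dimension vectors vary. *)
Definition lambda_mx nu0 (X : mrep K nu0) : Prop :=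
  (forall j, mum X j = 0) /\ exists r, @nilrep K Q r nu0 X.

(** The subspace is everything at the vertices other than i. *)
Lemma ret_inc_id j : j != i -> retm K (e j) *m incm K (e j) = 1%:M.
Proof.
move=> ji; rewrite -[RHS](ret_inc K (e j)).
suff -> : prjm K (e j) = 0 by rewrite mul0mx addr0.
apply/matrixP => a [b hb]; exfalso; by rewrite nu''0 in hb.
Qed.

Lemma inc_epi (g : forall j, 'M[K]_(nu j)) k :
  (forall j, g j \in unitmx) -> k != i ->
  invmx (g k) *m retm K (e k) *m (incm K (e k) *m g k) = 1%:M.
Proof.
move=> gu ki; rewrite mulmxA -[_ *m _ *m incm _ _]mulmxA ret_inc_id// mulmx1.
exact: mulVmx.
Qed.

Lemma lambda_mx_conj (g : forall j, 'M[K]_(nu j)) (Y : mrep K nu) :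
  (forall j, g j \in unitmx) -> lambda_mx Y -> lambda_mx (conjm g Y).
Proof.
move=> gu [m0 [r nY]]; have YZ := conjm_intertwine Y gu.
split=> [j|]; first by apply: (mum_epi (psi := fun j => invmx (g j)) YZ);
  rewrite ?mulVmx.
by exists r; apply: (nilrep_epi (psi := fun j => invmx (g j)) YZ) => // j;
  rewrite mulVmx.
Qed.

Section Glue.
Variables (X0 : mrep K nu') (X1 : mrep K nu'') (E : off K nu' nu'').
Variable g : forall j, 'M[K]_(nu j).
Hypotheses (lX0 : lambda_mx X0) (lX1 : lambda_mx X1).
Hypothesis fX0 : forall j, row_full (pathspan i N X0 j).
Hypothesis bE : forall j, bmum X0 X1 E j = 0.
Hypothesis gu : forall j, g j \in unitmx.
Local Notation Y := (conjm g (extm e X0 X1 E)).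

Lemma glue_lambda : lambda_mx Y.
Proof.
apply: lambda_mx_conj => //; have [m0 [r0 n0]] := lX0; have [m1 [r1 n1]] := lX1.
split; first exact: mum_extm_eq0.
by exists (r1 + r0)%N; exact: nilrep_extm.
Qed.

Lemma glue_intertwine : intertwines X0 Y (fun j => incm K (e j) *m g j).
Proof.
apply: intertwines_comp (conjm_intertwine _ gu).
exact: sub_intertwine.
Qed.

(** I_i of an extension of X1 by X0 is the subrepresentation: it contains the
   image of I_i(X0), and is contained in the subrepresentation since the latter
   is stable and contains all vertices other than i. *)
Lemma glue_span j : (pathspan i N Y j :=: incm K (e j) *m g j)%MS.
Proof.
apply/eqmxP/andP; split.
  apply: submx_trans (submxMl (pathspan i N X0 j) _).
  apply: (pathspan_intertwine_epi glue_intertwine N j (psi := fun k =>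
    invmx (g k) *m retm K (e k))).
  by move=> k; exact: inc_epi.
apply: submx_trans (pathspan_intertwine _ glue_intertwine N j).
rewrite -{1}[incm _ _ *m g j]mul1mx; apply: submxMr.
exact: submx_full.
Qed.

End Glue.

Section Cut.
Variables (Y : mrep K nu) (g : forall j, 'M[K]_(nu j)).
Hypotheses (lY : lambda_mx Y) (gu : forall j, g j \in unitmx).
Hypothesis gY : forall j, (pathspan i N Y j :=: incm K (e j) *m g j)%MS.
Local Notation Z := (conjm (fun j => invmx (g j)) Y).

Let gVu j : invmx (g j) \in unitmx. Proof. by rewrite unitmx_inv. Qed.

(** The row space of the inclusion followed by g is I_i(Y), which is stable. *)
Lemma cut_block h : incm K (e (src h)) *m Z h *m prjm K (e (tgt h)) = 0.
Proof.
rewrite /conjm invmxK !mulmxA.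
have : (incm K (e (src h)) *m g (src h) *m Y h <= incm K (e (tgt h)) *m g (tgt
  h))%MS.
  have g1 j : (pathspan i N Y j <= incm K (e j) *m g j)%MS by rewrite gY.
  have g2 j : (incm K (e j) *m g j <= pathspan i N Y j)%MS by rewrite gY.
  apply: (submx_trans _ (g1 _));
    apply: (submx_trans _ (pathspan_act i Y h nuN)).
  by apply: submxMr; exact: g2.
by move=> /submxP[M ->]; rewrite -!mulmxA (mulmxA (g _)) mulmxV// mul1mx
  inc_prj mulmx0.
Qed.

Lemma cut_ext : extm e (subm e Z) (quom e Z) (offm e Z) = Z.
Proof.
by apply: functional_extensionality_dep => h; apply: extm_decomp;
  exact: cut_block.
Qed.

Lemma cut_lambda : lambda_mx Z. Proof. exact: lambda_mx_conj. Qed.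

Lemma cut_sub_lambda : lambda_mx (subm e Z).
Proof.
have [m0 [r nZ]] := cut_lambda.
have := sub_intertwine e (subm e Z) (quom e Z) (offm e Z);
  rewrite cut_ext => SZ.
split=> [j|]; first exact: (mum_mono (psi := fun j =>
  retm K (e j)) SZ (inc_ret K (e j)) (m0 j)).
by exists r; apply: (nilrep_mono (psi := fun j => retm K (e j)) SZ _ nZ) => j;
  exact: inc_ret.
Qed.

Lemma cut_quo_lambda : lambda_mx (quom e Z).
Proof.
have [m0 [r nZ]] := cut_lambda.
have := quo_intertwine e (subm e Z) (quom e Z) (offm e Z);
  rewrite cut_ext => ZQ.
split=> [j|]; first exact: (mum_epi (psi := fun j =>
  secm K (e j)) ZQ (sec_prj K (e j)) (m0 j)).
by exists r; apply: (nilrep_epi (psi := fun j => secm K (e j)) ZQ _ nZ) => j;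
  exact: sec_prj.
Qed.

Lemma cut_bmum j : bmum (subm e Z) (quom e Z) (offm e Z) j = 0.
Proof. by apply: (bmum_eq0 (e := e)); rewrite cut_ext;
  have [m0 _] := cut_lambda. Qed.

(** A path from a vertex other than i starts in the subrepresentation, so it is
   already a path of the subrepresentation. *)
Lemma cut_sub_full j : row_full (pathspan i N (subm e Z) j).
Proof.
have := sub_intertwine e (subm e Z) (quom e Z) (offm e Z);
  rewrite cut_ext => SZ.
have SY := intertwines_comp SZ (conjm_intertwineV gu Y).
have := pathspan_intertwine_epi SY N j (psi := fun k =>
  invmx (g k) *m retm K (e k))
  (fun k => @inc_epi g k gu).
rewrite (gY j) => /(submxMr (invmx (g j) *m retm K (e j))).
rewrite !mulmxA -!(mulmxA _ (g j)) mulmxV// !mulmx1 -!mulmxA inc_ret mulmx1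
  sub1mx.
by [].
Qed.

End Cut.
End GlueCut.

(** * The space of extensions and its two projections *)

Section Correspondence.
Variables (K : numFieldType) (Q : quiver) (i : vertex Q) (l : nat).
Variables (nu nu' nu'' : vertex Q -> nat).
Hypothesis e : forall j, nu j = (nu' j + nu'' j)%N.
Hypothesis nu''E : forall j, mult_e l i j = nu'' j.

Let N := totdim nu.

Let nu''0 j : j != i -> nu'' j = 0%N.
Proof. by move=> /negPf ji; rewrite -nu''E /mult_e ji muln0. Qed.

Lemma LambdaE nu0 (x : rep K nu0) : @Lambda K Q nu0 x <-> lambda_mx (rmx x).
Proof.
split=> [/LambdaP[m0 nx]|[m0 [r nx]]]; first by split=> //; exists (totdim nu0).
by split=> [j|]; [exact/mu_eq0|exact: nilrep_seminilpotent nx].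
Qed.

Lemma L0P (x : rep K nu') : Lambda_il K nu' i 0 x <->
  lambda_mx (rmx x) /\ forall j, row_full (pathspan i N (rmx x) j).
Proof.
have le_tot : (totdim nu' <= N)%N by apply: leq_sum => j _; rewrite e leq_addr.
have rk j : \rank (pathspan i (totdim nu') (rmx x) j) = \rank (pathspan i N
  (rmx x) j).
  by apply/eqP; rewrite eqn_leq !mxrankS// pathspan_stab.
rewrite Lambda_ilP LambdaE; split=> -[lx h]; split=> // j.
  have /eqP := h j; rewrite /mult_e mul0n subn_eq0 rk => le.
  by rewrite /row_full eqn_leq rank_leq_col.
by rewrite rk (eqP (h j)) subnn.
Qed.

Lemma LLP (x : rep K nu) : Lambda_il K nu i l x <->
  lambda_mx (rmx x) /\ forall j, \rank (pathspan i N (rmx x) j) = nu' j.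
Proof.
rewrite Lambda_ilP LambdaE; split=> -[lx h]; split=> // j.
  rewrite -[LHS](subKn (rank_leq_col _)) h nu''E e addnK//.
by rewrite h e addKn nu''E.
Qed.

Local Notation LL := (sub_space (Lambda_il K nu i l)).
Local Notation L0 := (sub_space (Lambda_il K nu' i 0)).
Local Notation L1 := (sub_space (Lambda K nu'')).
Local Notation base := (prod_space L0 L1).

Definition gl_index := fam_index nu nu.
Definition off_index :=
  fam_index (fun h : dbl Q => nu'' (src h)) (fun h => nu' (tgt h)).
Local Notation mg := #|gl_index|.
Local Notation mE := #|off_index|.
Local Notation m := (mg + mE)%N.

Definition gpart (t : 'rV[K]_m) : forall j, 'M[K]_(nu j) :=
  fam (lsubmx t : 'rV_#|fam_index nu nu|).
Definition epart (t : 'rV[K]_m) : off K nu' nu'' :=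
  fam (rsubmx t : 'rV_#|fam_index (fun h => nu'' (src h)) (fun h =>
    nu' (tgt h))|).
Definition join_parts (g : forall j,
  'M[K]_(nu j)) (E : off K nu' nu'') : 'rV[K]_m :=
  row_mx (unfam g) (unfam (E : forall h, 'M_(nu'' (src h), nu' (tgt h)))).

Lemma gpartK g E : gpart (join_parts g E) = g.
Proof.
apply: functional_extensionality_dep => j.
by rewrite /gpart /join_parts row_mxKl unfamK.
Qed.

Lemma epartK g E : epart (join_parts g E) = E.
Proof.
apply: functional_extensionality_dep => h.
by rewrite /epart /join_parts row_mxKr unfamK.
Qed.

Lemma join_partsK t : join_parts (gpart t) (epart t) = t.
Proof. by rewrite /join_parts /gpart /epart !famK hsubmxK. Qed.

Definition X0 (z : base) : mrep K nu' := rmx (val z.1).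
Definition X1 (z : base) : mrep K nu'' := rmx (val z.2).

Definition eqn_fun (z : base) (t : 'rV[K]_m) : 'rV[K]_#|fam_index nu'' nu'| :=
  unfam (bmum (X0 z) (X1 z) (epart t)).
Definition eqn_mx (z : base) : 'M[K]_(m,
  #|fam_index nu'' nu'|) := fmx (eqn_fun z).
Definition gl_det : mpoly m K := @fam_det K _ nu m (lshift mE).

Lemma gl_detP (t : 'rV[K]_m) :
  reflect (forall j, gpart t j \in unitmx) (meval (t 0) gl_det != 0).
Proof.
have -> : gpart t = fam (\row_k t 0 (lshift mE k)).
  apply: functional_extensionality_dep => j; congr (fam _ j).
  by apply/rowP => k; rewrite !mxE.
exact: fam_det_neq0.
Qed.

Lemma eqn_mxE z t : t *m eqn_mx z = eqn_fun z t.
Proof.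
apply: fmxE => c u v; rewrite /eqn_fun; apply/rowP => k; rewrite !mxE.
have -> : epart (c *: u + v) = fun h => c *: epart u h + epart v h.
  apply: functional_extensionality_dep => h.
  by rewrite /epart linearP/= fam_linear.
by rewrite bmum_linear !mxE.
Qed.

Lemma eqn_eq0 z t : t *m eqn_mx z = 0 <->
  forall j, bmum (X0 z) (X1 z) (epart t) j = 0.
Proof.
rewrite eqn_mxE; split=> h.
  move=> j; rewrite -(unfamK (bmum (X0 z) (X1 z) (epart t))) -/(eqn_fun z t) h.
  by apply/matrixP => r s; rewrite !mxE.
by apply/rowP => k; rewrite !mxE h mxE.
Qed.

Lemma base_lambda0 (z : base) : lambda_mx (X0 z).
Proof. by have /L0P[] := set_valP z.1. Qed.

Lemma base_full (z : base) j : row_full (pathspan i N (X0 z) j).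
Proof. by have /L0P[_] := set_valP z.1. Qed.

Lemma base_lambda1 (z : base) : lambda_mx (X1 z).
Proof. by have /LambdaE := set_valP z.2. Qed.

(** A column vector v killed by the matrix of the system is a family A
   orthogonal to the image of the off-diagonal moment map. *)
Lemma eqn_mx_full z : row_full (eqn_mx z).
Proof.
apply: row_full_ker => v ev.
have A0 := bmum_surj (X1 := X1 z) nu''0 (base_full z) (A := fun j =>
  (fam v^T j)^T).
have f0 j : fam v^T j = 0.
  apply: (can_inj (@trmxK _ _ _)); rewrite trmx0; apply: A0 => F.
  have : join_parts (fun=> 0) F *m eqn_mx z *m v = 0 by rewrite -mulmxA ev
    mulmx0.
  rewrite eqn_mxE /eqn_fun epartK unfam_mul => /matrixP/(_ 0 0).
  by rewrite !mxE eqxx mulr1n.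
have vT : v^T = 0.
  by rewrite -(famK v^T); apply/rowP => k; rewrite /unfam mxE f0 !mxE.
by rewrite -[v]trmxK vT trmx0.
Qed.

Definition ext_locus : set (prod_space base (affine_space K m)) :=
  lin_locus setT eqn_mx gl_det.
(** The variety of the diagram: triples (x0, x1), g, E with E a solution of the
   off-diagonal moment map equation. *)
Definition ext_space : kspace K := sub_space ext_locus.
Definition base_proj (u : ext_space) : base := (val u).1.
Definition params (u : ext_space) : 'rV[K]_m := (val u).2.

Lemma ext_spaceP (u : ext_space) :
  (forall j, gpart (params u) j \in unitmx) /\
  (forall j, bmum (X0 (base_proj u)) (X1 (base_proj u)) (epart (params u)) j =
    0).
Proof. by have [_ /gl_detP ? /eqn_eq0 ?] := set_valP u. Qed.

Definition glued (u : ext_space) : mrep K nu :=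
  conjm (gpart (params u)) (extm e (X0 (base_proj u)) (X1 (base_proj u)) (epart
    (params u))).

Lemma glued_span u j :
  (pathspan i N (glued u) j :=: incm K (e j) *m gpart (params u) j)%MS.
Proof.
have [gu bu] := ext_spaceP u.
exact: (glue_span e nu''0 _ _ (base_full _) gu).
Qed.

Lemma rank_inc (g : forall j, 'M[K]_(nu j)) j : g j \in unitmx ->
  \rank (incm K (e j) *m g j) = nu' j.
Proof.
move=> gu; rewrite mxrankMfree ?row_free_unit//; apply/eqP.
by apply/row_freeP; exists (retm K (e j)); exact: inc_ret.
Qed.

Lemma glued_LL u : Lambda_il K nu i l (mxr (glued u)).
Proof.
apply/LLP; have -> : rmx (mxr (glued u)) = glued u.
  by apply: functional_extensionality_dep => h; rewrite mxrK.
have [gu bu] := ext_spaceP u; split.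
  exact: glue_lambda (base_lambda0 _) (base_lambda1 _) bu gu.
by move=> j; rewrite glued_span rank_inc.
Qed.

(** The map q of the diagram. *)
Definition glue_map (u : ext_space) : LL :=
  @subpoint _ (rep_space K nu) (Lambda_il K nu i l) _ (glued_LL u).

Lemma rmx_glue_map u : rmx (val (glue_map u)) = glued u.
Proof. by apply: functional_extensionality_dep => h; rewrite /= mxrK. Qed.

Lemma is_morphism_base_proj : is_morphism base_proj.
Proof. exact: is_morphism_comp (@is_morphism_val _ _ _) (@is_morphism_fst _ _
  _). Qed.

Lemma regular_params : regular_mx (setT : set ext_space) params.
Proof.
apply: (regular_mx_comp (f := (fun u : ext_space =>
  (val u).2 : affine_space K m)) _ (@regular_mx_affine K m)).
exact: is_morphism_comp (@is_morphism_val _ _ _) (@is_morphism_snd _ _ _).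
Qed.

Lemma regular_gpart (Y : kspace K) (U : set Y) (t : Y -> 'rV[K]_m) j : open U ->
  regular_mx U t -> regular_mx U (fun y => gpart (t y) j).
Proof.
move=> oU rt; apply: regular_fam => // r s.
by apply: (@regular_ext _ _ _ (fun y => t y r (lshift mE s))) => // y _;
  rewrite mxE.
Qed.

Lemma regular_epart (Y : kspace K) (U : set Y) (t : Y -> 'rV[K]_m) h : open U ->
  regular_mx U t -> regular_mx U (fun y => epart (t y) h).
Proof.
move=> oU rt; apply: (regular_fam (a := fun h => nu'' (src h)) (b := fun h =>
  nu' (tgt h))) => // r s.
by apply: (@regular_ext _ _ _ (fun y => t y r (rshift mg s))) => // y _;
  rewrite mxE.
Qed.

Lemma regular_X0 : regular_mrep (setT : set base) X0.
Proof.
move=> h; apply: (regular_mx_comp (f := (fun z : base =>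
  val z.1)) _ (@regular_rmx K Q nu' h)).
exact: is_morphism_comp (@is_morphism_fst _ _ _) (@is_morphism_val _ _ _).
Qed.

Lemma regular_X1 : regular_mrep (setT : set base) X1.
Proof.
move=> h; apply: (regular_mx_comp (f := (fun z : base =>
  val z.2)) _ (@regular_rmx K Q nu'' h)).
exact: is_morphism_comp (@is_morphism_snd _ _ _) (@is_morphism_val _ _ _).
Qed.

Lemma regular_eqn_mx : regular_mx (setT : set base) eqn_mx.
Proof.
move=> r s; apply: (@regular_ext _ _ _ (fun z =>
  eqn_fun z (delta_mx 0 r) 0 s)) => //.
  by move=> z _; rewrite mxE.
apply: (regular_unfam (M := fun z =>
  bmum (X0 z) (X1 z) (epart (delta_mx 0 r)))) => // j.
apply: (regular_bmum openT (E := fun=> epart (delta_mx 0 r))) => //.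
- exact: regular_X0.
- exact: regular_X1.
- by move=> h; exact: regular_mx_cst.
Qed.

Lemma regular_glued : regular_mrep (setT : set ext_space) glued.
Proof.
apply: (regular_conjm openT (g := fun u => gpart (params u))) => //.
- by move=> u j _; have [] := ext_spaceP u.
- by move=> j; apply: regular_gpart => //; exact: regular_params.
- apply: regular_extm => // h.
  + exact: (regular_mx_comp is_morphism_base_proj (regular_X0 (h := h))).
  + exact: (regular_mx_comp is_morphism_base_proj (regular_X1 (h := h))).
  + by apply: regular_epart => //; exact: regular_params.
Qed.

Lemma is_morphism_glue_map : is_morphism glue_map.
Proof.
apply: is_morphism_sub; apply: is_morphism_rep => h.
apply: regular_mx_ext (regular_glued (h := h)) => // u _.
by rewrite /= mxrK.
Qed.

(** The space of extensions was defined as such a locus, over the whole base;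
   the point E = 0, g = 1 lies in every fiber. *)
Lemma chart_base_proj : linear_chart base_proj setT.
Proof.
exists m, #|fam_index nu'' nu'|, eqn_mx, gl_det, (fun u => val u); split;
  first split=> //.
- exact: regular_eqn_mx.
- by move=> z _; exact: eqn_mx_full.
- split; first exact: is_morphism_val.
  have TT (u : ext_space) : (base_proj @^-1` setT) u by [].
  exists (fun u => subpoint (TT u)); split.
  + by apply: is_morphism_sub; exact: is_morphism_id.
  + by move=> u; apply: val_inj.
  + by move=> u.
move=> z _; exists (join_parts (fun=> 1%:M) (fun=> 0)); split=> //.
- by apply/gl_detP => j; rewrite gpartK unitmx1.
- apply/eqn_eq0 => j; rewrite epartK /bmum big1// => h _.
  rewrite mul0mx add0r.
  have -> : oppe (fun _ => 0) h = 0 :> 'M[K]_(nu'' (tgt h),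
    nu' (src h)) by case: (h).
  by rewrite !mulmx0 mul0mx scaler0.
Qed.

End Correspondence.

(** * Local structure of the gluing map *)

Section QuotientChart.
Variables (K : numFieldType) (Q : quiver) (i : vertex Q) (l : nat).
Variables (nu nu' nu'' : vertex Q -> nat).
Hypothesis e : forall j, nu j = (nu' j + nu'' j)%N.
Hypothesis nu''E : forall j, mult_e l i j = nu'' j.

Local Notation N := (totdim nu).
Local Notation LL := (sub_space (Lambda_il K nu i l)).
Local Notation L0 := (sub_space (Lambda_il K nu' i 0)).
Local Notation L1 := (sub_space (Lambda K nu'')).
Local Notation base := (prod_space L0 L1).
Local Notation ext_space := (ext_space K i nu nu' nu'').
Local Notation glue_map := (@glue_map K Q i l nu nu' nu'' e nu''E).

Let nu''0 j : j != i -> nu'' j = 0%N.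
Proof. by move=> /negPf ji; rewrite -nu''E /mult_e ji muln0. Qed.

Lemma mxrKf (nu0 : vertex Q -> nat) (M : mrep K nu0) : rmx (mxr M) = M.
Proof. by apply: functional_extensionality_dep => h; rewrite mxrK. Qed.

Section Unglue.
Variables (x : LL) (g : forall j, 'M[K]_(nu j)).
Hypothesis gu : forall j, g j \in unitmx.
Hypothesis gS : forall j,
  (pathspan i N (rmx (val x)) j :=: incm K (e j) *m g j)%MS.
Local Notation Z := (conjm (fun j => invmx (g j)) (rmx (val x))).

Let lx : lambda_mx (rmx (val x)). Proof. by have /(LLP e nu''E)[] := set_valP
  x. Qed.

Lemma unglue_sub : Lambda_il K nu' i 0 (mxr (subm e Z)).
Proof.
apply/(L0P i e); rewrite mxrKf; split; first exact: cut_sub_lambda gS.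
exact: cut_sub_full gS.
Qed.

Lemma unglue_quo : Lambda K nu'' (mxr (quom e Z)).
Proof. by apply/LambdaE; rewrite mxrKf; exact: cut_quo_lambda gS. Qed.

Definition unglue_base : base :=
  (@subpoint _ (rep_space K nu') (Lambda_il K nu' i 0) _ unglue_sub,
   @subpoint _ (rep_space K nu'') (Lambda K nu'') _ unglue_quo).

Lemma X0_unglue : X0 unglue_base = subm e Z. Proof. exact: mxrKf. Qed.
Lemma X1_unglue : X1 unglue_base = quom e Z. Proof. exact: mxrKf. Qed.

Lemma unglue_locus : @ext_locus K Q i nu nu' nu'' (unglue_base,
  join_parts g (offm e Z)).
Proof.
split=> //; first by apply/gl_detP => j; rewrite gpartK.
apply/eqn_eq0 => j; rewrite X0_unglue X1_unglue epartK.
exact: (cut_bmum _ lx gu gS).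
Qed.

(** The inverse of gluing, once a basis g adapted to I_i(x) is chosen. *)
Definition unglue : ext_space := subpoint unglue_locus.

Lemma glue_map_unglue : glue_map unglue = x.
Proof.
apply: val_inj; apply: rep_ext => h; rewrite rmx_glue_map /glued.
rewrite X0_unglue X1_unglue [params _]/= epartK gpartK.
by rewrite (cut_ext _ gu gS)// conjmKV.
Qed.

End Unglue.

Section Chart.
Variable y : LL.

Lemma frame_rows j : exists kappa : 'I_(nu' j) -> 'I_#|gen_index N nu|,
  row_free (rowsub kappa (pathspan i N (rmx (val y)) j)).
Proof.
by have /(LLP e nu''E)[_ /(_ j)/free_rows] := set_valP y.
Qed.

Definition kappa j := projT1 (cid (frame_rows j)).
Arguments kappa : clear implicits.
Definition compl_rows j := projT1 (cid (completion (e j) (projT2 (cid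
  (frame_rows j))))).

(** A basis of V_nu whose first vectors are images of fixed paths and whose
   other vectors are constant; at the base point it is adapted to I_i(y). *)
Definition frame (x : LL) j : 'M[K]_(nu j) :=
  retm K (e j) *m rowsub (kappa j) (pathspan i N (rmx (val x)) j) +
  prjm K (e j) *m compl_rows j.

Definition frame_dom : set LL := [set x | \prod_j \det (frame x j) != 0].

Lemma frame_domP x : frame_dom x <-> forall j, frame x j \in unitmx.
Proof.
split=> [/prodf_neq0 h j|h]; first by rewrite unitmxE unitfE; exact: h.
by apply/prodf_neq0 => j _; have := h j; rewrite unitmxE unitfE.
Qed.

Lemma frame_dom_base : frame_dom y.
Proof.
apply/frame_domP => j; exact: projT2 (cid (completion (e j) (projT2 (cid
  (frame_rows j))))).
Qed.

Lemma regular_frame j : regular_mx (setT : set LL) (frame ^~ j).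
Proof.
apply: regular_mxD => //; apply: regular_mxM => //; try exact: regular_mx_cst.
move=> r s; apply: (@regular_ext _ _ _
  (fun x : LL => pathspan i N (rmx (val x)) j (kappa j r) s)) => //.
  by move=> x _; rewrite mxE.
apply: regular_pathspan => // h.
exact: (regular_mx_comp (@is_morphism_val _ _ _) (@regular_rmx K Q nu h)).
Qed.

Lemma open_frame_dom : open frame_dom.
Proof.
apply: open_neq0T; apply: regular_prod => // j _; apply: regular_det => //.
exact: regular_frame.
Qed.

Lemma inc_frame x j :
  incm K (e j) *m frame x j = rowsub (kappa j) (pathspan i N (rmx (val x)) j).
Proof.
by rewrite mulmxDr !mulmxA inc_ret inc_prj mul1mx mul0mx addr0.
Qed.

Lemma span_eq (x : LL) (g : forall j, 'M[K]_(nu j)) j : g j \in unitmx ->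
  (incm K (e j) *m g j <= pathspan i N (rmx (val x)) j)%MS ->
  (pathspan i N (rmx (val x)) j :=: incm K (e j) *m g j)%MS.
Proof.
move=> gu le; apply/eqmx_sym/eqmxP; rewrite le /=.
have [_ <-] := mxrank_leqif_sup le.
have /(LLP e nu''E)[_ ->] := set_valP x.
by rewrite (rank_inc e).
Qed.

Lemma frame_span x j : frame_dom x ->
  (pathspan i N (rmx (val x)) j :=: incm K (e j) *m frame x j)%MS.
Proof.
move=> /frame_domP fu; apply: span_eq => //.
by rewrite inc_frame; exact: rowsub_sub.
Qed.

(** The coordinates of a vector along the constant part of the frame. *)
Definition coframe x j : 'M[K]_(nu j, nu'' j) :=
  invmx (frame x j) *m prjm K (e j).

(** Over the domain of the frame, I_i(x) is spanned by the first vectors of the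
   frame: they lie in I_i(x), which has the same dimension. *)
Lemma coframeP x m j (A : 'M[K]_(m, nu j)) : frame_dom x ->
  (A *m coframe x j = 0) <-> (A <= pathspan i N (rmx (val x)) j)%MS.
Proof.
move=> Vx; have /frame_domP fu := Vx; rewrite (frame_span j Vx) /coframe mulmxA.
split=> [A0|/submxP[M ->]]; last first.
  by rewrite -!mulmxA (mulmxA (frame x j)) mulmxV// mul1mx inc_prj mulmx0.
have -> : A = A *m invmx (frame x j) *m retm K (e j) *m (incm K (e j) *m frame
  x j).
  rewrite mulmxA -[_ *m retm _ _ *m incm _ _]mulmxA.
  have -> : retm K (e j) *m incm K (e j) = 1%:M - prjm K (e j) *m secm K (e j).
    by rewrite -(ret_inc K (e j)) addrK.
  by rewrite mulmxBr mulmx1 mulmxA A0 mul0mx subr0 mulmxKV.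
exact: submxMl.
Qed.

Local Notation mg := #|fam_index nu nu|.

(** Its vanishing says that t maps V_nu' into I_i(x). *)
Definition flag_fun x (t : 'rV[K]_mg) : 'rV[K]_#|fam_index nu' nu''| :=
  unfam (fun j => incm K (e j) *m fam t j *m coframe x j).
Definition flag_mx x : 'M[K]_(mg, #|fam_index nu' nu''|) := fmx (flag_fun x).
Definition flag_det : mpoly mg K := @fam_det K _ nu mg id.

Lemma flag_detP (t : 'rV[K]_mg) :
  reflect (forall j, fam t j \in unitmx) (meval (t 0) flag_det != 0).
Proof.
have Et : t = \row_k t 0 (id k) by apply/rowP => k; rewrite mxE.
by rewrite {1}Et; exact: fam_det_neq0.
Qed.

Lemma flag_mxE x t : t *m flag_mx x = flag_fun x t.
Proof.
apply: fmxE => c u v; rewrite /flag_fun; apply/rowP => k.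
by rewrite [LHS]mxE fam_linear mulmxDr mulmxDl -scalemxAr -scalemxAl !mxE.
Qed.

Lemma flag_eq0 x t : frame_dom x -> t *m flag_mx x = 0 <->
  forall j, (incm K (e j) *m fam t j <= pathspan i N (rmx (val x)) j)%MS.
Proof.
move=> Vx; rewrite flag_mxE; split=> h.
  move=> j; apply/coframeP => //.
  rewrite -(unfamK (fun j => incm K (e j) *m fam t j *m coframe x j))
    -/(flag_fun x t) h.
  by apply/matrixP => r s; rewrite !mxE.
by apply/rowP => k; rewrite /flag_fun /unfam mxE (coframeP _ _).2// !mxE.
Qed.

Lemma flag_mx_full x : frame_dom x -> row_full (flag_mx x).
Proof.
move=> /frame_domP fu; apply: row_full_surj => v.
(* in the frame, the matrix with the single off-diagonal block v *)
exists (unfam (fun j => retm K (e j) *m fam v j *m secm K (e j) *m frame x j)).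
rewrite flag_mxE -[RHS]famK /flag_fun; congr unfam.
apply: functional_extensionality_dep => j; rewrite unfamK /coframe !mulmxA.
by rewrite inc_ret mul1mx mulmxK// -mulmxA sec_prj mulmx1.
Qed.

Lemma regular_flag_mx : regular_mx frame_dom flag_mx.
Proof.
have oV := open_frame_dom.
move=> r s; apply: (@regular_ext _ _ _ (fun x =>
  flag_fun x (delta_mx 0 r) 0 s)) => //.
  by move=> z _; rewrite mxE.
apply: (regular_unfam (M := fun x j =>
  incm K (e j) *m fam (delta_mx 0 r) j *m coframe x j)) => // j.
apply: regular_mxM => //; first exact: regular_mx_cst.
apply: regular_mxM => //; last exact: regular_mx_cst.
apply: regular_mx_inv => //.
  by move=> x /frame_domP/(_ j); rewrite unitmxE unitfE.
exact: (regular_mx_restr openT oV (@subsetT _ _) (@regular_frame j)).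
Qed.

Local Notation flags := (lin_locus frame_dom flag_mx flag_det).

Lemma chart_locus (u : ext_space) : frame_dom (glue_map u) ->
  flags (glue_map u, lsubmx (params u) : 'rV[K]_mg).
Proof.
move=> Vu; have [gu _] := ext_spaceP u; split=> //; first by apply/flag_detP.
apply/flag_eq0 => // j; rewrite rmx_glue_map.
have h : (incm K (e j) *m gpart (params u) j <= pathspan i N (glued e u) j)%MS.
  by rewrite (glued_span e nu''E).
exact: h.
Qed.

Definition to_flags (u : sub_space (glue_map @^-1` frame_dom)) : sub_space
  flags :=
  subpoint (chart_locus (set_valP u)).

Section OfFlags.
Variable z : sub_space flags.

Lemma flags_unit j : fam ((val z).2 : 'rV[K]_mg) j \in unitmx.
Proof. by have [_ /flag_detP] := set_valP z. Qed.

Lemma flags_span j : (pathspan i N (rmx (val (val z).1)) j :=: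
  incm K (e j) *m fam ((val z).2 : 'rV[K]_mg) j)%MS.
Proof.
have [Vz _ /(flag_eq0 _ Vz)/(_ j) h] := set_valP z.
by apply: span_eq => //; exact: flags_unit.
Qed.

Definition of_flags_point : ext_space := unglue flags_unit flags_span.

Lemma of_flags_dom : (glue_map @^-1` frame_dom) of_flags_point.
Proof. by rewrite /preimage/= glue_map_unglue; have [] := set_valP z. Qed.

Definition of_flags : sub_space (glue_map @^-1` frame_dom) := subpoint
  of_flags_dom.

End OfFlags.

Lemma of_flagsK : cancel of_flags to_flags.
Proof.
move=> z; apply: val_inj; rewrite /= glue_map_unglue [RHS]surjective_pairing.
by rewrite /join_parts row_mxKl famK.
Qed.

Lemma to_flagsK : cancel to_flags of_flags.
Proof.
move=> u; apply: val_inj; apply: val_inj => /=.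
have [gu _] := ext_spaceP (val u).
have EZ : conjm (fun j => invmx (fam (lsubmx (params (val u)) : 'rV_mg) j))
  (rmx (val (glue_map (val u)))) =
    extm e (X0 (base_proj (val u))) (X1 (base_proj (val u))) (epart (params
      (val u))).
  by rewrite rmx_glue_map /glued conjmK.
rewrite [RHS]surjective_pairing; congr (_, _); last first.
  rewrite EZ -[RHS]join_partsK; congr join_parts.
  by apply: functional_extensionality_dep => h; rewrite off_extm.
rewrite [RHS]surjective_pairing; congr (_, _); apply: val_inj;
  apply: rep_ext => h.
  by rewrite /= mxrK EZ sub_extm.
by rewrite /= mxrK EZ quo_extm.
Qed.

Lemma is_morphism_to_flags : is_morphism to_flags.
Proof.
apply: is_morphism_sub; apply: (@is_morphism_pair K LL (affine_space K mg)
  (sub_space (glue_map @^-1` frame_dom)) (fun u => glue_map (val u))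
  (fun u => lsubmx (params (val u)) : 'rV[K]_mg)).
  exact: is_morphism_comp (@is_morphism_val _ _ _) (is_morphism_glue_map K e
    nu''E).
apply: is_morphism_affine => r s.
apply: (regular_comp (f := (val : sub_space (glue_map @^-1` frame_dom) ->
  ext_space))
  (h := fun u => lsubmx (params u) r s)).
  exact: is_morphism_val.
by apply: (@regular_ext _ _ _ (fun u => params u r (lshift _ s))) =>
  // [u _|]; [rewrite mxE|exact: regular_params].
Qed.

Lemma is_morphism_of_flags : is_morphism of_flags.
Proof.
pose g (z : sub_space flags) := fam ((val z).2 : 'rV[K]_mg).
pose Z (z : sub_space flags) := conjm (fun j =>
  invmx (g z j)) (rmx (val (val z).1)).
have rg j : regular_mx setT (g ^~ j).
  apply: regular_fam => //.
  apply: (regular_mx_comp (f := (fun z : sub_space flags =>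
    (val z).2 : affine_space K mg)) _ (@regular_mx_affine K mg)).
  exact: is_morphism_comp (@is_morphism_val _ _ _) (@is_morphism_snd _ _ _).
have rZ : regular_mrep setT Z.
  apply: (regular_conjm openT (g := fun z j => invmx (g z j))) => //.
  - by move=> z j _; rewrite unitmx_inv; exact: flags_unit.
  - move=> j; apply: regular_mx_inv => // z _.
    by have := flags_unit z j; rewrite unitmxE unitfE.
  - move=> h; apply: (regular_mx_comp (f := fun z : sub_space flags =>
      val (val z).1) _ (@regular_rmx K Q nu h)).
    apply: is_morphism_comp (@is_morphism_val _ _ _).
    exact: is_morphism_comp (@is_morphism_val _ _ _) (@is_morphism_fst _ _ _).
apply: is_morphism_sub; apply: is_morphism_sub.
apply: (@is_morphism_pair _ base (affine_space K _) _
  (fun z => unglue_base (flags_unit z) (flags_span z))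
  (fun z => join_parts (g z) (offm e (Z z)))).
  apply: (@is_morphism_pair _ L0 L1 _
    (fun z => subpoint (unglue_sub (flags_unit z) (flags_span z)))
    (fun z => subpoint (unglue_quo (flags_unit z) (flags_span z)))).
    apply: is_morphism_sub; apply: is_morphism_rep => h.
    apply: regular_mx_ext (regular_subm openT e rZ (h := h)) => // z _.
    by rewrite /= mxrK.
  apply: is_morphism_sub; apply: is_morphism_rep => h.
  apply: regular_mx_ext (regular_quom openT e rZ (h := h)) => // z _.
  by rewrite /= mxrK.
apply: is_morphism_affine => r s.
have rL : regular_mx setT (fun z => unfam (g z)) by apply: regular_unfam.
have rR : regular_mx setT (fun z =>
  unfam (offm e (Z z) : forall h, 'M_(nu'' (src h), nu' (tgt h)))).
  by apply: regular_unfam => // h; exact: regular_offm.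
case: (split_ordP s) => s' ->.
  by apply: regular_ext (rL r s') => // z _; rewrite /join_parts row_mxEl.
by apply: regular_ext (rR r s') => // z _; rewrite /join_parts row_mxEr.
Qed.

(** A point over x is determined by g: the blocks are read off from the
   conjugate of x by the inverse of g. *)
Lemma chart_glue_map : linear_chart glue_map frame_dom.
Proof.
exists mg, #|fam_index nu' nu''|, flag_mx, flag_det, to_flags; split;
  first split.
- exact: open_frame_dom.
- exact: regular_flag_mx.
- exact: flag_mx_full.
- split; first exact: is_morphism_to_flags.
  exists of_flags; split; first exact: is_morphism_of_flags.
    exact: to_flagsK.
  exact: of_flagsK.
- by [].
move=> x Vx; have /frame_domP fu := Vx.
exists (unfam (frame x)); split=> //=.
  by apply/flag_detP => j; rewrite unfamK.
by apply/flag_eq0 => // j; rewrite unfamK inc_frame; exact: rowsub_sub.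
Qed.

End Chart.
End QuotientChart.

(** * The space of extensions is a variety *)

Section VarietyCriteria.
Variables (K : fieldType).

(** The regular functions separate the points, so the equalizer of two
   morphisms is an intersection of zero sets of regular functions. *)
Lemma separated_regular (X : kspace K) :
  (forall x y : X, (forall F, regular setT F -> F x = F y) -> x = y) ->
  Defs.separated X.
Proof.
move=> inj Y f g _ mf mg.
have -> : [set y | f y = g y] =
    \bigcap_(F in regular (setT : set X)) [set y | F (f y) - F (g y) = 0].
  apply/seteqP; split=> [y /= E F _|y h]; first by rewrite /= E subrr.
  by apply: inj => F rF; apply/eqP; rewrite -subr_eq0; exact/eqP/h.
apply: closed_bigI => F rF; apply: closed_eq0; apply: regularB => //.
  exact: (regular_comp mf rF).
exact: (regular_comp mg rF).
Qed.

(** The condition on g is stated for points a with a given value, so that it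
   does not mention the proof that the image lies in A. *)
Lemma affine_variety_embed (Z : kspace K) n (A : set (affine_space K n))
    (f : Z -> 'rV[K]_n) (g : sub_space A -> Z) :
  closed A -> regular_mx setT f -> (forall z, A (f z)) -> is_morphism g ->
  (forall z a, val a = f z -> g a = z) -> (forall a, f (g a) = val a) ->
  affine_variety Z.
Proof.
move=> cA rf Af mg gf fg.
exists n, A, (fun z => subpoint (Af z)); split=> //; split.
  by apply: is_morphism_sub; exact: (is_morphism_affine rf).
exists g; split=> //; first by move=> z; exact: gf.
by move=> a; apply: val_inj; exact: fg.
Qed.

Lemma closed_mx_eq0 (X : kspace K) m n (M : X -> 'M[K]_(m, n)) :
  regular_mx setT M -> closed [set x | M x = 0].
Proof.
move=> rM; have -> : [set x | M x = 0] =
    \bigcap_(ab in [set: 'I_m * 'I_n]) [set x | M x ab.1 ab.2 = 0].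
  apply/seteqP; split=> [x Mx ab _|x h]; first by rewrite /= (Mx : M x = 0) mxE.
  by apply/matrixP => a b; rewrite mxE; exact: (h (a, b)).
by apply: closed_bigI => ab _; apply: closed_eq0; exact: rM.
Qed.

(** The moment map equation and the vanishing of paths are polynomial
   conditions. *)
Lemma closed_Lambda (Q : quiver) (nu : vertex Q -> nat) : closed (Lambda K nu).
Proof.
have -> : Lambda K nu = [set x : rep_space K nu |
    (\bigcap_(j in setT) [set x : rep_space K nu | mum (rmx x) j = 0]) x /\
    (\bigcap_(p in [set p : seq (dbl Q) * (vertex Q * vertex Q) |
       (totdim nu <= count (@letter Q) p.1)%N])
      [set x : rep_space K nu | pathmx (rmx x) p.1 p.2.1 p.2.2 = 0]) x].
  apply/seteqP; split=> x.
    move=> /LambdaP[m0 nx]; split=> [j _|p hp]; [exact: m0|exact: nx].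
  move=> [m0 nx]; apply/LambdaP; split=> [j|w j k h]; first exact: m0.
  exact: (nx (w, (j, k))).
apply: closedI; apply: closed_bigI => p _; apply: closed_mx_eq0.
  by apply: regular_mum => // h; exact: regular_rmx.
by apply: regular_pathmx => // h; exact: regular_rmx.
Qed.

End VarietyCriteria.

Section ExtSpaceVariety.
Variables (K : numFieldType) (Q : quiver) (i : vertex Q).
Variables (nu nu' nu'' : vertex Q -> nat).
Hypothesis e : forall j, nu j = (nu' j + nu'' j)%N.

Local Notation N := (totdim nu).
Local Notation L0 := (sub_space (Lambda_il K nu' i 0)).
Local Notation L1 := (sub_space (Lambda K nu'')).
Local Notation base := (prod_space L0 L1).
Local Notation ext_space := (ext_space K i nu nu' nu'').

Lemma ext_space_eq (u v : ext_space) : (forall h,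
  X0 (base_proj u) h = X0 (base_proj v) h) ->
  (forall h, X1 (base_proj u) h = X1 (base_proj v) h) ->
    params u = params v -> u = v.
Proof.
move=> E0 E1 Et; apply: val_inj.
rewrite [LHS]surjective_pairing [RHS]surjective_pairing; congr (_, _) => //.
rewrite [LHS]surjective_pairing [RHS]surjective_pairing.
by congr (_, _); apply: val_inj; apply: rep_ext.
Qed.

Lemma regular_X0_base_proj : regular_mrep (setT : set ext_space) (fun u =>
  X0 (base_proj u)).
Proof.
move=> h; apply: (regular_mx_comp (@is_morphism_base_proj K Q i nu nu' nu'')
  (@regular_X0 K Q i nu' nu'' h)).
Qed.

Lemma regular_X1_base_proj : regular_mrep (setT : set ext_space) (fun u =>
  X1 (base_proj u)).
Proof.
move=> h; apply: (regular_mx_comp (@is_morphism_base_proj K Q i nu nu' nu'')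
  (@regular_X1 K Q i nu' nu'' h)).
Qed.

Lemma separated_ext_space : Defs.separated ext_space.
Proof.
apply: separated_regular => u v E; apply: ext_space_eq.
- by move=> h; apply/matrixP => a b;
    exact: (E (fun u => X0 (base_proj u) h a b) (@regular_X0_base_proj h a b)).
- by move=> h; apply/matrixP => a b;
    exact: (E (fun u => X1 (base_proj u) h a b) (@regular_X1_base_proj h a b)).
- apply/matrixP => a b; exact: (E (fun u =>
    params u a b) (@regular_params K Q i nu nu' nu'' a b)).
Qed.

Section Piece.
Variable kappa : 'I_(nu' i) -> 'I_#|gen_index N nu'|.

Definition minor (Y : mrep K nu') : K := \det (rowsub kappa (pathspan i N Y i)).

Definition piece : set ext_space := [set u | minor (X0 (base_proj u)) != 0].

Lemma regular_minor (X : kspace K) (Y : X -> mrep K nu') :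
  regular_mrep setT Y -> regular setT (fun x => minor (Y x)).
Proof.
move=> rY; apply: regular_det => // a b.
apply: (@regular_ext _ _ _ (fun x => pathspan i N (Y x) i (kappa a) b)) => //.
  by move=> x _; rewrite mxE.
exact: regular_pathspan.
Qed.

Lemma open_piece : open piece.
Proof. by apply: open_neq0T; apply: regular_minor;
  exact: regular_X0_base_proj. Qed.

(** At a vertex other than i the empty path already spans everything. *)
Lemma minor_full (Y : mrep K nu') : minor Y != 0 ->
  forall j, row_full (pathspan i N Y j).
Proof.
move=> mY j; have [->|ji] := eqVneq j i; last exact: pathspan_id.
rewrite -sub1mx; apply: submx_trans (rowsub_sub kappa _).
by rewrite sub1mx row_full_unit unitmxE unitfE.
Qed.

Local Notation m := (#|gl_index nu| + #|off_index nu' nu''|)%N.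
Local Notation d0 := #|fam_index (fun h : dbl Q => nu' (src h)) (fun h =>
  nu' (tgt h))|.
Local Notation d1 := #|fam_index (fun h : dbl Q => nu'' (src h)) (fun h =>
  nu'' (tgt h))|.
Local Notation amb := ((d0 + d1) + (m + 1))%N.

(** A point of the ambient affine space of a piece consists of coordinates of
   x0 and x1, of the parameters (g, E), and of one more coordinate, the inverse
   of the minor times the determinants of the g_j. *)
Definition amb0 (v : 'rV[K]_amb) : mrep K nu' := fam (lsubmx (lsubmx v)).
Definition amb1 (v : 'rV[K]_amb) : mrep K nu'' := fam (rsubmx (lsubmx v)).
Definition ambt (v : 'rV[K]_amb) : 'rV[K]_m := lsubmx (rsubmx v).
Definition ambs (v : 'rV[K]_amb) : K := rsubmx (rsubmx v) 0 0.

Definition piece_det (v : 'rV[K]_amb) : K :=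
  minor (amb0 v) * meval (ambt v 0) (gl_det K nu nu' nu'').

Definition piece_image : set (affine_space K amb) :=
  [set v : 'rV[K]_amb | [/\ Lambda K nu' (mxr (amb0 v)),
    Lambda K nu'' (mxr (amb1 v)),
     (forall j, bmum (amb0 v) (amb1 v) (epart (ambt v)) j = 0) &
     ambs v * piece_det v - 1 = 0]].

Let regular_sub (X : kspace K) a b (f : X ->
  'rV[K]_(a + b)) : regular_mx setT f ->
  regular_mx setT (fun x => lsubmx (f x)) /\ regular_mx setT (fun x =>
    rsubmx (f x)).
Proof.
move=> rf; split=> r s.
  by apply: (@regular_ext _ _ _ (fun x => f x r (lshift b s))) => // x _;
    rewrite mxE.
by apply: (@regular_ext _ _ _ (fun x => f x r (rshift a s))) => // x _;
  rewrite mxE.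
Qed.

Section Regular.
Variables (X : kspace K) (v : X -> 'rV[K]_amb).
Hypothesis rv : regular_mx setT v.

Lemma regular_amb0 : regular_mrep setT (fun x => amb0 (v x)).
Proof.
by move=> h; apply: regular_fam => //; apply: (regular_sub _).1;
  exact: (regular_sub rv).1.
Qed.

Lemma regular_amb1 : regular_mrep setT (fun x => amb1 (v x)).
Proof.
by move=> h; apply: regular_fam => //; apply: (regular_sub _).2;
  exact: (regular_sub rv).1.
Qed.

Lemma regular_ambt : regular_mx setT (fun x => ambt (v x)).
Proof. by apply: (regular_sub _).1; exact: (regular_sub rv).2. Qed.

Lemma regular_ambs : regular setT (fun x => ambs (v x)).
Proof. by apply: (regular_sub _).2; exact: (regular_sub rv).2. Qed.

Lemma regular_piece_det : regular setT (fun x => piece_det (v x)).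
Proof.
apply: regularM => //; first by apply: regular_minor; exact: regular_amb0.
by apply: regular_meval => // k; exact: regular_ambt.
Qed.

End Regular.

Let rid := @regular_mx_affine K amb.

Lemma closed_piece_image : closed piece_image.
Proof.
have -> : piece_image =
    ((fun v : affine_space K amb =>
      mxr (amb0 v) : rep_space K nu') @^-1` Lambda K nu' `&`
     (fun v : affine_space K amb =>
       mxr (amb1 v) : rep_space K nu'') @^-1` Lambda K nu'') `&`
    (\bigcap_(j in setT) [set v : affine_space K amb |
      bmum (amb0 v) (amb1 v) (epart (ambt v)) j = 0] `&`
     [set v : affine_space K amb | ambs v * piece_det v - 1 = 0]).
  apply/seteqP; split=> v.
    by move=> [h0 h1 hb hs]; split; split=> // j _; exact: hb.
  by move=> [[h0 h1] [hb hs]]; split=> // j; exact: hb.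
apply: closedI; apply: closedI.
- apply: closed_preimage (@closed_Lambda K Q nu'); apply: is_morphism_rep => h.
  by apply: regular_mx_ext (regular_amb0 rid (h := h)) => // v _; rewrite mxrK.
- apply: closed_preimage (@closed_Lambda K Q nu''); apply: is_morphism_rep => h.
  by apply: regular_mx_ext (regular_amb1 rid (h := h)) => // v _; rewrite mxrK.
- apply: closed_bigI => j _; apply: closed_mx_eq0; apply: regular_bmum => //.
  + exact: regular_amb0.
  + exact: regular_amb1.
  + by move=> h; apply: regular_epart => //; exact: regular_ambt.
- apply: closed_eq0; apply: regularB => //; last exact: regular_cst.
  by apply: regularM => //; [exact: regular_ambs|exact: regular_piece_det].
Qed.

Definition piece_coord (u : sub_space piece) : 'rV[K]_amb :=
  row_mx
    (row_mx (unfam (X0 (base_proj (val u)) : forall h, 'M_(nu' (src h),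
      nu' (tgt h))))
            (unfam (X1 (base_proj (val u)) : forall h, 'M_(nu'' (src h),
              nu'' (tgt h)))))
    (row_mx (params (val u))
       ((minor (X0 (base_proj (val u))) * meval (params (val u) 0) (gl_det K nu
         nu' nu''))^-1)%:M).

Lemma piece_coordE u :
  [/\ amb0 (piece_coord u) = X0 (base_proj (val u)),
    amb1 (piece_coord u) = X1 (base_proj (val u)),
      ambt (piece_coord u) = params (val u) &
      ambs (piece_coord u) =
        (minor (X0 (base_proj (val u))) * meval (params (val u) 0) (gl_det K nu
          nu' nu''))^-1].
Proof.
rewrite /amb0 /amb1 /ambt /ambs /piece_coord !(row_mxKl, row_mxKr).
by split; rewrite ?mxE ?eqxx//; apply: functional_extensionality_dep => h;
  rewrite unfamK.
Qed.

Lemma piece_neq0 (u : sub_space piece) :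
  minor (X0 (base_proj (val u))) * meval (params (val u) 0) (gl_det K nu nu'
    nu'') != 0.
Proof.
apply: mulf_neq0; first exact: (set_valP u).
by apply/gl_detP; have [] := ext_spaceP (val u).
Qed.

Lemma piece_coord_image u : piece_image (piece_coord u).
Proof.
have [E0 E1 Et Es] := piece_coordE u.
split; rewrite /piece_det ?E0 ?E1 ?Et ?Es.
- by apply/LambdaE; rewrite mxrKf; exact: (base_lambda0 e).
- by apply/LambdaE; rewrite mxrKf; exact: base_lambda1.
- by have [] := ext_spaceP (val u).
- by rewrite mulVf ?subrr// piece_neq0.
Qed.

Section OfImage.
Variable a : sub_space piece_image.
Local Notation v := (val a : 'rV[K]_amb).

Lemma image_neq0 : minor (amb0 v) != 0 /\ meval (ambt v 0) (gl_det K nu nu'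
  nu'') != 0.
Proof.
have [_ _ _ /eqP] := set_valP a; rewrite subr_eq0 => /eqP E.
have : ambs v * piece_det v != 0 by rewrite E oner_neq0.
by rewrite !mulf_eq0 !negb_or => /and3P[].
Qed.

Lemma image_L0 : Lambda_il K nu' i 0 (mxr (amb0 v)).
Proof.
have [h0 _ _ _] := set_valP a; have [m0 _] := image_neq0.
by apply/(L0P i e); split; [exact/LambdaE|rewrite mxrKf; exact: minor_full].
Qed.

Lemma image_L1 : Lambda K nu'' (mxr (amb1 v)).
Proof. by have [] := set_valP a. Qed.

Definition image_base : base :=
  (@subpoint _ (rep_space K nu') (Lambda_il K nu' i 0) _ image_L0,
   @subpoint _ (rep_space K nu'') (Lambda K nu'') _ image_L1).

Lemma image_locus : @ext_locus K Q i nu nu' nu'' (image_base, ambt v).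
Proof.
have [_ _ hb _] := set_valP a; have [_ d0] := image_neq0.
split=> //; apply/eqn_eq0 => j.
have -> : X0 image_base = amb0 v by exact: mxrKf.
by have -> : X1 image_base = amb1 v by exact: mxrKf.
Qed.

Lemma image_piece : piece (subpoint image_locus).
Proof.
have [m0 _] := image_neq0; rewrite /piece/=.
by have -> : X0 (base_proj (subpoint image_locus)) = amb0 v by exact: mxrKf.
Qed.

Definition of_image : sub_space piece := subpoint image_piece.

End OfImage.

Lemma is_morphism_of_image : is_morphism of_image.
Proof.
have rv : regular_mx setT (fun a : sub_space piece_image => val a : 'rV[K]_amb).
  exact: (regular_mx_comp (@is_morphism_val _ _ _) rid).
apply: is_morphism_sub; apply: is_morphism_sub.
apply: (@is_morphism_pair K base (affine_space K m) (sub_space piece_image)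
  image_base (fun a => ambt (val a))); last first.
  by apply: is_morphism_affine; exact: regular_ambt.
apply: (@is_morphism_pair K L0 L1 (sub_space piece_image)
  (fun a => subpoint (image_L0 a)) (fun a => subpoint (image_L1 a))).
  apply: is_morphism_sub; apply: is_morphism_rep => h.
  by apply: regular_mx_ext (regular_amb0 rv (h := h)) => // a _;
    rewrite /= mxrK.
apply: is_morphism_sub; apply: is_morphism_rep => h.
by apply: regular_mx_ext (regular_amb1 rv (h := h)) => // a _; rewrite /= mxrK.
Qed.

Lemma regular_piece_coord : regular_mx setT piece_coord.
Proof.
have mv := @is_morphism_val K ext_space piece.
have r0 h : regular_mx setT (fun u : sub_space piece =>
  X0 (base_proj (val u)) h).
  exact: (regular_mx_comp mv (regular_X0_base_proj (h := h))).
have r1 h : regular_mx setT (fun u : sub_space piece =>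
  X1 (base_proj (val u)) h).
  exact: (regular_mx_comp mv (regular_X1_base_proj (h := h))).
have rt : regular_mx setT (fun u : sub_space piece => params (val u)).
  exact: (regular_mx_comp mv (@regular_params K Q i nu nu' nu'')).
have rrow (X : kspace K) a b (f : X -> 'rV[K]_a) (g : X -> 'rV[K]_b) :
    regular_mx setT f -> regular_mx setT g ->
    regular_mx setT (fun x => row_mx (f x) (g x)).
  move=> rf rg r s; case: (split_ordP s) => s' ->.
    by apply: regular_ext (rf r s') => // x _; rewrite row_mxEl.
  by apply: regular_ext (rg r s') => // x _; rewrite row_mxEr.
apply: (rrow); first by apply: (rrow); apply: regular_unfam.
apply: (rrow) => // r s.
apply: (@regular_ext _ _ _ (fun u : sub_space piece =>
  (minor (X0 (base_proj (val u))) *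
  meval (params (val u) 0) (gl_det K nu nu' nu''))^-1)) => //.
  by move=> u _; rewrite !ord1 mxE eqxx.
apply: regular_inv => //; first by move=> u _; exact: piece_neq0.
apply: regularM => //; first exact: regular_minor.
by apply: regular_meval => // k; exact: rt.
Qed.

Lemma affine_piece : affine_variety (sub_space piece).
Proof.
apply: (affine_variety_embed closed_piece_image regular_piece_coord
  piece_coord_image is_morphism_of_image).
- move=> u a Ea; apply: val_inj; have [E0 E1 Et Es] := piece_coordE u.
  apply: ext_space_eq.
  + by move=> h; rewrite /X0 /= mxrK Ea E0.
  + by move=> h; rewrite /X1 /= mxrK Ea E1.
  + by rewrite /params /= Ea Et.
- move=> a; have [E0 E1 Et Es] := piece_coordE (of_image a).
  have [_ _ _ /eqP] := set_valP a; rewrite subr_eq0 => /eqP hs.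
  rewrite -[LHS]hsubmxK -[RHS]hsubmxK; congr row_mx.
    rewrite -[LHS]hsubmxK -[RHS]hsubmxK; congr row_mx.
      rewrite -[LHS]famK -[RHS]famK; congr unfam.
      by rewrite -/(amb0 _) E0; exact: mxrKf.
    rewrite -[LHS]famK -[RHS]famK; congr unfam.
    by rewrite -/(amb1 _) E1; exact: mxrKf.
  rewrite -[LHS]hsubmxK -[RHS]hsubmxK; congr row_mx; first exact: Et.
  apply/matrixP => r s; rewrite !ord1 -/(ambs _) Es -/(ambs _).
  have -> : X0 (base_proj (val (of_image a))) = amb0 (val a) by exact: mxrKf.
  have pd0 : piece_det (val a) != 0.
    by apply/eqP => E; move/eqP: hs; rewrite E mulr0 eq_sym oner_eq0.
  by apply: (mulIf pd0); rewrite hs; exact: mulVf.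
Qed.

End Piece.

Lemma prevariety_ext_space : prevariety ext_space.
Proof.
pose I : finType := {ffun 'I_(nu' i) -> 'I_#|gen_index N nu'|}.
exists #|I|, (fun k : 'I_#|I| => piece (fun r =>
  (enum_val k : {ffun _ -> _}) r)); split.
  by move=> k; split; [exact: open_piece|exact: affine_piece].
move=> u; have fu := base_full e (base_proj u) i.
have [kappa fk] := free_rows (eqP fu).
exists (enum_rank ([ffun r => kappa r] : I));
  rewrite enum_rankK /piece /minor /=.
rewrite -unitfE -unitmxE -row_free_unit.
suff -> : rowsub [ffun r => kappa r] (pathspan i N (X0 (base_proj u)) i) =
    rowsub kappa (pathspan i N (X0 (base_proj u)) i) by [].
by apply/matrixP => r s; rewrite !mxE ffunE.
Qed.

Lemma variety_ext_space : variety ext_space.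
Proof. by split; [exact: prevariety_ext_space|exact: separated_ext_space]. Qed.

End ExtSpaceVariety.

Theorem proposition1p14 (R : realType) (Q : quiver) (i : vertex Q) (l : nat)
    (nu : vertex Q -> nat) (l_gt0 : (0 < l)%N) (l_le : (l <= nu i)%N) :
  let LL := sub_space (Lambda_il R[i] nu i l) in
  let L0 := sub_space (Lambda_il R[i] (fun j => nu j - mult_e l i j)%N i 0) in
  let L1 := sub_space (Lambda R[i] (mult_e l i)) in
  exists (X : kspace R[i]) (q : X -> LL) (p : X -> prod_space L0 L1),
    [/\ variety X,
        smooth q /\ connected_fibers q,
        smooth p /\ connected_fibers p &
        exists Phi : set LL -> set L0 * set L1,
          set_bij (irr LL) (irr L0 `*` irr L1) Phi /\
          forall Z Z0 Z1, irr LL Z -> irr L0 Z0 -> irr L1 Z1 ->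
            (Phi Z = (Z0, Z1) <-> q @^-1` Z = p @^-1` (Z0 `*` Z1))].
Proof.
move=> LL L0 L1.
have e j : nu j = ((nu j - mult_e l i j) + mult_e l i j)%N.
  rewrite subnK// /mult_e; have [->|_] := eqVneq j i; first by rewrite muln1.
  by rewrite muln0.
have nE j : mult_e l i j = mult_e l i j by [].
pose q := glue_map (K := R[i]) e nE.
pose p := @base_proj R[i] Q i nu (fun j => nu j - mult_e l i j)%N (mult_e l i).
have mq : is_morphism q by exact: is_morphism_glue_map.
have mp : is_morphism p by exact: is_morphism_base_proj.
have chq y : exists2 V, V y & linear_chart q V.
  by exists (frame_dom e nE y); [exact: frame_dom_base|exact: chart_glue_map].
have chp y : exists2 V, V y & linear_chart p V.
  by exists setT => //; exact: (chart_base_proj _ e nE).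
exists (ext_space R[i] i nu (fun j =>
  nu j - mult_e l i j)%N (mult_e l i)), q, p.
split.
- exact: variety_ext_space e.
- by split; [exact: smooth_chart|exact: connected_fibers_chart].
- by split; [exact: smooth_chart|exact: connected_fibers_chart].
- apply: irr_correspondence.
  + exact: mq.1.
  + by move=> A; exact: open_chart.
  + exact: irreducible_fiber_chart.
  + exact: mp.1.
  + by move=> A; exact: open_chart.
  + exact: irreducible_fiber_chart.
Qed.
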